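(* Let $d\in \mathbb{N}$ and $\mathbf{s}=(s_1,\dots,s_d)\in\mathbb{N}^d$ with $s_1\ge 3$, $|\mathbf{s}|=s_1+\cdots+s_d$. For each $j$ let $l_j$ be one of the functions $m\mapsto 2m$, $m\mapsto 2m+1$, $m\mapsto 2m-1$; put $\nu(l)=1$ if $l(m)=2m-1$ and $\nu(l)=0$ otherwise; let $\succ_j$ be ''$\ge$'' if $l_j(m)=2m+1$ and ''$>$'' otherwise, and set \[ T=\sum_{n_1 \succ_1 \cdots \succ_{d-1} n_d\succ_d 0}\frac{ b_{n_1}^2}{l_1(n_1)^{s_1}\cdots l_d(n_d)^{s_d}}. \] (a) If $l_1(m)\ne 2m-1$ and for every $j\ge2$ with $l_j(m)=2m-1$ we have $l_{j-1}(m)\ne 2m$, then $T\in \mathsf{CMZV}^4_{|\mathbf{s}|}$. In particular this holds if $l_1(m)=2m+1$ and $l_j(m)\ne 2m$ for all $j$. If instead $l_1(m)=2m-1$ and for every $j\ge2$ with $l_j(m)=2m-1$ we have $l_{j-1}(m)\ne 2m$, then $T\in \mathsf{CMZV}^4_{|\mathbf{s}|}+\mathsf{CMZV}^4_{|\mathbf{s}|+1}+\mathsf{CMZV}^4_{|\mathbf{s}|+2}$. (b) In general, $T\in \mathsf{CMZV}^4_{\le |\mathbf{s}|+2\nu(l_1)}\otimes\mathbb{Q}[i]$. (c) The claim in (b) still holds if any of the relations between consecutive indices $n_j,n_{j+1}$ ($1\le j\le d$, $n_{d+1}=0$) is changed from ''$>$'' to ''$\ge$'' or vice versa, provided the series is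 defined; i.e. for arbitrary choices of each ''$\succ$'' among ''$\ge$'', ''$>$'', \[ \sum_{n_1\succ\cdots\succ n_d \succ 0}\frac{ b_{n_1}^2}{l_1(n_1)^{s_1}\cdots l_d(n_d)^{s_d}} \in \mathsf{CMZV}^4_{\le |\mathbf{s}|+2\nu(l_1)}\otimes\mathbb{Q}[i]. \]
   Context: $b_n=4^n\binom{2n}{n}^{-1}$ for $n\in\mathbb{N}_0$. For $\mathbf{k}\in\mathbb{N}^r$ and fourth roots of unity $z_1,\dots,z_r$ with $(k_1,z_1)\ne(1,1)$, $\operatorname{Li}_{\mathbf{k}}(\mathbf{z})=\sum_{m_1>\cdots>m_r>0} \frac{z_1^{m_1}\cdots z_r^{m_r}}{m_1^{k_1}\cdots m_r^{k_r}}$ (a colored multiple zeta value of level 4 and weight $k_1+\cdots+k_r$). $\mathsf{CMZV}^4_w$ is the $\mathbb{Q}$-span of all such values of weight $w$ ($\mathsf{CMZV}^4_0=\mathbb{Q}$), $\mathsf{CMZV}^4_{\le w}=\sum_{k\le w}\mathsf{CMZV}^4_k$, and $V\otimes\mathbb{Q}[i]$ is the $\mathbb{Q}[i]$-span of $V$. *)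

(* Defs.v *)
From mathcomp Require Import all_boot all_order all_algebra.
From mathcomp Require Import all_classical all_reals all_analysis.
From mathcomp Require Import complex.

Set Implicit Arguments.
Unset Strict Implicit.
Unset Printing Implicit Defensive.

Import Order.TTheory GRing.Theory Num.Theory numFieldNormedType.Exports.
Local Open Scope classical_set_scope.
Local Open Scope ring_scope.

(* The complex numbers over R. Going through numClosedFieldType lets the       *)
(* canonical topology of a numFieldType (the one of the modulus) apply.        *)
Definition Cplx (R : realType) : numClosedFieldType := R[i].

Section NestedSums.
Variable d : nat.

(* n_{k+1}, with the convention n_{d+1} = 0 (indices are 0-based here). *)
Definition index_at (n : 'I_d -> nat) (k : nat) : nat :=
  if insub k is Some j then n j else 0%N.

(* n_1 >_1 n_2 >_2 ... n_d >_d 0, where the relation following n_j is ">" if   *)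
(* strict j holds and ">=" otherwise.                                          *)
Definition chain (strict : 'I_d -> bool) (n : 'I_d -> nat) : bool :=
  [forall j : 'I_d, if strict j then (index_at n j.+1 < n j)%N
                    else (index_at n j.+1 <= n j)%N].

(* Restriction of the nested sum of F to the finitely many chains with n_1 < N *)
(* (a chain is weakly decreasing, so this bounds all the indices); the value   *)
(* of a nested series is the limit as N goes to infinity.                      *)
Definition nested_sum (V : nmodType) (strict : 'I_d -> bool)
    (F : ('I_d -> nat) -> V) (N : nat) : V :=
  \sum_(n : {ffun 'I_d -> 'I_N} | chain strict (fun j => n j : nat))
    F (fun j => n j : nat).

End NestedSums.

Section ColoredMZV.
Variable R : realType.
Local Notation C := (Cplx R).

Definition Li (r : nat) (k : 'I_r -> nat) (z : 'I_r -> C) : C :=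
  limn (nested_sum (fun=> true)
    (fun m => \prod_(j < r) (z j ^+ m j / (m j)%:R ^+ k j))).

Definition admissible4 (r : nat) (k : 'I_r -> nat) (z : 'I_r -> C) : Prop :=
  [/\ forall j, (0 < k j)%N,
      forall j, z j ^+ 4 = 1 &
      forall j : 'I_r, j = 0%N :> nat -> ~ (k j = 1%N /\ z j = 1)].

Definition span_over (K S : set C) : set C :=
  [set x | exists (n : nat) (c v : 'I_n -> C),
     [/\ forall i, K (c i), forall i, S (v i) & x = \sum_(i < n) c i * v i]].

Definition rationals : set C := range (ratr : rat -> C).

Definition gaussian_rationals : set C :=
  [set ratr a + ratr b * 'i | a in [set: rat] & b in [set: rat]].

(* In weight 0 the only generator is the empty sum (r = 0), whose value is 1,  *)
(* so that CMZV4 0 is the set of rational numbers.                             *)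
Definition CMZV4 (w : nat) : set C :=
  span_over rationals
    [set x | exists (r : nat) (k : 'I_r -> nat) (z : 'I_r -> C),
       [/\ admissible4 k z, (\sum_(j < r) k j)%N = w & x = Li k z]].

Definition add_spaces (A B : set C) : set C := [set a + b | a in A & b in B].

Definition CMZV4_le (w : nat) : set C :=
  \big[add_spaces/[set 0]]_(k < w.+1) CMZV4 k.

Definition tensor_Qi (V : set C) : set C := span_over gaussian_rationals V.

End ColoredMZV.

(* The functions m |-> 2m, m |-> 2m+1 and m |-> 2m-1. *)
Inductive lin_fun := Two | TwoPlus1 | TwoMinus1.

Definition lin_eval (l : lin_fun) (m : nat) : int :=
  match l with
  | Two => 2 * m%:Z
  | TwoPlus1 => 2 * m%:Z + 1
  | TwoMinus1 => 2 * m%:Z - 1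
  end.

Definition nu (l : lin_fun) : nat := if l is TwoMinus1 then 1%N else 0%N.

Definition default_strict (l : lin_fun) : bool :=
  if l is TwoPlus1 then false else true.

Section InverseBinomialSums.
Variable R : realType.

Definition b_ (n : nat) : R := 4 ^+ n * ('C(2 * n, n)%:R)^-1.

Section Fixed.
Variables (d : nat) (l : 'I_d.+1 -> lin_fun) (s : 'I_d.+1 -> nat).

Definition binom_term (n : 'I_d.+1 -> nat) : R :=
  b_ (n ord0) ^+ 2 / \prod_(j < d.+1) (lin_eval (l j) (n j))%:~R ^+ s j.

Definition binom_partial (strict : 'I_d.+1 -> bool) (N : nat) : R :=
  nested_sum strict binom_term N.

Definition binom_series (strict : 'I_d.+1 -> bool) : R :=
  limn (binom_partial strict).

(* No term of the series has a vanishing denominator (this can fail only when  *)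
(* some n_j = 0 is allowed although l_j(m) = 2m).                              *)
Definition terms_defined (strict : 'I_d.+1 -> bool) : Prop :=
  forall n : 'I_d.+1 -> nat, chain strict n ->
  forall j, lin_eval (l j) (n j) != 0.

End Fixed.
End InverseBinomialSums.

(* Main.v *)
Require Import Defs.
From mathcomp Require Import all_boot all_order all_algebra.
From mathcomp Require Import all_classical all_reals all_analysis.
From mathcomp Require Import complex.
From mathcomp Require Import ring lra zify.

Set Implicit Arguments.
Unset Strict Implicit.
Unset Printing Implicit Defensive.

Import Order.TTheory GRing.Theory Num.Theory numFieldNormedType.Exports.
Local Open Scope classical_set_scope.
Local Open Scope ring_scope.

(* Put x = sin theta. For a sequence g, the function
     phi_g = cos theta * x * \sum_n b_n / (2n+1) (\sum_(m <= n) g_m) x^(2n)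
   is the primitive in theta of \sum_n b_n g_n x^(2n). Hence the generating series of
   b_n times a nested sum is an iterated integral of dtheta, dtheta / sin, cot and tan, and
   the Wallis integral of sin^(2n-1) supplies the second factor b_n at theta = pi / 2. With
   u = tan (theta / 2) the four forms have Taylor coefficients that are 4-periodic, i.e.
   combinations of powers of fourth roots of unity, so the value at u = 1 is a combination
   of colored multiple zeta values of level 4; only dtheta needs coefficients in i Q, and its
   number of occurrences is even. Primitives are handled through the derivatives of power
   series in u on ]0, 1[.
   A factor 1/(2n-1) is a shifted 1/(2n+1) because b_(n+1) = b_n (2n+2)/(2n+1), which gives
   (a). In general, partial fractions and summation by parts reduce the series to pure
   powers and to the sum of b_n^2 / ((2n)^2 (2n+1)), which is the integral of cos * phi_g. *)

Section PowerSeries.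
Variable R : realType.
Implicit Types (a b k : nat -> R) (u r : R).

Definition rad1 a := forall r, 0 < r < 1 -> exists C, forall n, `|a n| * r ^+ n <= C.

Definition psum a u : R := limn (pseries a u).

Definition shiftr a : nat -> R := fun n => if n is m.+1 then a m else 0.

Lemma rad1_cvg_norm a u : rad1 a -> `|u| < 1 -> cvgn (series (fun n => `|a n * u ^+ n|)).
Proof.
move=> ra u1; pose r := (1 + `|u|) / 2.
have u0 : 0 <= `|u| by [].
have r0 : 0 < r by rewrite /r; lra.
have r1 : r < 1 by rewrite /r; lra.
have ur : `|u| < r by rewrite /r; lra.
have [|C hC] := ra r; first by rewrite r0 r1.
apply: (@series_le_cvg _ _ (geometric C (`|u| / r))) => [n|n|n|].
- exact: normr_ge0.
- rewrite /= mulr_ge0 ?exprn_ge0 ?divr_ge0 ?(ltW r0)//.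
  by apply: le_trans (hC 0%N); rewrite mulr_ge0 ?exprn_ge0 ?(ltW r0).
- rewrite /= normrM normrX expr_div_n mulrCA mulrC ler_wpM2l ?exprn_ge0//.
  by rewrite ler_pdivlMr ?exprn_gt0.
- apply: is_cvg_geometric_series; rewrite ger0_norm ?divr_ge0 ?(ltW r0)//.
  by rewrite ltr_pdivrMr ?mul1r.
Qed.

Lemma rad1_cvg a u : rad1 a -> `|u| < 1 -> cvgn (pseries a u).
Proof. by move=> ra u1; apply: normed_cvg; exact: rad1_cvg_norm. Qed.

Lemma psum_cvg a u : rad1 a -> `|u| < 1 -> pseries a u @ \oo --> psum a u.
Proof. by move=> ra u1; exact: rad1_cvg. Qed.

Lemma rad1_bounded a C : (forall n, `|a n| <= C) -> rad1 a.
Proof.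
move=> h r /andP[r0 r1]; exists C => n.
by apply: le_trans (h n); rewrite ler_piMr// exprn_ile1// ltW.
Qed.

Lemma rad1_le a b : (forall n, `|a n| <= `|b n|) -> rad1 b -> rad1 a.
Proof.
move=> h rb r r01; have [C hC] := rb _ r01; exists C => n.
by apply: le_trans (hC n); apply: ler_wpM2r => //; rewrite exprn_ge0//; case/andP: r01 => /ltW.
Qed.

Lemma rad1D a b : rad1 a -> rad1 b -> rad1 (a + b).
Proof.
move=> ra rb r r01; have [A hA] := ra _ r01; have [B hB] := rb _ r01.
exists (A + B) => n; apply: le_trans (lerD (hA n) (hB n)).
rewrite -mulrDl ler_wpM2r ?ler_normD// exprn_ge0//; by case/andP: r01 => /ltW.
Qed.

Lemma rad1Z c a : rad1 a -> rad1 (c *: a).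
Proof.
move=> ra r r01; have [A hA] := ra _ r01; exists (`|c| * A) => n.
by rewrite /= normrM -mulrA ler_wpM2l.
Qed.

Lemma rad1_shiftr a : rad1 a -> rad1 (shiftr a).
Proof.
move=> ra r r01; have [A hA] := ra _ r01; exists A => -[|n] /=.
  by rewrite normr0 mul0r; apply: le_trans (hA 0%N); rewrite mulr_ge0// exprn_ge0//; case/andP: r01 => /ltW.
apply: le_trans (hA n); rewrite ler_wpM2l// exprS ler_piMl//.
  by rewrite exprn_ge0//; case/andP: r01 => /ltW.
by case/andP: r01 => _ /ltW.
Qed.

Lemma succ_geometric_le r n : 0 <= r <= 1 -> n.+1%:R * r ^+ n * (1 - r) <= 1 - r ^+ n.+1.
Proof.
move=> /andP[r0 r1]; elim: n => [|n IH]; first by rewrite expr0 expr1; lra.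
rewrite -natr1 [r ^+ n.+1]exprS [r ^+ n.+2]exprS.
have e0 : 0 <= r ^+ n.+1 by rewrite exprn_ge0.
have e1 : r ^+ n.+1 <= 1 by rewrite exprn_ile1.
have : r * (n.+1%:R * r ^+ n * (1 - r)) <= r * (1 - r ^+ n.+1) by rewrite ler_wpM2l.
move: e0 e1; rewrite exprS; set E := r ^+ n; nra.
Qed.

Lemma rad1_succ a : rad1 a -> rad1 (fun n => n.+1%:R * a n).
Proof.
move=> ra r /andP[r0 r1]; pose q := Num.sqrt r.
have q0 : 0 < q by rewrite sqrtr_gt0.
have qq : q * q = r by rewrite -expr2 sqr_sqrtr ?ltW.
have q1 : q < 1.
  rewrite ltNge; apply/negP => h; have : 1 <= q * q by rewrite mulr_ege1.
  by rewrite qq leNgt r1.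
have [|C hC] := ra q; first by rewrite q0 q1.
exists ((1 - q)^-1 * C) => n; rewrite normrM ger0_norm// -qq exprMn mulrACA.
have C0 : 0 <= C by apply: le_trans (hC 0%N); rewrite mulr_ge0 ?exprn_ge0// ltW.
apply: ler_pM; rewrite ?mulr_ge0 ?exprn_ge0 ?(ltW q0)//.
rewrite -[leRHS]mul1r ler_pdivlMr ?subr_gt0//.
apply: le_trans (succ_geometric_le _ _) _; first by rewrite !ltW.
by rewrite gerBl exprn_ge0// ltW.
Qed.

Lemma rad1_tail a : rad1 a -> rad1 (fun n => a n.+1).
Proof.
move=> ra r /andP[r0 r1]; have [|C hC] := ra r; first by rewrite r0 r1.
exists (C / r) => n; rewrite ler_pdivlMr// -mulrA -exprSr; exact: hC.
Qed.

Lemma rad1_diffs a : rad1 a -> rad1 (pseries_diffs a).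
Proof. by move=> ra; apply: rad1_succ; apply: rad1_tail. Qed.

Lemma psumD a b u : rad1 a -> rad1 b -> `|u| < 1 -> psum (a + b) u = psum a u + psum b u.
Proof.
move=> ra rb u1; apply/cvg_lim => //.
rewrite /pseries (_ : (fun _ => _) = (fun n => a n * u ^+ n) + (fun n => b n * u ^+ n)).
  by rewrite seriesD; apply: cvgD; exact: psum_cvg.
by apply/funext => n /=; rewrite !fctE mulrDl.
Qed.

Lemma psumZ c a u : rad1 a -> `|u| < 1 -> psum (c *: a) u = c * psum a u.
Proof.
move=> ra u1; apply/cvg_lim => //.
rewrite /pseries (_ : (fun _ => _) = c *: (fun n => a n * u ^+ n)).
  by rewrite seriesZ; apply: cvgZr; exact: psum_cvg.
by apply/funext => n; exact/esym/mulrA.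
Qed.

Lemma psumN a u : rad1 a -> `|u| < 1 -> psum (- a) u = - psum a u.
Proof. by move=> ra u1; rewrite -scaleN1r psumZ// mulN1r. Qed.

Lemma psumB a b u : rad1 a -> rad1 b -> `|u| < 1 -> psum (a - b) u = psum a u - psum b u.
Proof.
by move=> ra rb u1; rewrite psumD// ?psumN//; rewrite -scaleN1r; exact: rad1Z.
Qed.

Lemma psum0 a : psum a 0 = a 0%N.
Proof.
apply/cvg_lim => //; rewrite -cvg_shiftS/=.
rewrite (_ : (fun n => _) = cst (a 0%N)); first exact: cvg_cst.
apply/funext => n; rewrite /pseries /series/= big_mkord big_ord_recl expr0 mulr1.
by rewrite big1 ?addr0// => i _; rewrite expr0n mulr0.
Qed.

Lemma psum_zero u : psum (0 : nat -> R) u = 0.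
Proof.
apply/cvg_lim => //; rewrite (_ : pseries _ u = cst 0); first exact: cvg_cst.
by apply/funext => n; rewrite /pseries /series/= big1// => i _; rewrite mul0r.
Qed.

Lemma psum_shiftr a u : rad1 a -> `|u| < 1 -> psum (shiftr a) u = u * psum a u.
Proof.
move=> ra u1; apply/cvg_lim => //; rewrite -cvg_shiftS/=.
rewrite (_ : (fun n => _) = (fun n => u * pseries a u n)).
  by apply: cvgZr; exact: psum_cvg.
apply/funext => n; rewrite /pseries /series/= !big_mkord big_ord_recl mul0r add0r.
rewrite mulr_sumr; apply: eq_bigr => i _.
by rewrite /bump/= exprS mulrCA.
Qed.

Lemma is_derive_psum a u : rad1 a -> `|u| < 1 ->
  is_derive u 1 (psum a) (psum (pseries_diffs a) u).
Proof.
move=> ra u1; pose K := (1 + `|u|) / 2.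
have u0 : 0 <= `|u| by [].
have K1 : `|K| < 1 by rewrite ger0_norm /K; lra.
have uK : `|u| < `|K| by rewrite [`|K|]ger0_norm /K; lra.
by apply: (pseries_snd_diffs (K := K)) => //; apply: rad1_cvg => //;
  do ?apply: rad1_diffs.
Qed.

Lemma psum_le_bound a u B : rad1 a -> `|u| < 1 ->
  (forall m, `|\sum_(n < m) a n * u ^+ n| <= B) -> `|psum a u| <= B.
Proof.
move=> ra u1 h; have /(cvg_norm) c := psum_cvg ra u1.
rewrite -(cvg_lim _ c)//; apply: limr_le; first by apply/cvg_ex; eexists; exact: c.
by apply: nearW => m; rewrite /pseries /series/= big_mkord.
Qed.

Lemma geometric_sum_le (u : R) m : 0 <= u < 1 -> \sum_(n < m) u ^+ n <= (1 - u)^-1.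
Proof.
move=> /andP[u0 u1]; rewrite -[leRHS]mul1r ler_pdivlMr ?subr_gt0//.
have := subrX1 u m; have := exprn_ge0 m u0; nra.
Qed.

Lemma sum_geometric_bound a u A N C : 0 <= u < 1 ->
  (forall n, (n < N)%N -> `|a n| <= A) -> (forall n, (N <= n)%N -> `|a n| <= C) ->
  0 <= A -> 0 <= C ->
  forall m, `|\sum_(n < m) a n * u ^+ n| <= N%:R * A + C / (1 - u).
Proof.
move=> u01 hA hC A0 C0 m; have /andP[u0 u1] := u01.
apply: le_trans (ler_norm_sum _ _ _) _.
apply: (@le_trans _ _ (\sum_(n < m) ((n < N)%N%:R * A + C * u ^+ n))).
  apply: ler_sum => n _; rewrite normrM [`|u ^+ n|]ger0_norm ?exprn_ge0//.
  case: ltnP => nN; last by rewrite mul0r add0r ler_wpM2r ?exprn_ge0 ?hC.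
  rewrite mul1r; have := hA _ nN; have := exprn_ge0 n u0.
  have : u ^+ n <= 1 by rewrite exprn_ile1// ltW.
  set E := u ^+ n; set X := `|a n| => h1 h2 h3.
  have X0 : 0 <= X by exact: normr_ge0.
  by nra.
rewrite big_split/= -mulr_suml -mulr_sumr lerD//; last first.
  by rewrite ler_wpM2l// geometric_sum_le.
rewrite ler_wpM2r// -natr_sum ler_nat.
have [mN|Nm] := leqP m N.
  rewrite (eq_bigr (fun=> 1%N)) ?sum1_card ?card_ord// => i _.
  by rewrite (leq_trans (ltn_ord i) mN).
rewrite -(big_mkord xpredT (fun i => (i < N)%N : nat)) (big_cat_nat (n := N))//= ?(ltnW Nm)//.
have -> : (\sum_(N <= i < m) (i < N) = 0)%N.
  by rewrite big_nat_cond big1// => i /andP[/andP[+ _] _]; rewrite leqNgt => /negbTE ->.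
rewrite addn0 (eq_big_nat _ _ (F2 := fun=> 1%N)) ?sum_nat_const_nat ?muln1 ?subn0// => i.
by move=> /andP[_ ->].
Qed.

Lemma cvg_tail_le a (e : R) : a @ \oo --> (0 : R) -> 0 < e ->
  exists N, forall n, (N <= n)%N -> `|a n| <= e.
Proof.
move=> /cvgrPdist_le h e0; have [N _ hN] := h _ e0.
by exists N => n /hN; rewrite sub0r normrN.
Qed.

Lemma cvg_rad1 a (l : R) : a @ \oo --> l -> rad1 a.
Proof.
move=> al; have [M [_ hM]] := cvg_seq_bounded (cvgP _ al).
by apply: (@rad1_bounded _ (M + 1)) => n; apply: hM => //; rewrite ltrDl.
Qed.

Lemma psum_small a : a @ \oo --> (0 : R) -> (1 - u) * psum a u @[u --> 1^'-] --> (0 : R).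
Proof.
move=> a0; have ra := cvg_rad1 a0; apply/cvgrPdist_le => e e0.
have [|N hN] := cvg_tail_le (e := e / 2) a0; first by rewrite divr_gt0.
have [M [_ hM']] := cvg_seq_bounded (cvgP _ a0).
pose A := `|M| + 1; have A0 : 0 <= A by rewrite addr_ge0.
have hA n : (n < N)%N -> `|a n| <= A.
  by move=> _; apply: hM' => //; rewrite /A; have := ler_norm M; lra.
have D0 : 0 < 2 * (N%:R * A + 1) by rewrite mulr_gt0// ltr_wpDl// mulr_ge0.
have hu : \forall u \near 1^'-, 1 - e / (2 * (N%:R * A + 1)) < u.
  by apply: nbhs_left_gt; rewrite gtrBl divr_gt0.
near=> u.
have u1 : u < 1 by near: u; exact: nbhs_left_lt.
have u0 : 0 < u by near: u; exact: nbhs_left_gt.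
have ue : 1 - e / (2 * (N%:R * A + 1)) < u by near: u.
rewrite sub0r normrN normrM ger0_norm ?subr_ge0 ?ltW//.
have nu1 : `|u| < 1 by rewrite gtr0_norm.
have b := psum_le_bound ra nu1 (@sum_geometric_bound a u A N (e/2) _ hA hN A0 _).
have {b} : `|psum a u| <= N%:R * A + e / 2 / (1 - u) by apply: b; rewrite ?(ltW u0)//; lra.
move=> b; have v0 : 0 < 1 - u by rewrite subr_gt0.
apply: le_lt_trans (ler_wpM2l (ltW v0) b) _.
rewrite mulrDr [(1 - u) * (_ / _)]mulrC divfK ?gt_eqF//.
have : (1 - u) * (2 * (N%:R * A + 1)) < e by rewrite -ltr_pdivlMr//; lra.
have : 0 <= N%:R * A by rewrite mulr_ge0.
nra.
Unshelve. all: by end_near. Qed.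

Definition delta0 : nat -> R := fun n => (n == 0)%:R.

Lemma rad1_delta0 : rad1 delta0.
Proof. by apply: (@rad1_bounded _ 1) => -[|n]; rewrite /delta0/= ?normr1 ?normr0. Qed.

Lemma psum_delta0 u : psum delta0 u = 1.
Proof.
apply/cvg_lim => //; rewrite -cvg_shiftS/=.
rewrite (_ : (fun n => _) = cst 1); first exact: cvg_cst.
apply/funext => n; rewrite /pseries /series/= big_mkord big_ord_recl expr0 mulr1.
by rewrite big1 ?addr0// => i _; rewrite /delta0/= mul0r.
Qed.

Lemma psum_cst1 u : `|u| < 1 -> (1 - u) * psum (cst 1) u = 1.
Proof.
move=> u1; have r1 : rad1 (cst 1) by apply: (@rad1_bounded _ 1) => n; rewrite normr1.
have e : cst 1 = delta0 + shiftr (cst 1).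
  by apply/funext => -[|n]; rewrite !fctE /delta0/= ?addr0 ?add0r.
have : psum (cst 1) u = 1 + u * psum (cst 1) u.
  rewrite {1}e psumD ?psum_shiftr ?psum_delta0//; [exact: rad1_delta0|exact: rad1_shiftr].
by move=> h; rewrite mulrBl mul1r {1}h addrK.
Qed.

Lemma abel a (l : R) : series a @ \oo --> l -> psum a u @[u --> 1^'-] --> l.
Proof.
move=> al; pose s n := series a n.+1.
have sl : s @ \oo --> l by rewrite /s cvg_shiftS.
have s0 : s - cst l @ \oo --> (0 : R) by rewrite -(subrr l); apply: cvgB => //; exact: cvg_cst.
have rs := cvg_rad1 sl; have rs0 := cvg_rad1 s0.
have ea : a = s - shiftr s.
  apply/funext => -[|n]; rewrite !fctE /s /series/= ?big_nat1 ?subr0//.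
  by rewrite [X in _ = X - _]big_nat_recr//= addrAC subrr add0r.
have r1 : rad1 (cst 1) by apply: (@rad1_bounded _ 1) => n; rewrite normr1.
have key u : `|u| < 1 -> psum a u = (1 - u) * psum (s - cst l) u + l.
  move=> u1; rewrite {1}ea psumB//; last exact: rad1_shiftr.
  have -> : s = (s - cst l) + l *: cst 1.
    by apply/funext => n; rewrite !fctE scaler1 subrK.
  rewrite psum_shiftr//; last by apply: rad1D => //; exact: rad1Z.
  have -> : (s - cst l + l *: cst 1 - cst l) = s - cst l.
    by rewrite -[cst l](_ : l *: cst 1 = _) ?addrK//; apply/funext => n; rewrite !fctE scaler1.
  rewrite psumD//; last exact: rad1Z.
  rewrite psumZ//; have := psum_cst1 u1; set p1 := psum _ _; set p2 := psum _ _.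
  by move=> e1; transitivity ((1 - u) * p2 + l * ((1 - u) * p1)); [ring|rewrite e1 mulr1].
have c : (1 - u) * psum (s - cst l) u + l @[u --> 1^'-] --> l.
  by rewrite -[X in _ --> X]add0r; apply: cvgD; [exact: psum_small|exact: cvg_cst].
apply: cvg_trans c; apply: near_eq_cvg; near=> u; apply/esym/key.
rewrite ger0_norm; first by near: u; exact: nbhs_left_lt.
by near: u; apply: nbhs_left_ge.
Unshelve. all: by end_near. Qed.

End PowerSeries.
Section Ode.
Variable R : realType.
Implicit Types (f g df dg : R -> R) (u v : R).

Definition has_deriv f df :=
  (forall u, 0 < u < 1 -> is_derive u 1 f (df u)) /\ {for 0, continuous f}.

Lemma has_deriv_le f df (a b : R) : has_deriv f df -> 0 <= a -> a <= b -> b < 1 ->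
  (forall v, a < v < b -> 0 <= df v) -> f a <= f b.
Proof.
move=> [hd hc] a0; rewrite le_eqVlt => /predU1P[<-//|ab] b1 h.
have cf u : 0 <= u -> u < 1 -> {for u, continuous f}.
  move=> + u1; rewrite le_eqVlt => /predU1P[<-//|u0].
  have [] := hd u; first by rewrite u0 u1.
  by move=> /derivable1_diffP/differentiable_continuous.
have [||c + e] := @MVT _ f df a b ab.
- move=> x; rewrite in_itv/= => /andP[ax xb]; apply: hd.
  by rewrite (le_lt_trans a0 ax) (lt_trans xb b1).
- apply: continuous_in_subspaceT => x; rewrite inE/= in_itv/= => /andP[ax xb].
  by apply: cf; [exact: le_trans ax|exact: le_lt_trans b1].
rewrite in_itv/= => cab; rewrite -subr_ge0 e mulr_ge0 ?h//.
by rewrite subr_ge0 ltW.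
Qed.

Lemma has_derivD f g df dg : has_deriv f df -> has_deriv g dg ->
  has_deriv (fun u => f u + g u) (fun u => df u + dg u).
Proof.
move=> [f1 f2] [g1 g2]; split; last exact: continuousD.
by move=> u u01; apply: is_deriveD; [exact: f1|exact: g1].
Qed.

Lemma has_derivZ c f df : has_deriv f df -> has_deriv (fun u => c * f u) (fun u => c * df u).
Proof.
move=> [f1 f2]; split; last by apply: continuousM => //; exact: cst_continuous.
by move=> u u01; apply: is_deriveZ; exact: f1.
Qed.

Lemma has_derivM f g df dg : has_deriv f df -> has_deriv g dg ->
  has_deriv (fun u => f u * g u) (fun u => df u * g u + f u * dg u).
Proof.
move=> [f1 f2] [g1 g2]; split; last exact: continuousM.
move=> u u01; apply: is_derive_eq.
  by apply: is_deriveM; [exact: f1|exact: g1].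
by rewrite addrC /GRing.scale/= [g u * _]mulrC.
Qed.

Lemma has_deriv_cst c : has_deriv (fun=> c) (fun=> 0).
Proof. by split; [move=> u _; exact: is_derive_cst|exact: cst_continuous]. Qed.

Lemma has_deriv_id : has_deriv (fun u => u) (fun=> 1).
Proof. by split; [move=> u _; exact: is_derive_id|exact: cvg_id]. Qed.

Lemma has_derivN f df : has_deriv f df -> has_deriv (fun u => - f u) (fun u => - df u).
Proof.
move=> [f1 f2]; split; last exact: continuousN.
by move=> u u01; apply: is_deriveN; exact: f1.
Qed.

Lemma has_derivB f g df dg : has_deriv f df -> has_deriv g dg ->
  has_deriv (fun u => f u - g u) (fun u => df u - dg u).
Proof. by move=> hf hg; apply: has_derivD => //; exact: has_derivN. Qed.

Lemma has_derivV f df : (forall u, f u != 0) -> has_deriv f df ->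
  has_deriv (fun u => (f u)^-1) (fun u => - df u / f u ^+ 2).
Proof.
move=> f0 [f1 f2]; split; last by apply: continuousV.
move=> u u01; have [d1 d2] := f1 u u01; split; first exact: derivableV.
by rewrite deriveV// d2 /GRing.scale/= -exprVn mulNr mulNr mulrC.
Qed.

Lemma has_derivX f df n : has_deriv f df ->
  has_deriv (fun u => f u ^+ n.+1) (fun u => n.+1%:R * f u ^+ n * df u).
Proof.
move=> hf; elim: n => [|n IH].
  have [f1 f2] := hf; split; last by rewrite (_ : (fun _ => _) = f)//; apply/funext => u; rewrite expr1.
  by move=> u u01; rewrite expr0 mulr1 mul1r; apply: f1.
have := has_derivM hf IH; congr has_deriv; apply/funext => u.
by rewrite -[n.+2%:R]natr1 [f u ^+ n.+1]exprS; ring.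
Qed.

Lemma has_deriv_eq f df dg : (forall u, 0 < u < 1 -> df u = dg u) ->
  has_deriv f df -> has_deriv f dg.
Proof. by move=> e [h1 h2]; split => // u u01; rewrite -e//; exact: h1. Qed.

Lemma has_deriv_sum (n : nat) (f df : nat -> R -> R) : (forall i, has_deriv (f i) (df i)) ->
  has_deriv (fun u => \sum_(i < n) f i u) (fun u => \sum_(i < n) df i u).
Proof.
move=> h; elim: n => [|n IH].
  have := has_deriv_cst 0; congr has_deriv; apply/funext => u; by rewrite big_ord0.
have := has_derivD IH (h n); congr has_deriv; apply/funext => u; by rewrite big_ord_recr.
Qed.

Lemma has_deriv_unique f g df dg : has_deriv f df -> has_deriv g dg ->
  (forall u, 0 < u < 1 -> df u = dg u) -> f 0 = g 0 ->
  forall u, 0 <= u < 1 -> f u = g u.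
Proof.
move=> hf hg e e0 u /andP[u0 u1].
have key f' g' df' dg' : has_deriv f' df' -> has_deriv g' dg' ->
    (forall u, 0 < u < 1 -> df' u = dg' u) -> f' 0 = g' 0 -> f' u <= g' u.
  move=> hf' hg' e' e0'; have /= := has_deriv_le (has_derivB hg' hf') (lexx 0) u0 u1.
  rewrite e0' subrr subr_ge0; apply => v /andP[v0 v1]; rewrite e' ?subrr//.
  by rewrite v0 (lt_trans v1 u1).
by apply/eqP; rewrite eq_le (key f g df dg)// (key g f dg df)// => v v01; rewrite e.
Qed.

Lemma has_deriv_psum (a : nat -> R) : rad1 a -> has_deriv (psum a) (psum (pseries_diffs a)).
Proof.
move=> ra; split.
  move=> u /andP[u0 u1]; apply: is_derive_psum => //; by rewrite ger0_norm// ltW.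
have [] := is_derive_psum ra (u := 0); first by rewrite normr0.
by move=> /derivable1_diffP/differentiable_continuous.
Qed.

Lemma has_deriv_psum_comp (a : nat -> R) f df : rad1 a -> has_deriv f df -> f 0 = 0 ->
  (forall u, 0 < u < 1 -> 0 <= f u < 1) ->
  has_deriv (fun u => psum a (f u)) (fun u => psum (pseries_diffs a) (f u) * df u).
Proof.
move=> ra [f1 f2] f00 f01; split.
  move=> u u01; apply: (@is_derive1_comp _ (psum a) f); last exact: f1.
  by apply: is_derive_psum => //; have /andP[? ?] := f01 u u01; rewrite ger0_norm.
apply: continuous_comp => //; rewrite f00.
by have [] := has_deriv_psum ra.
Qed.

Lemma psum_ge_partial (k : nat -> R) N u : rad1 k -> (forall n, 0 <= k n) -> 0 <= u < 1 ->
  \sum_(n < N) k n * u ^+ n <= psum k u.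
Proof.
move=> rk k0 /andP[u0 u1].
have c : cvgn (pseries k u) by apply: rad1_cvg => //; rewrite ger0_norm.
rewrite (_ : \sum_(n < N) _ = pseries k u N); last by rewrite /pseries /series/= big_mkord.
apply: nondecreasing_cvgn_le => //.
apply/nondecreasing_seqP => n; rewrite /pseries /series/= big_nat_recr//= lerDl.
by rewrite mulr_ge0 ?exprn_ge0.
Qed.

Definition tail_from (N : nat) (k : nat -> R) : nat -> R := fun n => if (n < N)%N then 0 else k n.

Lemma rad1_tail_from N k : rad1 k -> rad1 (tail_from N k).
Proof.
apply: rad1_le => n; rewrite /tail_from; case: ifP => // _; by rewrite normr0.
Qed.

Lemma psum_tail_from N k u : rad1 k -> `|u| < 1 ->
  psum (tail_from N k) u = psum k u - \sum_(n < N) k n * u ^+ n.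
Proof.
move=> rk u1; apply/cvg_lim => //.
have c : (fun m => pseries k u m - \sum_(n < N) k n * u ^+ n) @ \oo -->
   psum k u - \sum_(n < N) k n * u ^+ n.
  by apply: cvgB; [exact: psum_cvg|exact: cvg_cst].
apply: cvg_trans c; apply: near_eq_cvg; exists N => // m /= Nm.
rewrite /pseries /series/= (big_cat_nat (n := N))//= -(big_mkord xpredT (fun n => k n * u ^+ n)).
rewrite addrAC subrr add0r [RHS](big_cat_nat (n := N))//=.
have -> : \sum_(0 <= i < N) tail_from N k i * u ^+ i = 0.
  by rewrite big_nat big1// => i /andP[_ iN]; rewrite /tail_from iN mul0r.
by rewrite add0r; apply: eq_big_nat => i /andP[Ni _]; rewrite /tail_from ltnNge Ni.
Qed.

Lemma psum_mono (k : nat -> R) u v : rad1 k -> (forall n, 0 <= k n) -> 0 <= u -> u <= v -> v < 1 ->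
  psum k u <= psum k v.
Proof.
move=> rk k0 u0 uv v1; have v0 := le_trans u0 uv; apply: ler_lim.
- by apply: rad1_cvg => //; rewrite ger0_norm//; exact: le_lt_trans v1.
- by apply: rad1_cvg => //; rewrite ger0_norm.
- apply: nearW => m; rewrite /pseries /series/=; apply: ler_sum => i _.
  by rewrite ler_wpM2l// lerXn2r.
Qed.

Lemma squeeze (k : nat -> R) (s : nat -> R -> R) (sig : nat -> R) (p y L : R -> R) (l : R) :
  rad1 k -> (forall n, 0 <= k n) ->
  (forall u, 0 < u < 1 -> 0 <= p u) -> (forall u, 0 < u < 1 -> 0 <= y u < 1) ->
  (forall u v, 0 < u -> u <= v -> v < 1 -> y u <= y v) ->
  (forall n, has_deriv (s n) (fun u => p u * y u ^+ n)) -> (forall n, s n 0 = 0) ->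
  (forall n, s n u @[u --> 1^'-] --> sig n) ->
  has_deriv L (fun u => p u * psum k (y u)) -> L 0 = 0 -> L u @[u --> 1^'-] --> l ->
  series (fun n => k n * sig n) @ \oo --> l.
Proof.
move=> rk k0 p0 y01 ymono hs s0 hsig hL L0 hl.
have near01 (Q : R -> Prop) : (forall u, 0 < u < 1 -> Q u) -> \forall u \near 1^'-, Q u.
  move=> h; near=> u; apply: h; apply/andP; split.
    by near: u; exact: nbhs_left_gt.
  by near: u; exact: nbhs_left_lt.
have ny u : 0 < u < 1 -> `|y u| < 1 by move=> /y01/andP[a b]; rewrite ger0_norm.
have s_le u n : 0 < u < 1 -> s n u <= sig n.
  move=> /andP[u0 u1]; apply: (cvgr_to_ge (hsig n)); near=> v.
  have v1 : v < 1 by near: v; exact: nbhs_left_lt.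
  have uv : u <= v by near: v; exact: nbhs_left_ge.
  apply: (has_deriv_le (hs n)) => //; first exact: ltW.
  move=> w /andP[uw wv]; have w01 : 0 < w < 1 by rewrite (lt_trans u0 uw) (lt_trans wv v1).
  by rewrite mulr_ge0 ?p0// exprn_ge0//; case/andP: (y01 _ w01).
have s_ge0 u n : 0 < u < 1 -> 0 <= s n u.
  move=> /andP[u0 u1]; rewrite -(s0 n); apply: (has_deriv_le (hs n)) => //; first exact: ltW.
  move=> w /andP[uw wv]; have w01 : 0 < w < 1 by rewrite uw (lt_trans wv u1).
  by rewrite mulr_ge0 ?p0// exprn_ge0//; case/andP: (y01 _ w01).
have hpart N : has_deriv (fun u => L u - \sum_(n < N) k n * s n u)
    (fun u => p u * (psum k (y u) - \sum_(n < N) k n * y u ^+ n)).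
  have := has_derivB hL (@has_deriv_sum N _ _ (fun n => has_derivZ (k n) (hs n))).
  apply: has_deriv_eq => u _; rewrite mulrBr; congr (_ - _); rewrite mulr_sumr.
  by apply: eq_bigr => n _; rewrite mulrCA.
have part_ge u N : 0 < u < 1 -> \sum_(n < N) k n * s n u <= L u.
  move=> /andP[u0 u1]; rewrite -subr_ge0.
  have := has_deriv_le (hpart N) (lexx 0) (ltW u0) u1; rewrite L0 big1 ?subr0; last first.
    by move=> n _; rewrite s0 mulr0.
  apply=> v /andP[v0 v1]; have v01 : 0 < v < 1 by rewrite v0 (lt_trans v1 u1).
  by rewrite mulr_ge0 ?p0// subr_ge0 psum_ge_partial// y01.
have sig0 n : 0 <= sig n.
  by apply: (le_trans _ (s_le (2^-1) n _)); [apply: s_ge0|]; rewrite invr_gt0 ltr0n/= invf_lt1 ?ltr1n.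
have part_l N : series (fun n => k n * sig n) N <= l.
  rewrite /series/= big_mkord; apply: (ler_cvg_to _ hl).
    apply: cvg_big => [|n _]; first exact: add_continuous.
    by apply: cvgM; [exact: cvg_cst|exact: hsig].
  by apply: near01 => u u01; exact: part_ge.
have nd : {homo series (fun n => k n * sig n) : n m / (n <= m)%N >-> n <= m}.
  by apply/nondecreasing_seqP => n; rewrite /series/= big_nat_recr//= lerDl mulr_ge0.
have cs : cvgn (series (fun n => k n * sig n)).
  by apply: nondecreasing_is_cvgn => //; exists l => _ [N _ <-].
suff -> : l = limn (series (fun n => k n * sig n)) by [].
apply/eqP; rewrite eq_le; apply/andP; split; last first.
  by apply: limr_le => //; exact: nearW.
apply: (cvgr_to_le hl); apply: near01 => u u01; have /andP[u0 u1] := u01.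
apply/ler_addgt0Pr => e e0.
have sp : 0 < s 0%N u + 1 by rewrite ltr_wpDl// s_ge0.
pose e' := e / (s 0%N u + 1).
have e'0 : 0 < e' by rewrite divr_gt0.
have /cvgrPdist_le/(_ _ e'0) [N _ hN] := psum_cvg rk (ny _ u01).
have {}hN : psum k (y u) - \sum_(n < N) k n * y u ^+ n <= e'.
  have := hN N (leqnn N); rewrite /pseries /series/= big_mkord.
  by apply: le_trans; exact: ler_norm.
have hd := has_derivB (has_derivZ e' (hs 0%N)) (hpart N).
have := has_deriv_le hd (lexx 0) (ltW u0) u1.
rewrite /= s0 L0 mulr0 big1 ?subr0; last by move=> n _; rewrite s0 mulr0.
have tl v : 0 < v < u -> psum k (y v) - \sum_(n < N) k n * y v ^+ n <= e'.
  move=> /andP[v0 vu]; have v01 : 0 < v < 1 by rewrite v0 (lt_trans vu).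
  rewrite -psum_tail_from ?ny//; apply: le_trans hN; rewrite -psum_tail_from ?ny//.
  apply: psum_mono; [exact: rad1_tail_from| |by case/andP: (y01 _ v01)| |by case/andP: (y01 _ u01)].
    by move=> n; rewrite /tail_from; case: ifP.
  by apply: ymono => //; exact: ltW.
have H : forall v, 0 < v < u -> 0 <= e' * (p v * y v ^+ 0) - p v * (psum k (y v) - \sum_(n < N) k n * y v ^+ n).
  move=> v vu; have v01 : 0 < v < 1 by case/andP: vu => -> /= /lt_trans; apply.
  rewrite expr0 mulr1 mulrC -mulrBr mulr_ge0 ?p0// subr_ge0; exact: tl.
move=> /(_ H); rewrite subr_ge0 => hle.
apply: (@le_trans _ _ (series (fun n => k n * sig n) N + e)); last first.
  by rewrite lerD2r; exact: nondecreasing_cvgn_le.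
rewrite -lerBlDl; apply: le_trans (_ : e' * s 0%N u <= e); last first.
  rewrite /e' mulrAC ler_pdivrMr//; apply: ler_wpM2l; [exact: ltW|by rewrite lerDl].
apply: le_trans hle; rewrite lerD2l lerN2 /series/= big_mkord.
by apply: ler_sum => n _; rewrite ler_wpM2l// s_le.
Unshelve. all: by end_near. Qed.

End Ode.
Section HalfAngle.
Variable R : realType.
Implicit Types (u v : R).

(* Under u = tan (theta / 2), these are dtheta/du, sin theta and cos theta. *)
Definition hf u : R := 2 / (1 + u ^+ 2).
Definition sf u : R := u * hf u.
Definition cf u : R := hf u - 1.

Let den_gt0 u : 0 < 1 + u ^+ 2.
Proof. by rewrite ltr_pwDl// sqr_ge0. Qed.

Let den_neq0 u : 1 + u ^+ 2 != 0.
Proof. by rewrite gt_eqF. Qed.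

Lemma hf_gt0 u : 0 < hf u.
Proof. by rewrite divr_gt0. Qed.

Lemma sf2_cf2 u : sf u ^+ 2 + cf u ^+ 2 = 1.
Proof. by rewrite /sf /cf /hf; field. Qed.

Lemma cf_alt u : cf u = (1 - u ^+ 2) / (1 + u ^+ 2).
Proof. by rewrite /cf /hf; field. Qed.

Lemma sf0 : sf 0 = 0. Proof. by rewrite /sf mul0r. Qed.
Lemma cf0 : cf 0 = 1. Proof. by rewrite /cf /hf expr0n addr0; field. Qed.

Lemma sf_gt0 u : 0 < u -> 0 < sf u.
Proof. by move=> u0; rewrite mulr_gt0// hf_gt0. Qed.

Lemma cf_gt0 u : 0 <= u < 1 -> 0 < cf u.
Proof.
move=> /andP[u0 u1]; rewrite cf_alt divr_gt0// subr_gt0 expr_lt1//.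
Qed.

Lemma sf_lt1 u : u != 1 -> sf u < 1.
Proof.
move=> u1; rewrite /sf /hf mulrA ltr_pdivrMr// mul1r -subr_gt0.
have -> : 1 + u ^+ 2 - u * 2 = (u - 1) ^+ 2 by ring.
by rewrite exprn_even_gt0//= subr_eq0.
Qed.

Lemma sf_le u v : 0 < u -> u <= v -> v < 1 -> sf u <= sf v.
Proof.
move=> u0 uv v1; rewrite /sf /hf !mulrA ler_pdivrMr// mulrAC ler_pdivlMr//.
rewrite -subr_ge0; have -> : v * 2 * (1 + u ^+ 2) - u * 2 * (1 + v ^+ 2) = 2 * (v - u) * (1 - u * v) by ring.
by rewrite !mulr_ge0 ?subr_ge0//; nra.
Qed.

Lemma sf2_01 u : 0 < u < 1 -> 0 <= sf u ^+ 2 < 1.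
Proof.
move=> /andP[u0 u1]; rewrite sqr_ge0/= expr_lt1//; first by rewrite sf_lt1// lt_eqF.
by rewrite ltW// sf_gt0.
Qed.

Lemma sf2_le u v : 0 < u -> u <= v -> v < 1 -> sf u ^+ 2 <= sf v ^+ 2.
Proof.
move=> u0 uv v1; rewrite lerXn2r ?nnegrE ?(ltW (sf_gt0 _))//; first exact: lt_le_trans uv.
exact: sf_le.
Qed.

Lemma has_deriv_hf : has_deriv hf (fun u => - (sf u * hf u)).
Proof.
have h := has_derivZ 2 (has_derivV den_neq0 (has_derivD (has_deriv_cst 1) (has_derivX 1 (@has_deriv_id R)))).
apply: has_deriv_eq h => u _ /=; rewrite expr1 /sf /hf; field; exact: den_neq0.
Qed.

Lemma has_deriv_cf : has_deriv cf (fun u => - (sf u * hf u)).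
Proof.
have h := has_derivB has_deriv_hf (has_deriv_cst 1).
by apply: has_deriv_eq h => u _ /=; rewrite subr0.
Qed.

Lemma has_deriv_sf : has_deriv sf (fun u => cf u * hf u).
Proof.
have h := has_derivM (@has_deriv_id R) has_deriv_hf.
apply: has_deriv_eq h => u _ /=; rewrite /cf /sf /hf; field; exact: den_neq0.
Qed.

Lemma hf_cvg1 : hf u @[u --> 1^'-] --> (1 : R).
Proof.
rewrite [X in _ --> X](_ : (1 : R) = hf 1); last by rewrite /hf expr1n; field.
apply: cvg_at_left_filter.
have cid : {for (1 : R), continuous (fun u : R => u)} by exact: cvg_id.
have c1 : {for (1 : R), continuous (fun u : R => 1 + u * u)}.
  by apply: continuousD; [exact: cst_continuous|exact: continuousM].
have c2 : {for (1 : R), continuous (fun u : R => 2 / (1 + u * u))}.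
  by apply: continuousM; [exact: cst_continuous|apply: continuousV => //; rewrite -expr2].
have e : (fun u : R => 2 / (1 + u * u)) = hf by apply/funext => u; rewrite /hf expr2.
by rewrite e in c2.
Qed.

Lemma sf_cvg1 : sf u @[u --> 1^'-] --> (1 : R).
Proof.
rewrite -[X in _ --> X]mulr1; apply: cvgM; last exact: hf_cvg1.
by apply: cvg_at_left_filter; exact: cvg_id.
Qed.

Lemma cf_cvg1 : cf u @[u --> 1^'-] --> (0 : R).
Proof.
by rewrite -[X in _ --> X](subrr 1); apply: cvgB; [exact: hf_cvg1|exact: cvg_cst].
Qed.

End HalfAngle.

Inductive letter := LU | LTh | LCot | LTan | LRho.

Definition kap (l : letter) : bool :=
  match l with LU | LCot => true | _ => false end.

Definition eps (l : letter) (k : nat) : int :=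
  match l with
  | LU => 0
  | LTh => nth 0 [:: 0; 2; 0; -2] (k %% 4)
  | LCot => nth 0 [:: 2; 0; -2; 0] (k %% 4)
  | LTan => nth 0 [:: 0; 0; 4; 0] (k %% 4)
  | LRho => nth 0 [:: 0; 2; -4; 2] (k %% 4)
  end.

Section Letters.
Variable R : realType.
Implicit Types (a : nat -> R) (u : R) (l : letter).

Definition lval l u : R :=
  match l with
  | LU => hf u / sf u
  | LTh => hf u
  | LCot => hf u * cf u / sf u
  | LTan => hf u * sf u / cf u
  | LRho => hf u * (1 - sf u) / cf u
  end.

(* The coefficients of the primitive of [lval l * psum a]; Taylor expansion gives
   [lval l u = kap l / u + \sum_(k >= 1) eps l k * u ^+ (k - 1)]. *)
Definition lop l a : nat -> R := fun n =>
  n%:R^-1 * ((kap l)%:R * a n + \sum_(m < n) (eps l (n - m))%:~R * a m).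

Lemma eps_period l k : eps l (k + 4) = eps l k.
Proof. by case: l; rewrite /eps/= ?modnDr. Qed.

Lemma eps_norm_le4 l k : `|(eps l k)%:~R : R| <= 4.
Proof.
rewrite -intr_norm (ler_int R _ 4); have : (k %% 4 < 4)%N by rewrite ltn_mod.
by case: l => /=; case: (k %% 4)%N => [|[|[|[|]]]].
Qed.

Lemma lop0 l a : lop l a 0%N = 0.
Proof. by rewrite /lop invr0 mul0r. Qed.

Lemma lop_linear l k a b : lop l (k *: a + b) = k *: lop l a + lop l b.
Proof.
apply/funext => n; rewrite !fctE /lop /GRing.scale/=.
rewrite (eq_bigr (fun m : 'I_n => k * ((eps l (n - m))%:~R * a m) + (eps l (n - m))%:~R * b m)).
  by rewrite big_split/= -mulr_sumr; ring.
by move=> m _; ring.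
Qed.

Lemma lop_cvg0 l a : a @ \oo --> (0 : R) -> lop l a @ \oo --> (0 : R).
Proof.
move=> a0; have na0 : (fun n => `|a n|) @ \oo --> (0 : R) by rewrite -(@normr0 _ R); apply: cvg_norm.
rewrite -cvg_shiftS; apply/norm_cvg0P.
have c : (fun n => `|a n.+1| + 4 * arithmetic_mean (fun n => `|a n|) n) @ \oo --> (0 : R).
  rewrite -[X in _ --> X]addr0 -[X in _ --> _ + X](mulr0 4); apply: cvgD.
    by rewrite (cvg_shiftS (fun n => `|a n|)).
  by apply: cvgM; [exact: cvg_cst|exact: cesaro].
apply: (@squeeze_cvgr _ _ _ _ (cst 0) _ _ _ _ _ c); last exact: cvg_cst.
apply: nearW => n; rewrite normr_ge0/= /lop /arithmetic_mean/= /series/= big_mkord normrM.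
rewrite ger0_norm ?invr_ge0// mulrCA -[X in _ <= X + _](mulKf (_ : n.+1%:R != 0 :> R)) ?pnatr_eq0//.
rewrite -mulrDr ler_wpM2l ?invr_ge0//; apply: le_trans (ler_normD _ _) _; apply: lerD.
  rewrite normrM; apply: ler_wpM2r; first exact: normr_ge0.
  by case: (kap l); rewrite ?normr1 ?normr0// ler1n.
rewrite mulr_sumr; apply: le_trans (ler_norm_sum _ _ _) _; apply: ler_sum => m _.
by rewrite normrM ler_wpM2r// eps_norm_le4.
Qed.

Lemma lop_num_shift l a : let q := fun n => (kap l)%:R * a n + \sum_(m < n) (eps l (n - m))%:~R * a m in
  let e j := (eps l j)%:~R : R in let s := @shiftr R in
  q - s (s (s (s q))) = (kap l)%:R *: (a - s (s (s (s a)))) + e 1%N *: s a + e 2%N *: s (s a)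
     + e 3%N *: s (s (s a)) + e 4%N *: s (s (s (s a))).
Proof.
move=> q e s; apply/funext => n; rewrite !fctE /GRing.scale/=.
case: n => [|[|[|[|n]]]]; rewrite /q /= !(big_ord_recr, big_ord0)/= ?subn0 /e; try ring.
rewrite (_ : (n.+4 - n = 4)%N); last lia.
rewrite (_ : (n.+4 - n.+1 = 3)%N); last lia.
rewrite (_ : (n.+4 - n.+2 = 2)%N); last lia.
rewrite (_ : (n.+4 - n.+3 = 1)%N); last lia.
rewrite (eq_bigr (fun m : 'I_n => (eps l (n - m))%:~R * a m)); last first.
  move=> m _; congr (_%:~R * _); rewrite -[RHS]eps_period; congr eps.
  have := ltn_ord m; lia.
ring.
Qed.


Lemma lval_eps l u : 0 < u < 1 -> lval l u * (u * (1 - u ^+ 4)) =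
  (kap l)%:R * (1 - u ^+ 4) + (eps l 1)%:~R * u + (eps l 2)%:~R * u ^+ 2
    + (eps l 3)%:~R * u ^+ 3 + (eps l 4)%:~R * u ^+ 4.
Proof.
move=> /andP[u0 u1].
have n0 : u != 0 by rewrite gt_eqF.
have n2 : 1 + u ^+ 2 != 0 by rewrite gt_eqF// ltr_pwDl// sqr_ge0.
have n1 : 1 - u ^+ 2 != 0 by rewrite gt_eqF// subr_gt0 expr_lt1// ltW.
by case: l; rewrite /lval /= ?cf_alt /sf /hf; field; rewrite ?n0 ?n1 ?n2.
Qed.

Lemma has_deriv_lop l a : a @ \oo --> (0 : R) -> (kap l -> a 0%N = 0) ->
  has_deriv (psum (lop l a)) (fun u => lval l u * psum a u).
Proof.
move=> a0 hk; have ra := cvg_rad1 a0; have rl := cvg_rad1 (lop_cvg0 l a0).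
apply: (has_deriv_eq _ (has_deriv_psum rl)) => u u01; have /andP[u0 u1] := u01.
have nu : `|u| < 1 by rewrite gtr0_norm.
pose q n := (kap l)%:R * a n + \sum_(m < n) (eps l (n - m))%:~R * a m.
have qE : q = shiftr (pseries_diffs (lop l a)).
  apply/funext => -[|n]; rewrite /q /=.
    by rewrite big_ord0 addr0; case: (kap l) hk => [->//|_]; rewrite ?mulr0 ?mul0r.
  by rewrite /pseries_diffs /lop mulVKf// pnatr_eq0.
have rd := rad1_diffs rl; have rq : rad1 q by rewrite qE; exact: rad1_shiftr.
have sq1 := rad1_shiftr rq; have sq2 := rad1_shiftr sq1; have sq3 := rad1_shiftr sq2.
have sq4 := rad1_shiftr sq3.
have sa1 := rad1_shiftr ra; have sa2 := rad1_shiftr sa1; have sa3 := rad1_shiftr sa2.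
have sa4 := rad1_shiftr sa3.
have eD : psum q u = u * psum (pseries_diffs (lop l a)) u by rewrite qE psum_shiftr.
have := lop_num_shift l a; rewrite -/q => /(congr1 (fun f => psum f u)).
clearbody q; clear qE rl.
have rB : rad1 (a - shiftr (shiftr (shiftr (shiftr a)))).
  by apply: rad1D => //; rewrite -scaleN1r; exact: rad1Z.
rewrite psumB// !psum_shiftr//.
have z c := rad1Z c.
rewrite !(psumD, psumZ) ?psum_shiftr//; do ?[by apply: z|apply: rad1D => //].
  2: by rewrite -scaleN1r; exact: z.
rewrite psumN ?psum_shiftr//.
rewrite eD.
set D := psum _ u; set A := psum a u => e.
have n0 : u * (1 - u ^+ 4) != 0.
  by rewrite mulf_neq0 ?gt_eqF// subr_gt0 expr_lt1// ltW.
apply: (mulIf n0); rewrite mulrAC lval_eps//.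
transitivity (u * D - u * (u * (u * (u * (u * D))))); first ring.
by rewrite e; ring.
Qed.

Fixpoint wseq (t : seq letter) : nat -> R :=
  if t is l :: t' then lop l (wseq t') else @delta0 R.

(* The innermost letter must not have a pole at 0. *)
Definition wok (t : seq letter) := ~~ kap (last LTh t).

Lemma wseq_cvg0 t : wseq t @ \oo --> (0 : R).
Proof.
elim: t => [|l t IH]; last exact: lop_cvg0.
rewrite -cvg_shiftS (_ : (fun n => _) = cst 0); first exact: cvg_cst.
by apply/funext => n.
Qed.

End Letters.

Section Span.
Variables (F : fieldType) (V : lmodType F).
Implicit Types (K : set F) (S : set V) (v w : V).

Inductive kspan K S : V -> Prop :=
| kspan0 : kspan K S 0
| kspan_cons k s v : K k -> S s -> kspan K S v -> kspan K S (k *: s + v).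

Lemma kspanD K S v w : kspan K S v -> kspan K S w -> kspan K S (v + w).
Proof. by elim=> [|k s x Kk Ss _ IH] hw; rewrite ?add0r -?addrA//; constructor => //; exact: IH. Qed.

Lemma kspanZ K S c v : (forall x y, K x -> K y -> K (x * y)) -> K c -> kspan K S v -> kspan K S (c *: v).
Proof.
move=> KM Kc; elim=> [|k s x Kk Ss _ IH]; first by rewrite scaler0; constructor.
by rewrite scalerDr scalerA; constructor => //; exact: KM.
Qed.

Lemma kspan_in K S v : K 1 -> S v -> kspan K S v.
Proof. by move=> K1 Sv; rewrite -[v]addr0 -[X in X + _]scale1r; constructor => //; constructor. Qed.

Lemma kspan_sub K S S' v : (forall s, S s -> S' s) -> kspan K S v -> kspan K S' v.
Proof. by move=> h; elim=> [|k s x Kk Ss _ IH]; constructor => //; exact: h. Qed.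

Lemma kspan_sum K S (I : Type) (r : seq I) (f : I -> V) :
  (forall i, kspan K S (f i)) -> kspan K S (\sum_(i <- r) f i).
Proof.
move=> h; elim: r => [|i r IH]; first by rewrite big_nil; constructor.
by rewrite big_cons; apply: kspanD.
Qed.

End Span.

Lemma kspan_bind (F : fieldType) (V W : lmodType F) (K : set F) (S : set V) (S' : set W) (f : V -> W) v :
  (forall x y, K x -> K y -> K (x * y)) ->
  (forall k x y, f (k *: x + y) = k *: f x + f y) ->
  (forall s, S s -> kspan K S' (f s)) -> kspan K S v -> kspan K S' (f v).
Proof.
move=> KM fl h; elim=> [|k s x Kk Ss _ IH].
  have : f 0 + f 0 = f 0 + 0 by rewrite addr0 -{3}(addr0 0) -[X in f (X + _)](scaler0 _ 1) fl scale1r.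
  by move=> /addrI ->; constructor.
by rewrite fl; apply: kspanD => //; apply: kspanZ => //; exact: h.
Qed.
Section PartialSums.
Variable V : nmodType.
Implicit Types g : nat -> V.

Definition Lt g n := \sum_(m < n) g m.
Definition Le g n := \sum_(m < n.+1) g m.

Lemma Lt0 g : Lt g 0 = 0. Proof. exact: big_ord0. Qed.
Lemma LtS g n : Lt g n.+1 = Lt g n + g n. Proof. exact: big_ord_recr. Qed.
Lemma LeE g n : Le g n = Lt g n + g n. Proof. exact: big_ord_recr. Qed.

End PartialSums.

Section InvBinomial.
Variable R : realType.

Lemma b_0 : b_ R 0 = 1.
Proof. by rewrite /b_ muln0 bin0 expr0 invr1 mulr1. Qed.

Lemma b_S n : b_ R n.+1 = b_ R n * (2 * n%:R + 2) / (2 * n%:R + 1).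
Proof.
have c0 m : ('C(2 * m, m))%:R != 0 :> R by rewrite pnatr_eq0 -lt0n bin_gt0; lia.
have rec : ('C(2 * n.+1, n.+1) * n.+1 = 2 * (2 * n).+1 * 'C(2 * n, n))%N.
  have e1 := mul_bin_diag (2 * n).+1 n; have e2 := mul_bin_down (2 * n).+1 n.
  have e3 := binS (2 * n).+1 n; have e4 := mul_bin_diag (2 * n) n.
  have := mul_bin_left (2 * n) n.
  rewrite (_ : (2 * n.+1 = (2 * n).+2)%N); last lia.
  move: e1 e2 e3 e4; rewrite /=.
  have -> : ((2 * n).+1 - n = n.+1)%N by lia.
  have -> : (2 * n - n = n)%N by lia.
  nia.
have {}rec : 'C(2 * n.+1, n.+1)%:R * (n%:R + 1) = 2 * (2 * n%:R + 1) * 'C(2 * n, n)%:R :> R.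
  by rewrite natr1 -natrM rec !natrM -[(2 * n).+1%:R]natr1 natrM.
rewrite /b_ exprS; move: (c0 n.+1) (c0 n) rec; set X := _%:R; set Y := 'C(2 * n, n)%:R => x0 y0 rec.
have n0 : n%:R + 1 != 0 :> R by rewrite natr1 pnatr_eq0.
have n1 : 2 * n%:R + 1 != 0 :> R by rewrite gt_eqF// ltr_wpDl// mulr_ge0.
have -> : X = 2 * (2 * n%:R + 1) * Y / (n%:R + 1) by rewrite -rec mulfK.
by field; rewrite n1 y0 n0.
Qed.

Lemma b_gt0 n : 0 < b_ R n.
Proof. by rewrite /b_ mulr_gt0 ?exprn_gt0// invr_gt0 ltr0n bin_gt0; lia. Qed.

Lemma odd_gt0 n : 0 < 2 * n%:R + 1 :> R.
Proof. by rewrite ltr_wpDl// mulr_ge0. Qed.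

Lemma b_le_succ n : b_ R n <= n.+1%:R.
Proof.
elim: n => [|n IH]; first by rewrite b_0.
rewrite b_S ler_pdivrMr ?odd_gt0//; move: IH; rewrite -[n.+2%:R]natr1 -natr1.
have : 0 <= n%:R :> R by []; have := b_gt0 n; set B := b_ R n; set N := n%:R; nra.
Qed.

Lemma b_sqr_le n : b_ R n ^+ 2 <= 4 * n%:R + 1.
Proof.
elim: n => [|n IH]; first by rewrite b_0 expr1n mulr0 add0r.
rewrite b_S -[n.+1%:R]natr1 expr_div_n ler_pdivrMr ?exprn_gt0 ?odd_gt0// exprMn.
have N0 : 0 <= n%:R :> R by [].
have h : b_ R n ^+ 2 * (2 * n%:R + 2) ^+ 2 <= (4 * n%:R + 1) * (2 * n%:R + 2) ^+ 2.
  by rewrite ler_wpM2r// sqr_ge0.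
by apply: le_trans h _; move: N0; set N := n%:R => N0; rewrite -subr_ge0; have -> : (4 * (N + 1) + 1) * (2 * N + 1) ^+ 2 - (4 * N + 1) * (2 * N + 2) ^+ 2 = 1 by ring.
Qed.

Definition i0 n : R := (2 * n%:R)^-1.
Definition i1 n : R := (2 * n%:R + 1)^-1.
Definition im n : R := (2 * n%:R - 1)^-1.

(* [(true, k)] and [(false, k)] stand for the summation steps over [2 m] (with <)
   and over [2 m + 1] (with <=), with exponent [k + 1]. *)
Fixpoint gseq (t : seq (bool * nat)) : nat -> R :=
  match t with
  | [::] => @delta0 R
  | (true, k) :: t' => fun n => i0 n ^+ k.+1 * Lt (gseq t') n
  | (false, k) :: t' => fun n => i1 n ^+ k.+1 * Le (gseq t') n
  end.

Definition gwt (t : seq (bool * nat)) : nat := (\sum_(p <- t) p.2.+1)%N.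

Lemma i0_ge0 n : 0 <= i0 n. Proof. by rewrite invr_ge0 mulr_ge0. Qed.
Lemma i1_gt0 n : 0 < i1 n. Proof. by rewrite invr_gt0 odd_gt0. Qed.
Lemma i1_le1 n : i1 n <= 1.
Proof. by rewrite /i1 invf_le1 ?odd_gt0// lerDr mulr_ge0. Qed.
Lemma i0_le1 n : i0 n <= 1.
Proof.
case: n => [|n]; first by rewrite /i0 mulr0 invr0.
by rewrite /i0 invf_le1 ?mulr_gt0// -natrM ler1n.
Qed.

Lemma gseq_01 t n : 0 <= gseq t n <= 1.
Proof.
elim: t n => [|[[] k] t IH] n /=.
- by rewrite /delta0; case: (n == 0%N); rewrite /= ?lexx ler01.
- have s0 : 0 <= Lt (gseq t) n by apply: sumr_ge0 => i _; case/andP: (IH i).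
  have s1 : Lt (gseq t) n <= n%:R.
    rewrite -[X in _ <= X%:R](card_ord n) -sum1_card natr_sum; apply: ler_sum => i _; by case/andP: (IH i).
  rewrite mulr_ge0 ?exprn_ge0 ?i0_ge0//= exprSr -mulrA.
  have : i0 n * Lt (gseq t) n <= 1.
    apply: le_trans (ler_wpM2l (i0_ge0 n) s1) _; case: n {s0 s1} => [|n]; first by rewrite mulr0.
    by rewrite /i0 mulrC ler_pdivrMr ?mulr_gt0// mul1r ler_peMl// ler1n.
  have := exprn_ile1 k (i0_ge0 n) (i0_le1 n); have := exprn_ge0 k (i0_ge0 n).
  have : 0 <= i0 n * Lt (gseq t) n by rewrite mulr_ge0 ?i0_ge0.
  set X := i0 n * _; set E := _ ^+ k; nra.
- have s0 : 0 <= Le (gseq t) n by apply: sumr_ge0 => i _; case/andP: (IH i).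
  have s1 : Le (gseq t) n <= n.+1%:R.
    rewrite -[X in _ <= X%:R](card_ord n.+1) -sum1_card natr_sum; apply: ler_sum => i _; by case/andP: (IH i).
  rewrite mulr_ge0 ?exprn_ge0 ?(ltW (i1_gt0 n))//= exprSr -mulrA.
  have : i1 n * Le (gseq t) n <= 1.
    apply: le_trans (ler_wpM2l (ltW (i1_gt0 n)) s1) _.
    by rewrite /i1 mulrC ler_pdivrMr ?odd_gt0// mul1r -natr1 lerD2r ler_peMl// ler1n.
  have := exprn_ile1 k (ltW (i1_gt0 n)) (i1_le1 n); have := exprn_ge0 k (ltW (i1_gt0 n)).
  have : 0 <= i1 n * Le (gseq t) n by rewrite mulr_ge0// ltW ?i1_gt0.
  set X := i1 n * _; set E := _ ^+ k; nra.
Qed.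

Lemma gseq_ge0 t n : 0 <= gseq t n. Proof. by case/andP: (gseq_01 t n). Qed.

Lemma Lt_gseq_ge0 t n : 0 <= Lt (gseq t) n.
Proof. by apply: sumr_ge0 => i _; exact: gseq_ge0. Qed.

Lemma Le_gseq_ge0 t n : 0 <= Le (gseq t) n.
Proof. by apply: sumr_ge0 => i _; exact: gseq_ge0. Qed.

Lemma Le_gseq_le t n : Le (gseq t) n <= n.+1%:R.
Proof.
rewrite -[X in _ <= X%:R](card_ord n.+1) -sum1_card natr_sum; apply: ler_sum => i _.
by case/andP: (gseq_01 t i).
Qed.

Lemma rad1_quadratic (k : nat -> R) : (forall n, `|k n| <= n.+1%:R ^+ 2) -> rad1 k.
Proof.
move=> h; have r1 : rad1 (cst (1 : R)) by apply: (@rad1_bounded _ _ 1) => n; rewrite normr1.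
apply: (rad1_le _ (rad1_succ (rad1_succ r1))) => n.
by apply: le_trans (h n) _; rewrite mulr1 -expr2 ger0_norm// sqr_ge0.
Qed.

Lemma rad1_b_gseq t : rad1 (fun n => b_ R n * gseq t n).
Proof.
apply: rad1_quadratic => n; rewrite ger0_norm ?mulr_ge0 ?gseq_ge0 ?(ltW (b_gt0 _))// expr2.
rewrite ler_pM ?gseq_ge0 ?(ltW (b_gt0 _))// ?b_le_succ//.
by case/andP: (gseq_01 t n) => _ /le_trans; apply; rewrite ler1n.
Qed.

Lemma rad1_b_i1_Le t : rad1 (fun n => b_ R n * i1 n * Le (gseq t) n).
Proof.
apply: rad1_quadratic => n.
rewrite ger0_norm ?mulr_ge0 ?Le_gseq_ge0 ?(ltW (b_gt0 _)) ?(ltW (i1_gt0 _))// expr2.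
rewrite ler_pM ?Le_gseq_le ?Le_gseq_ge0 ?mulr_ge0 ?(ltW (b_gt0 _)) ?(ltW (i1_gt0 _))//.
by apply: le_trans (b_le_succ n); rewrite ler_piMr ?i1_le1// ltW ?b_gt0.
Qed.



Definition psy (k : nat -> R) (u : R) := psum k (sf u ^+ 2).

Lemma sf2_norm (u : R) : 0 <= u < 1 -> `|sf u ^+ 2| < 1.
Proof.
move=> /andP[+ u1]; rewrite le_eqVlt => /predU1P[<-|u0].
  by rewrite sf0 expr0n normr0.
have /andP[_ h] : 0 <= sf u ^+ 2 < 1 by apply: sf2_01; rewrite u0 u1.
by rewrite ger0_norm ?sqr_ge0.
Qed.

Lemma psyD k1 k2 u : rad1 k1 -> rad1 k2 -> 0 <= u < 1 -> psy (k1 + k2) u = psy k1 u + psy k2 u.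
Proof. by move=> r1 r2 u01; rewrite /psy psumD// sf2_norm. Qed.

Lemma psyZ c k u : rad1 k -> 0 <= u < 1 -> psy (c *: k) u = c * psy k u.
Proof. by move=> r1 u01; rewrite /psy psumZ// sf2_norm. Qed.

Lemma psy_shiftr k u : rad1 k -> 0 <= u < 1 -> psy (shiftr k) u = sf u ^+ 2 * psy k u.
Proof. by move=> r1 u01; rewrite /psy psum_shiftr// sf2_norm. Qed.

Lemma psy0 k : psy k 0 = k 0%N.
Proof. by rewrite /psy sf0 expr0n psum0. Qed.

Definition mulidx (k : nat -> R) : nat -> R := fun n => 2 * n%:R * k n.

Lemma rad1_mulidx k : rad1 k -> rad1 (mulidx k).
Proof.
move=> rk; apply: (rad1_le _ (rad1Z 2 (rad1_succ rk))) => n.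
rewrite /mulidx !fctE /GRing.scale/= mulrA !normrM ler_wpM2r// ler_wpM2l//.
by rewrite !ger0_norm// ler_nat.
Qed.

Lemma has_deriv_psy k : rad1 k -> has_deriv (psy k) (fun u => lval LCot u * psy (mulidx k) u).
Proof.
move=> rk; have hs := has_derivX 1 (has_deriv_sf R).
have s00 : sf (0 : R) ^+ 2 = 0 by rewrite sf0 expr0n.
apply: (has_deriv_eq _ (has_deriv_psum_comp rk hs s00 (@sf2_01 R))) => u /andP[u0 u1].
have -> : mulidx k = 2 *: shiftr (pseries_diffs k).
  apply/funext => -[|n]; rewrite /mulidx !fctE /GRing.scale/= ?mulr0 ?mul0r//.
  by rewrite /pseries_diffs mulrA.
have rd := rad1_diffs rk; have u01 : 0 <= u < 1 by rewrite ltW.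
rewrite psyZ ?psy_shiftr//; last exact: rad1_shiftr.
rewrite /psy /lval expr1; field; by rewrite gt_eqF// sf_gt0.
Qed.

Definition bg t n := b_ R n * gseq t n.
Definition bphi t n := b_ R n * i1 n * Le (gseq t) n.
Definition phi t (u : R) := cf u * sf u * psy (bphi t) u.
Definition xpsi t (u : R) := sf u * psy (bg t) u.

Lemma i1_odd n : (2 * n%:R + 1) * i1 n = 1.
Proof. by rewrite mulfV// gt_eqF// odd_gt0. Qed.

Lemma b_S_i0 n : b_ R n.+1 * i0 n.+1 = b_ R n * i1 n.
Proof.
rewrite b_S /i0 /i1 -natr1; field.
have := odd_gt0 n; have : 0 <= n%:R :> R by [].
by set N := n%:R => h1 h2; apply/andP; split; rewrite gt_eqF//; lra.
Qed.

Lemma lval_cot_sf (u : R) : 0 < u -> lval LCot u * sf u = hf u * cf u.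
Proof. by move=> u0; rewrite /lval divfK// gt_eqF// sf_gt0. Qed.

Lemma has_deriv_phi t : has_deriv (phi t) (fun u => hf u * psy (bg t) u).
Proof.
have rk : rad1 (bphi t) by exact: rad1_b_i1_Le.
have rm := rad1_mulidx rk; have rb : rad1 (bg t) by exact: rad1_b_gseq.
have h := has_derivM (has_derivM (has_deriv_cf R) (has_deriv_sf R)) (has_deriv_psy rk).
apply: (has_deriv_eq _ h) => u /andP[u0 u1]; have u01 : 0 <= u < 1 by rewrite ltW.
have e : bg t + shiftr (mulidx (bphi t) + 2 *: bphi t) = mulidx (bphi t) + bphi t.
  apply/funext => -[|n]; rewrite !fctE /bg /mulidx /bphi /GRing.scale/=.
    by rewrite mulr0 mul0r add0r addr0 /i1 mulr0 add0r invr1 LeE Lt0 add0r mulr1.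
  have e1 := i1_odd n.+1; have e0 := i1_odd n.
  have eb : b_ R n.+1 = (2 * n%:R + 2) * (b_ R n * i1 n) by rewrite b_S /i1; ring.
  have -> : forall x : R, 2 * n.+1%:R * x + x = (2 * n.+1%:R + 1) * x by move=> x; ring.
  rewrite !LeE LtS; set L := Lt _ n; set G := gseq t n; set G1 := gseq t n.+1.
  have -> : (2 * n.+1%:R + 1) * (b_ R n.+1 * i1 n.+1 * (L + G + G1)) = b_ R n.+1 * (L + G + G1).
    by rewrite mulrA mulrCA e1 mulr1.
  rewrite eb; ring.
have /(congr1 (fun k => psy k u)) := e.
have r2 := rad1Z 2 rk; have rs := rad1D rm r2; have rs' := rad1_shiftr rs.
rewrite !psyD// psy_shiftr// !psyD// psyZ//.
have := lval_cot_sf u0; have := sf2_cf2 u.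
set B := psy (bg t) u; set K := psy (bphi t) u; set M := psy (mulidx _) u.
set x := sf u; set c := cf u; set h' := hf u; set L := lval _ _ => e1 e2 e3.
have -> : (- (x * h') * x + c * (c * h')) * K + c * x * (L * M) = h' * ((c ^+ 2 - x ^+ 2) * K) + c * (L * x) * M by ring.
rewrite e2; have c2 : c ^+ 2 = 1 - x ^+ 2 by rewrite -e1; ring.
transitivity (h' * ((c ^+ 2 - x ^+ 2) * K + c ^+ 2 * M)); first ring.
congr (_ * _); have -> : B = M + K - x ^+ 2 * (M + 2 * K).
  by rewrite -e3; ring.
rewrite c2; ring.
Qed.

Lemma phi0 t : phi t 0 = 0. Proof. by rewrite /phi sf0 mulr0 mul0r. Qed.
Lemma xpsi0 t : xpsi t 0 = 0. Proof. by rewrite /xpsi sf0 mul0r. Qed.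

Lemma bg_true0 k t : bg ((true, k) :: t) 0%N = 0.
Proof. by rewrite /bg/= Lt0 !mulr0. Qed.

Lemma psy_A1 t u : 0 <= u < 1 -> psy (bg ((true, 0%N) :: t)) u = sf u / cf u * phi t u.
Proof.
move=> u01; have -> : bg ((true, 0%N) :: t) = shiftr (bphi t).
  by apply/funext => -[|n]; rewrite ?bg_true0// /bg /bphi/= expr1 mulrA b_S_i0.
rewrite psy_shiftr//; last exact: rad1_b_i1_Le.
by rewrite /phi; field; rewrite gt_eqF// cf_gt0.
Qed.

Lemma has_deriv_AS k t : has_deriv (psy (bg ((true, k.+1) :: t)))
  (fun u => lval LCot u * psy (bg ((true, k) :: t)) u).
Proof.
have := has_deriv_psy (rad1_b_gseq ((true, k.+1) :: t)).
congr has_deriv; apply/funext => u; congr (_ * psy _ _).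
apply/funext => -[|n]; rewrite /mulidx /bg/=; first by rewrite mulr0 mul0r Lt0 !mulr0.
have e : 2 * n.+1%:R * i0 n.+1 = 1 by rewrite mulfV// mulf_neq0 ?pnatr_eq0.
rewrite [i0 _ ^+ k.+2]exprS; move: e; set N := n.+1%:R; set X := i0 _; set Y := X ^+ k.+1 => e.
by transitivity ((2 * N * X) * (b_ R n.+1 * (Y * Lt (gseq t) n.+1))); [ring|rewrite e mul1r].
Qed.

Lemma xpsi_B1 t u : 0 <= u < 1 -> xpsi ((false, 0%N) :: t) u = phi t u / cf u.
Proof.
move=> u01; rewrite /xpsi /phi (_ : bg _ = bphi t); last first.
  by apply/funext => n; rewrite /bg /bphi/= expr1 mulrA.
by field; rewrite gt_eqF// cf_gt0.
Qed.

Lemma has_deriv_BS k t : has_deriv (xpsi ((false, k.+1) :: t))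
  (fun u => lval LCot u * xpsi ((false, k) :: t) u).
Proof.
have rk := rad1_b_gseq ((false, k.+1) :: t).
apply: (has_deriv_eq _ (has_derivM (has_deriv_sf R) (has_deriv_psy rk))) => u /andP[u0 u1].
rewrite /xpsi; have -> : bg ((false, k) :: t) = bg ((false, k.+1) :: t) + mulidx (bg ((false, k.+1) :: t)).
  apply/funext => n; rewrite !fctE /mulidx /bg/= [i1 _ ^+ k.+2]exprS.
  have := i1_odd n; set X := i1 n; set Y := X ^+ k.+1; set L := Le _ _ => e.
  by transitivity ((2 * n%:R + 1) * X * (b_ R n * (Y * L))); [rewrite e mul1r|ring].
rewrite psyD ?(ltW u0)//; last exact: rad1_mulidx.
have := lval_cot_sf u0; rewrite -/(bg _); set L := lval _ _ => e; ring: e.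
Qed.


Fixpoint sint n (u : R) : R :=
  if n is m.+1 then ((2 * m%:R + 2) * sint m u - sf u ^+ (2 * m).+2 * cf u) / (2 * m%:R + 3)
  else 1 - cf u.

Lemma sint0 n : sint n 0 = 0.
Proof.
elim: n => [|n IH] /=; first by rewrite cf0 subrr.
by rewrite IH sf0 expr0n mul0r mulr0 subrr mul0r.
Qed.

Lemma has_deriv_sint n : has_deriv (sint n) (fun u => hf u * sf u * (sf u ^+ 2) ^+ n).
Proof.
elim: n => [|n IH].
  apply: (has_deriv_eq _ (has_derivB (has_deriv_cst (1 : R)) (has_deriv_cf R))) => u _.
  by rewrite sub0r opprK expr0 mulr1 mulrC.
have h := has_derivZ (2 * n%:R + 3)^-1 (has_derivB (has_derivZ (2 * n%:R + 2) IH)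
  (has_derivM (has_derivX (2 * n).+1 (has_deriv_sf R)) (has_deriv_cf R))).
have {h} h := has_deriv_eq _ h.
have -> : sint n.+1 = (fun u => (2 * n%:R + 3)^-1 * ((2 * n%:R + 2) * sint n u - sf u ^+ (2 * n).+2 * cf u)).
  by apply/funext => u /=; rewrite mulrC.
apply: h => u _; rewrite -[(2 * n).+2%:R]natr1 -[(2 * n).+1%:R]natr1 natrM.
have e := sf2_cf2 u; rewrite [(_ ^+ 2) ^+ n.+1]exprS.
have -> : sf u ^+ (2 * n).+2 = sf u * (sf u * (sf u ^+ 2) ^+ n) by rewrite !exprS exprM expr0 mulr1 -expr2.
have -> : sf u ^+ (2 * n).+1 = sf u * (sf u ^+ 2) ^+ n by rewrite exprS exprM.
set x := sf u; set c := cf u; set h' := hf u; set E := (x ^+ 2) ^+ n.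
have c2 : c * c = 1 - x * x by rewrite -e /x /c; ring.
have n3 : 2 * n%:R + 3 != 0 :> R by have := odd_gt0 n => o; rewrite gt_eqF//; lra.
transitivity ((2 * n%:R + 3)^-1 * ((2 * n%:R + 2) * h' * x * E * (1 - c * c) + x * x * x * E * h')).
  by rewrite -/x; ring.
by rewrite c2; field.
Qed.

Lemma sint_cvg1 n : sint n u @[u --> 1^'-] --> b_ R n * i1 n.
Proof.
elim: n => [|n IH].
  rewrite b_0 /i1 mulr0 add0r invr1 mulr1 -[X in _ --> X]subr0.
  by apply: cvgB; [exact: cvg_cst|exact: cf_cvg1].
have -> : b_ R n.+1 * i1 n.+1 = ((2 * n%:R + 2) * (b_ R n * i1 n) - 1 * 0) / (2 * n%:R + 3).
  rewrite mulr0 subr0 b_S /i1 -natr1; field; have := odd_gt0 n => o.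
  by apply/andP; split; rewrite gt_eqF//; lra.
have c : sf u ^+ (2 * n).+2 @[u --> 1^'-] --> (1 : R).
  elim: (2 * n).+2 => [|m IHm]; first exact: cvg_cst.
  rewrite -[X in _ --> X]mulr1 (_ : (fun u => _) = (fun u : R => sf u * sf u ^+ m)).
    by apply: cvgM; [exact: sf_cvg1|].
  by apply/funext => u; rewrite exprS.
apply: cvgM; last exact: cvg_cst.
apply: cvgB; first by apply: cvgM; [exact: cvg_cst|].
by apply: cvgM => //; exact: cf_cvg1.
Qed.

End InvBinomial.
Section WordSpans.
Variable R : realType.
Implicit Types (l : letter) (t : seq letter).

Definition QR : set R := range (@ratr R).

Lemma QR_M (x y : R) : QR x -> QR y -> QR (x * y).
Proof. by move=> [p _ <-] [q _ <-]; exists (p * q) => //; rewrite rmorphM. Qed.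

Lemma QR_1 : QR 1. Proof. by exists 1 => //; rewrite rmorph1. Qed.

Definition isTh l := if l is LTh then true else false.
Definition isRho l := if l is LRho then true else false.
Definition isTan l := if l is LTan then true else false.

(* Only the form of [LTan] has a pole at u = 1. *)
Definition conv_word t := if t is l :: _ then ~~ isTan l else true.

Definition pureW (cv : bool) (p : bool) (w : nat) : set (nat -> R) :=
  [set wseq R t | t in [set t | [/\ wok t, ~~ has isRho t, odd (count isTh t) = p,
     size t = w & cv ==> conv_word t]]].

Definition mixW (cv : bool) (w : nat) : set (nat -> R) :=
  [set wseq R t | t in [set t | [/\ wok t, (size t <= w)%N & cv ==> conv_word t]]].

Lemma kspan_cvg0 (S : set (nat -> R)) a : (forall s, S s -> s @ \oo --> (0 : R)) ->
  kspan QR S a -> a @ \oo --> (0 : R).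
Proof.
move=> h; elim=> [|k s v _ Ss _ IH]; first exact: cvg_cst.
rewrite -[X in _ --> X](addr0 (0 : R)) -[X in _ --> X + _](scaler0 _ k); apply: cvgD => //.
by apply: cvgZr; exact: h.
Qed.

Lemma pureW_cvg0 cv p w a : kspan QR (pureW cv p w) a -> a @ \oo --> (0 : R).
Proof. by apply: kspan_cvg0 => _ [t _ <-]; exact: wseq_cvg0. Qed.

Lemma mixW_cvg0 cv w a : kspan QR (mixW cv w) a -> a @ \oo --> (0 : R).
Proof. by apply: kspan_cvg0 => _ [t _ <-]; exact: wseq_cvg0. Qed.

Lemma pureW_zero cv p w a : kspan QR (pureW cv p w.+1) a -> a 0%N = 0.
Proof.
elim=> // k s v _ [[|l t] [_ _ _ //= sz _] <-] _ IH.
by rewrite !fctE IH /= lop0 scaler0 addr0.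
Qed.

Lemma lop_pureW l cv p w a : ~~ isRho l -> (kap l -> (0 < w)%N) ->
  kspan QR (pureW cv p w) a -> kspan QR (pureW (~~ isTan l) (isTh l (+) p) w.+1) (lop l a).
Proof.
move=> nR kw; apply: kspan_bind; [exact: QR_M|exact: lop_linear|].
move=> _ [t [h1 h2 h3 h4 h5] <-]; apply: kspan_in; first exact: QR_1.
exists (l :: t) => //; split => /=; rewrite ?negb_or ?nR ?h2 ?oddD ?h3 ?h4//.
- case: t h1 h4 {h2 h3 h5} => [_ h4|x t h1 _]; last exact: h1.
  by apply/negP => /kw; rewrite -h4.
- by rewrite oddb.
- by apply/implyP.
Qed.

Definition pspan cv p w (f : R -> R) :=
  exists2 a, kspan QR (pureW cv p w) a & forall u, 0 <= u < 1 -> f u = psum a u.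

Lemma pspan_int l cv p w f F : ~~ isRho l -> (kap l -> (0 < w)%N) ->
  pspan cv p w f -> has_deriv F (fun u => lval l u * f u) -> F 0 = 0 ->
  pspan (~~ isTan l) (isTh l (+) p) w.+1 F.
Proof.
move=> nR kw [a ha fa] hF F0; exists (lop l a); first exact: lop_pureW ha.
have a0 := pureW_cvg0 ha.
apply: (has_deriv_unique hF (has_deriv_lop a0 _)).
- move=> /kw; case: w ha {kw} => // w ha _; exact: pureW_zero ha.
- by move=> u /andP[u0 u1]; rewrite fa// ltW.
- by rewrite F0 psum0 lop0.
Qed.

Implicit Types (g : seq (bool * nat)).

Lemma gwt_cons b k g : gwt ((b, k) :: g) = (k.+1 + gwt g)%N.
Proof. by rewrite /gwt big_cons. Qed.

Section Step.
Variable g : seq (bool * nat).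
Hypothesis IH : pspan false true (gwt g).+1 (@phi R g).

Lemma pspan_A k : pspan true false (gwt ((true, k.+1) :: g)) (psy (@bg R ((true, k.+1) :: g))).
Proof.
elim: k => [|k IHk].
  rewrite gwt_cons; apply: (@pspan_int LTh _ _ _ _ _ _ _ IH) => //; last by rewrite psy0 bg_true0.
  apply: (has_deriv_eq _ (@has_deriv_AS R 0 g)) => u /andP[u0 u1].
  have u01 : 0 <= u < 1 by rewrite ltW.
  by rewrite psy_A1// /lval; field; rewrite !gt_eqF// ?sf_gt0 ?cf_gt0.
rewrite gwt_cons addSn -(gwt_cons true); apply: (@pspan_int LCot _ _ _ _ _ _ _ IHk) => //; [by rewrite gwt_cons| |by rewrite psy0 bg_true0].
exact: has_deriv_AS.
Qed.

Lemma pspan_B k : pspan true true (gwt ((false, k.+1) :: g)) (@xpsi R ((false, k.+1) :: g)).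
Proof.
elim: k => [|k IHk].
  rewrite gwt_cons; apply: (@pspan_int LU _ _ _ _ _ _ _ IH) => //; last by rewrite xpsi0.
  apply: (has_deriv_eq _ (@has_deriv_BS R 0 g)) => u /andP[u0 u1].
  have u01 : 0 <= u < 1 by rewrite ltW.
  by rewrite xpsi_B1// /lval; field; rewrite !gt_eqF// ?sf_gt0 ?cf_gt0.
rewrite gwt_cons addSn -(gwt_cons false); apply: (@pspan_int LCot _ _ _ _ _ _ _ IHk) => //; [by rewrite gwt_cons| |by rewrite xpsi0].
exact: has_deriv_BS.
Qed.

End Step.

Lemma pspan_phi g : pspan false true (gwt g).+1 (@phi R g).
Proof.
have weak cv p w f : pspan cv p w f -> pspan false p w f.
  move=> [a ha fa]; exists a => //; apply: kspan_sub ha => _ [x [h1 h2 h3 h4 h5] <-].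
  by exists x.
elim: g => [|[[] [|k]] g IH].
- rewrite /gwt big_nil; apply: (weak true).
  have d0 : pspan true false 0 (psum (@delta0 R)).
    by exists (@delta0 R) => //; apply: kspan_in; [exact: QR_1|exists [::]].
  apply: (@pspan_int LTh _ _ _ _ _ _ _ d0); rewrite ?phi0//.
  apply: (has_deriv_eq _ (@has_deriv_phi R [::])) => u /andP[u0 u1]; congr (_ * _).
  rewrite psum_delta0 /psy (_ : @bg R [::] = @delta0 R) ?psum_delta0//.
  apply/funext => -[|n]; rewrite /bg /delta0/= ?mulr0// b_0 mulr1//.
- rewrite gwt_cons; apply: (@pspan_int LTan _ _ _ _ _ _ _ IH); rewrite ?phi0//.
  apply: (has_deriv_eq _ (@has_deriv_phi R ((true, 0%N) :: g))) => u /andP[u0 u1].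
  by rewrite psy_A1 ?(ltW u0)// /lval; ring.
- apply: weak; apply: (@pspan_int LTh _ _ _ _ _ _ _ (pspan_A IH k)); rewrite ?phi0//.
  exact: has_deriv_phi.
- have [a ha fa] := IH; exists (lop LCot a + lop LTan a).
    rewrite gwt_cons; apply: kspanD.
      apply: (kspan_sub _ (@lop_pureW LCot _ _ _ _ _ _ ha)) => // _ [x [h1 h2 h3 h4 h5] <-].
      by exists x.
    exact: (@lop_pureW LTan _ _ _ _ _ _ ha).
  have a0 := pureW_cvg0 ha; have az := pureW_zero ha.
  have hd := has_derivD (has_deriv_lop (l := LCot) a0 (fun=> az)) (has_deriv_lop (l := LTan) a0 (fun=> az)).
  move=> u u01; have nu : `|u| < 1 by case/andP: u01 => u0 u1; rewrite ger0_norm.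
  rewrite psumD//; [|exact: (cvg_rad1 (lop_cvg0 _ a0))..].
  apply: (has_deriv_unique (@has_deriv_phi R ((false, 0%N) :: g)) hd) => //; last first.
    by rewrite phi0 !psum0 !lop0 addr0.
  move=> v /andP[v0 v1]; have v01 : 0 <= v < 1 by rewrite ltW.
  rewrite -mulrDl -fa//; have := xpsi_B1 g v01; rewrite /xpsi.
  set P := psy _ v; set F := phi g v => e.
  have x0 : sf v != 0 by rewrite gt_eqF// sf_gt0.
  have c0 : cf v != 0 by rewrite gt_eqF// cf_gt0.
  have -> : P = F / cf v / sf v by rewrite -e mulrC mulKf.
  rewrite /lval; have := sf2_cf2 v; set x := sf v; set c := cf v => e1.
  have -> : hf v * (F / c / x) = (x ^+ 2 + c ^+ 2) * (hf v * (F / c / x)) by rewrite e1 mul1r.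
  by field; rewrite c0 x0.
- apply: weak; apply: (@pspan_int LU _ _ _ _ _ _ _ (pspan_B IH k)); rewrite ?phi0// ?gwt_cons//.
  apply: (has_deriv_eq _ (@has_deriv_phi R ((false, k.+1) :: g))) => u /andP[u0 u1].
  by rewrite /lval /xpsi mulrA divfK// gt_eqF// sf_gt0.
Qed.

Definition transfer cv p w (f : nat -> R) := exists2 a, kspan QR (pureW cv p w) a &
  forall y : R, series a @ \oo --> y -> series f @ \oo --> y.

Lemma transfer_A k g : transfer true false (gwt ((true, k.+2) :: g))
  (fun n => b_ R n ^+ 2 * gseq R ((true, k.+2) :: g) n).
Proof.
have [aG hG eG] := pspan_A (pspan_phi g) k; exists (lop LU aG).
  rewrite gwt_cons addSn -(gwt_cons true); apply: (@lop_pureW LU _ _ _ _ _ _ hG) => // _.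
  by rewrite gwt_cons.
move=> l /abel hl.
have a0 := pureW_cvg0 hG.
have az : aG 0%N = 0 by move: hG; rewrite gwt_cons => /pureW_zero.
have hd := has_deriv_lop (l := LU) a0 (fun=> az).
pose kk n := @bg R ((true, k.+1) :: g) n.+1.
have rk : rad1 kk by apply: rad1_tail; exact: rad1_b_gseq.
have e : @bg R ((true, k.+1) :: g) = shiftr kk.
  by apply/funext => -[|n]; rewrite ?bg_true0.
have hd' : has_deriv (psum (lop LU aG)) (fun u => hf u * sf u * psum kk (sf u ^+ 2)).
  apply: has_deriv_eq hd => u /andP[u0 u1]; rewrite -eG ?(ltW u0)// e psy_shiftr ?(ltW u0)//.
  by rewrite /lval /psy; field; rewrite gt_eqF// sf_gt0.
have sq := squeeze rk _ _ (@sf2_01 R) _ (@has_deriv_sint R) (@sint0 R) (@sint_cvg1 R) hd' _ hl.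
rewrite -cvg_shiftS.
have -> : (fun n => series (fun n => b_ R n ^+ 2 * gseq R ((true, k.+2) :: g) n) n.+1) =
   series (fun n => kk n * (b_ R n * i1 R n)).
  apply/funext => n; rewrite /series/= big_nat_recl//= Lt0 !mulr0 add0r.
  apply: eq_bigr => i _; rewrite /kk /bg /= -b_S_i0 [i0 R _ ^+ k.+3]exprS; ring.
apply: sq.
- by move=> n; rewrite /kk /bg mulr_ge0 ?gseq_ge0// ltW ?b_gt0.
- by move=> u /andP[u0 u1]; rewrite mulr_ge0// ltW ?hf_gt0 ?sf_gt0.
- exact: sf2_le.
- by rewrite psum0 lop0.
Qed.

Lemma transfer_B k g : transfer true false (gwt ((false, k.+2) :: g))
  (fun n => b_ R n ^+ 2 * gseq R ((false, k.+2) :: g) n).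
Proof.
have [aG hG eG] := pspan_B (pspan_phi g) k; exists (lop LTh aG).
  rewrite gwt_cons addSn -(gwt_cons false); exact: (@lop_pureW LTh _ _ _ _ _ _ hG).
move=> l /abel hl.
have a0 := pureW_cvg0 hG.
have hd := has_deriv_lop (l := LTh) a0 (fun h => False_ind _ (notF h)).
pose kk := @bg R ((false, k.+1) :: g).
have rk : rad1 kk by exact: rad1_b_gseq.
have hd' : has_deriv (psum (lop LTh aG)) (fun u => hf u * sf u * psum kk (sf u ^+ 2)).
  apply: has_deriv_eq hd => u /andP[u0 u1]; rewrite -eG ?(ltW u0)//.
  by rewrite /lval /xpsi /psy mulrA.
have sq := squeeze rk _ _ (@sf2_01 R) _ (@has_deriv_sint R) (@sint0 R) (@sint_cvg1 R) hd' _ hl.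
have -> : (fun n => b_ R n ^+ 2 * gseq R ((false, k.+2) :: g) n) = (fun n => kk n * (b_ R n * i1 R n)).
  apply/funext => n; rewrite /kk /bg /= [i1 R _ ^+ k.+3]exprS; ring.
apply: sq.
- by move=> n; rewrite /kk /bg mulr_ge0 ?gseq_ge0// ltW ?b_gt0.
- by move=> u /andP[u0 u1]; rewrite mulr_ge0// ltW ?hf_gt0 ?sf_gt0.
- exact: sf2_le.
- by rewrite psum0 lop0.
Qed.

End WordSpans.
Section NestedSum.
Variable V : comNzRingType.

Fixpoint nested_seq d : ('I_d -> bool) -> ('I_d -> nat -> V) -> nat -> V :=
  match d with
  | 0 => fun _ _ n => (n == 0%N)%:R
  | d'.+1 => fun st f n => f ord0 n *
      (if st ord0 then @Lt V else @Le V) (nested_seq (fun j => st (lift ord0 j)) (fun j => f (lift ord0 j))) n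
  end.

Definition ffun_cons N d (p : 'I_N * {ffun 'I_d -> 'I_N}) : {ffun 'I_d.+1 -> 'I_N} :=
  [ffun i => if unlift ord0 i is Some j then p.2 j else p.1].

Lemma ffun_cons0 N d (p : 'I_N * {ffun 'I_d -> 'I_N}) : ffun_cons p ord0 = p.1.
Proof. by rewrite ffunE unlift_none. Qed.

Lemma ffun_consS N d (p : 'I_N * {ffun 'I_d -> 'I_N}) j : ffun_cons p (lift ord0 j) = p.2 j.
Proof. by rewrite ffunE liftK. Qed.

Lemma ffun_cons_bij N d : bijective (@ffun_cons N d).
Proof.
exists (fun f : {ffun 'I_d.+1 -> 'I_N} => (f ord0, [ffun j => f (lift ord0 j)])) => [[a q]|f].
  rewrite ffun_cons0; congr (_, _); apply/ffunP => j; by rewrite ffunE ffun_consS.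
apply/ffunP => i; case: (unliftP ord0 i) => [j ->|->]; by rewrite ?ffun_consS ?ffun_cons0/= ?ffunE.
Qed.

Lemma index_at_cons N d (p : 'I_N * {ffun 'I_d -> 'I_N}) k :
  index_at (fun j => ffun_cons p j : nat) k = if k is k'.+1 then index_at (fun j => p.2 j : nat) k' else p.1.
Proof.
rewrite /index_at; case: k => [|k].
  case: insubP => [i _ i0|]; last by rewrite ltn0Sn.
  by rewrite (_ : i = ord0) ?ffun_cons0//; apply: val_inj.
case: insubP => [i ik vi|]; case: insubP => [j jk vj|]//=.
- by rewrite (_ : i = lift ord0 j) ?ffun_consS//; apply: val_inj; rewrite /= vi vj.
- by move=> h; move: ik; rewrite ltnS (negbTE h).
- by rewrite ltnS jk.
Qed.

Lemma chain_cons N d (st : 'I_d.+1 -> bool) (p : 'I_N * {ffun 'I_d -> 'I_N}) :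
  chain st (fun j => ffun_cons p j : nat) =
  (index_at (fun j => p.2 j : nat) 0 < p.1 + ~~ st ord0)%N &&
  chain (fun j => st (lift ord0 j)) (fun j => p.2 j : nat).
Proof.
rewrite /chain; apply/forallP/andP => [h|[h1 /forallP h2] j].
  split; first by have := h ord0; rewrite index_at_cons ffun_cons0; case: (st _); rewrite ?addn0 ?addn1.
  apply/forallP => j; have := h (lift ord0 j); rewrite index_at_cons ffun_consS; exact.
case: (unliftP ord0 j) => [i ->|->]; rewrite index_at_cons ?ffun_consS ?ffun_cons0; first exact: h2.
by move: h1; case: (st _); rewrite ?addn0 ?addn1.
Qed.

Lemma nested_sum_aux d (st : 'I_d -> bool) (f : 'I_d -> nat -> V) N M : (M <= N)%N ->
  \sum_(n : {ffun 'I_d -> 'I_N} | chain st (fun j => n j : nat) && (index_at (fun j => n j : nat) 0 < M)%N)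
     \prod_(j < d) f j (n j) = Lt (nested_seq st f) M.
Proof.
elim: d st f M => [|d IH] st f M MN.
  case: M MN => [|M] MN.
    by rewrite Lt0 big1// => n; rewrite ltn0 andbF.
  rewrite /Lt big_ord_recl/= [X in _ + X]big1 ?addr0//.
  have n0 : {ffun 'I_0 -> 'I_N} by apply: finfun; case.
  rewrite (big_pred1 n0) ?big_ord0// => n /=; rewrite /index_at; case: insubP => //= _.
  rewrite (_ : chain _ _ = true)/=; last by apply/forallP; case.
  by apply/esym/eqP/ffunP; case.
rewrite (reindex (@ffun_cons N d)) /=; last by have [g h1 h2] := ffun_cons_bij N d; exists g => x _.
rewrite (eq_bigl (fun p : 'I_N * {ffun 'I_d -> 'I_N} => (p.1 < M)%N && (chain (fun j => st (lift ord0 j)) (fun j => p.2 j : nat) &&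
  (index_at (fun j => p.2 j : nat) 0 < p.1 + ~~ st ord0)%N))); last first.
  by move=> p; rewrite chain_cons index_at_cons; rewrite andbC; congr (_ && _); rewrite andbC.
rewrite (eq_bigr (fun p : 'I_N * {ffun 'I_d -> 'I_N} => f ord0 p.1 * \prod_(j < d) f (lift ord0 j) (p.2 j))); last first.
  by move=> p _; rewrite big_ord_recl ffun_cons0; congr (_ * _); apply: eq_bigr => j _; rewrite ffun_consS.
rewrite -(pair_big_dep (fun a : 'I_N => (a < M)%N) (fun a (q : {ffun 'I_d -> 'I_N}) => chain (fun j => st (lift ord0 j)) (fun j => q j : nat) &&
  (index_at (fun j => q j : nat) 0 < a + ~~ st ord0)%N) (fun a q => f ord0 a * \prod_(j < d) f (lift ord0 j) (q j)))/=.
rewrite /Lt (big_ord_widen_cond N xpredT (fun m => nested_seq st f m))//=.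
apply: eq_bigr => a aM; rewrite -mulr_sumr.
have aN : (a + ~~ st ord0 <= N)%N.
  by have := ltn_ord a; case: (st _); rewrite ?addn0 ?addn1// => /ltnW.
rewrite (IH (fun j => st (lift ord0 j)) (fun j => f (lift ord0 j)) _ aN).
by congr (_ * _); case: (st _); rewrite ?addn0 ?addn1.
Qed.

Lemma nested_sumE d (st : 'I_d.+1 -> bool) (f : 'I_d.+1 -> nat -> V) N :
  nested_sum st (fun n => \prod_(j < d.+1) f j (n j)) N = Lt (nested_seq st f) N.
Proof.
rewrite -(nested_sum_aux st f (leqnn N)) /nested_sum; apply: eq_bigl => n.
by rewrite /index_at; case: insubP => [j _ _|]//=; rewrite ltn_ord andbT.
Qed.

Lemma nested_sum0 (st : 'I_0 -> bool) (F : ('I_0 -> nat) -> V) (c : V) N :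
  (forall n, F n = c) -> nested_sum st F N = c.
Proof.
move=> Fc; have n0 : {ffun 'I_0 -> 'I_N} by apply: finfun; case.
rewrite /nested_sum (big_pred1 n0) => [|n /=]; first exact: Fc.
rewrite (_ : chain _ _ = true); last by apply/forallP; case.
by apply/esym/eqP/ffunP; case.
Qed.

End NestedSum.
Section ComplexLimits.
Variable R : realType.
Local Notation C := (Cplx R).

Definition inC (x : R) : C := x%:C%C.

Lemma inC_D x y : inC (x + y) = inC x + inC y. Proof. exact: (rmorphD (real_complex R)). Qed.
Lemma inC_N x : inC (- x) = - inC x. Proof. exact: (rmorphN (real_complex R)). Qed.
Lemma inC_M x y : inC (x * y) = inC x * inC y. Proof. exact: (rmorphM (real_complex R)). Qed.
Lemma inC_0 : inC 0 = 0. Proof. exact: (rmorph0 (real_complex R)). Qed.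
Lemma inC_1 : inC 1 = 1. Proof. exact: (rmorph1 (real_complex R)). Qed.
Lemma inC_nat n : inC n%:R = n%:R. Proof. exact: (rmorph_nat (real_complex R)). Qed.
Lemma inC_int n : inC n%:~R = n%:~R. Proof. exact: (rmorph_int (real_complex R)). Qed.
Lemma inC_V x : inC x^-1 = (inC x)^-1. Proof. exact: (fmorphV (real_complex R)). Qed.
Lemma inC_ratr q : inC (ratr q) = ratr q. Proof. exact: (fmorph_eq_rat (real_complex R \o ratr)). Qed.
Lemma inC_sum I (r : seq I) (f : I -> R) : inC (\sum_(i <- r) f i) = \sum_(i <- r) inC (f i).
Proof. exact: (rmorph_sum (real_complex R)). Qed.
Lemma inC_le x y : (inC x <= inC y) = (x <= y). Proof. exact: lecR. Qed.
Lemma inC_lt x y : (inC x < inC y) = (x < y). Proof. exact: ltcR. Qed.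

Lemma norm_inC x : `|inC x| = inC `|x|.
Proof.
have [x0|/ltW x0] := leP 0 x; first by rewrite !ger0_norm// -inC_0 inC_le.
by rewrite !ler0_norm ?inC_N// -inC_0 inC_le.
Qed.

Definition re (z : C) : R := complex.Re z.
Definition imz (z : C) : R := complex.Im z.

Lemma reD z w : re (z + w) = re z + re w. Proof. by case: z w => [a b] [c d]. Qed.
Lemma imzD z w : imz (z + w) = imz z + imz w. Proof. by case: z w => [a b] [c d]. Qed.
Lemma norm_re z : inC `|re z| <= `|z|. Proof. exact: normc_ge_Re. Qed.

Lemma norm_imz z : inC `|imz z| <= `|z|.
Proof.
rewrite [X in _ <= X](normc_def z) /inC lecR /imz; case: z => a b /=.
by rewrite -[X in X <= _]sqrtr_sqr ler_sqrt ?addr_ge0 ?sqr_ge0// lerDr sqr_ge0.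
Qed.

Lemma norm_le_re_imz z : `|z| <= inC (`|re z| + `|imz z|).
Proof.
rewrite [X in X <= _](normc_def z) /inC lecR /imz /re; case: z => a b /=.
have -> : `|a| + `|b| = Num.sqrt ((`|a| + `|b|) ^+ 2) by rewrite sqrtr_sqr [RHS]ger0_norm// addr_ge0.
rewrite ler_wsqrtr// sqrrD !real_normK ?num_real// addrAC lerDl.
by rewrite mulrn_wge0// mulr_ge0.
Qed.

Lemma cplx_pos (e : C) : 0 < e -> exists2 r : R, 0 < r & e = inC r.
Proof.
case: e => a b; rewrite ltcE/= => /andP[/eqP -> a0]; by exists a.
Qed.

Lemma cplx_cvg (u : nat -> C) (z : C) : (fun n => re (u n)) @ \oo --> re z ->
  (fun n => imz (u n)) @ \oo --> imz z -> u @ \oo --> z.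
Proof.
move=> /cvgrPdist_le hr /cvgrPdist_le hi; apply/cvgrPdist_le => e /cplx_pos[r r0 ->].
have r20 : 0 < r / 2 by rewrite divr_gt0.
near=> n; apply: le_trans (norm_le_re_imz _) _; rewrite inC_le [r]splitr; apply: lerD.
  suff : `|re z - re (u n)| <= r / 2 by case: (z) (u n) => [a b] [c d].
  by near: n; apply: hr.
suff : `|imz z - imz (u n)| <= r / 2 by case: (z) (u n) => [a b] [c d].
by near: n; apply: hi.
Unshelve. all: by end_near. Qed.

Lemma cplx_cvg_re (u : nat -> C) (z : C) : u @ \oo --> z -> (fun n => re (u n)) @ \oo --> re z.
Proof.
move=> /cvgrPdist_le h; apply/cvgrPdist_le => e e0.
have : 0 < inC e by rewrite -inC_0 inC_lt.
move=> /h; apply: filterS => n hn; rewrite -inC_le; apply: le_trans hn; apply: le_trans (norm_re _).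
by case: (z) (u n) => [a b] [c d].
Qed.

Lemma cplx_cvg_imz (u : nat -> C) (z : C) : u @ \oo --> z -> (fun n => imz (u n)) @ \oo --> imz z.
Proof.
move=> /cvgrPdist_le h; apply/cvgrPdist_le => e e0.
have : 0 < inC e by rewrite -inC_0 inC_lt.
move=> /h; apply: filterS => n hn; rewrite -inC_le; apply: le_trans hn; apply: le_trans (norm_imz _).
by case: (z) (u n) => [a b] [c d].
Qed.

Lemma cvg_inC_real (u : nat -> R) (z : C) : (fun n => inC (u n)) @ \oo --> z ->
  u @ \oo --> re z /\ z = inC (re z).
Proof.
move=> h; split; first exact: cplx_cvg_re h.
have : (fun n => imz (inC (u n))) @ \oo --> (0 : R) by exact: cvg_cst.
move=> /(cvg_unique _ (cplx_cvg_imz h)) h0; case: z h h0 => a b _ /= h0.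
by rewrite /inC/= -[b]/(imz (a +i* b)%C) h0.
Qed.

Lemma cplx_series_le (v : nat -> C) (g : nat -> R) : (forall n, `|v n| <= inC (g n)) ->
  cvgn (series g) -> cvgn (series v).
Proof.
move=> h cg.
have g0 n : 0 <= g n by rewrite -inC_le inC_0; apply: le_trans (h n).
have key (p : C -> R) : (forall z w, p (z + w) = p z + p w) -> p 0 = 0 ->
    (forall z, inC `|p z| <= `|z|) -> cvgn (fun n => p (series v n)).
  move=> pD p0 pn; have -> : (fun n => p (series v n)) = series (fun n => p (v n)).
    by apply/funext => n; rewrite /series/= (big_morph p pD p0).
  apply: normed_cvg; apply: (series_le_cvg _ _ _ cg) => [n|n|n]; [exact: normr_ge0|exact: g0|].
  rewrite -inC_le; apply: le_trans (h n); exact: pn.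
have /cvg_ex[/= x hx] := key re reD (erefl _) norm_re.
have /cvg_ex[/= y hy] := key imz imzD (erefl _) norm_imz.
by apply: (cvgP ((x +i* y)%C : C)); apply: cplx_cvg.
Qed.


Lemma b_i1 n : b_ R n * i1 R n * (2 * n%:R + 1) = b_ R n.
Proof. by rewrite -mulrA [i1 _ _ * _]mulrC i1_odd mulr1. Qed.

Lemma b_S_sub n : b_ R n.+1 = b_ R n + b_ R n * i1 R n.
Proof. by rewrite b_S -/(i1 R n) -[X in _ = X + _]b_i1; ring. Qed.

Lemma sum_b_i1 n : \sum_(m < n) b_ R m * i1 R m = b_ R n - 1.
Proof.
elim: n => [|n IH]; first by rewrite big_ord0 b_0 subrr.
by rewrite big_ord_recr/= IH b_S_sub addrAC.
Qed.

Lemma bi1_gt0 n : 0 < b_ R n * i1 R n.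
Proof. by rewrite mulr_gt0 ?b_gt0 ?i1_gt0. Qed.

Definition bdiff n := b_ R n * i1 R n / (2 * n%:R + 3).

Lemma bdiffE n : b_ R n * i1 R n - b_ R n.+1 * i1 R n.+1 = bdiff n.
Proof.
rewrite /bdiff b_S -/(i1 R n) /i1 -natr1; field.
have o := odd_gt0 R n; by apply/andP; split; rewrite gt_eqF//; lra.
Qed.

Lemma bdiff_ge0 n : 0 <= bdiff n.
Proof. by rewrite /bdiff mulr_ge0 ?(ltW (bi1_gt0 n))// invr_ge0 addr_ge0// mulr_ge0. Qed.

Lemma cvg_series_bdiff : cvgn (series bdiff).
Proof.
apply: nondecreasing_is_cvgn.
  by apply/nondecreasing_seqP => n; rewrite /series/= big_nat_recr//= lerDl bdiff_ge0.
exists 1 => _ [n _ <-].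
have -> : series bdiff n = 1 - b_ R n * i1 R n.
  elim: n => [|n IH]; first by rewrite /series/= big_geq// b_0 /i1 mulr0 add0r invr1 mulr1 subrr.
  by rewrite seriesSr IH -bdiffE; ring.
by rewrite gerBl ltW ?bi1_gt0.
Qed.

Lemma b_i1_cvg0 : (fun n => b_ R n * i1 R n) @ \oo --> (0 : R).
Proof.
have : cvgn (fun n => b_ R n * i1 R n).
  apply: nonincreasing_is_cvgn; last by exists 0 => _ [n _ <-]; exact/ltW/bi1_gt0.
  by apply/nonincreasing_seqP => n; rewrite -subr_ge0 bdiffE bdiff_ge0.
move=> /cvg_ex[/= y hy]; suff : y = 0 by move=> <-.
have hyy : (fun n => (b_ R n * i1 R n) * (b_ R n * i1 R n)) @ \oo --> y * y by apply: cvgM.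
have h1 : (fun n => 2 * harmonic n) @ \oo --> (2 * 0 : R).
  by apply: cvgM; [exact: cvg_cst|exact: cvg_harmonic].
have : y * y <= 2 * 0.
  apply: (ler_cvg_to hyy h1); apply: nearW => n; rewrite /harmonic/=.
  have -> : b_ R n * i1 R n * (b_ R n * i1 R n) = b_ R n ^+ 2 * (i1 R n) ^+ 2 by ring.
  have o := odd_gt0 R n.
  rewrite /i1 exprVn ler_pdivrMr ?exprn_gt0//; apply: le_trans (b_sqr_le _ n) _.
  rewrite mulrAC ler_pdivlMr// -natr1; have : 0 <= n%:R :> R by []; set N := n%:R; nra.
rewrite mulr0 -expr2 => y2; apply/eqP; rewrite -sqrf_eq0 eq_le y2 sqr_ge0//.
Qed.

(* A pair [(k, z)] carries exponent [k + 1]. *)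
Fixpoint lc (t : seq (nat * C)) : nat -> C :=
  if t is (k, z) :: t' then fun n => z ^+ n / n%:R ^+ k.+1 * Lt (lc t') n
  else fun n => (n == 0%N)%:R.

Definition root4 (t : seq (nat * C)) := all (fun p : nat * C => p.2 ^+ 4 == 1) t.

Lemma norm_root4 (z : C) n : z ^+ 4 == 1 -> `|z ^+ n| = 1.
Proof.
move=> /eqP h; have : `|z| ^+ 4 = 1 by rewrite -normrX h normr1.
by rewrite normrX => /eqP; rewrite pexpr_eq1// => /eqP ->; rewrite expr1n.
Qed.

Lemma norm_natV n k : `|(n%:R ^+ k.+1)^-1 : C| <= inC n%:R^-1.
Proof.
case: n => [|n]; first by rewrite expr0n !invr0 normr0 inC_0.
rewrite normfV normrX normr_nat inC_V inC_nat lef_pV2 ?posrE ?exprn_gt0//.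
by rewrite exprS ler_peMr// exprn_ege1// ler1n.
Qed.

Lemma natV_le_i1 n : n%:R^-1 <= 3 * i1 R n.
Proof.
case: n => [|n]; first by rewrite invr0 mulr_ge0// ltW ?i1_gt0.
rewrite /i1 ler_pdivlMr ?odd_gt0// mulrC ler_pdivrMr// -natr1.
by have : 0 <= n%:R :> R by []; lra.
Qed.

Lemma lc_bound t : root4 t -> exists2 M : R, 0 <= M & forall n, `|lc t n| <= inC (M * (b_ R n * i1 R n)).
Proof.
elim: t => [_|[k z] t IH /= /andP[hz /IH[M M0 hM]]].
  exists 1 => // -[|n] /=; last by rewrite normr0 -inC_0 inC_le mul1r ltW ?bi1_gt0.
  by rewrite normr1 -inC_1 inC_le b_0 /i1 mulr0 add0r invr1 !mulr1.
exists (3 * M) => [|n]; first by rewrite mulr_ge0.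
have hT : `|Lt (lc t) n| <= inC (M * b_ R n).
  apply: le_trans (ler_norm_sum _ _ _) _.
  apply: (@le_trans _ _ (\sum_(i < n) inC (M * (b_ R i * i1 R i)))); first by apply: ler_sum => i _.
  rewrite -inC_sum inC_le -mulr_sumr sum_b_i1 ler_wpM2l//; lra.
rewrite /= !normrM norm_root4// mul1r.
apply: (@le_trans _ _ (inC n%:R^-1 * inC (M * b_ R n))).
  by apply: ler_pM => //; exact: norm_natV.
rewrite -inC_M inC_le; have := natV_le_i1 n; have := b_gt0 R n.
set B := b_ R n; set I := i1 R n; set N := n%:R^-1 => B0 h.
apply: le_trans (_ : 3 * I * (M * B) <= _); last by rewrite le_eqVlt; apply/orP; left; apply/eqP; ring.
by rewrite ler_wpM2r// mulr_ge0// ltW.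
Qed.

Lemma Lt_lc_bound t M n : (forall n, `|lc t n| <= inC (M * (b_ R n * i1 R n))) -> 0 <= M ->
  `|Lt (lc t) n| <= inC (M * b_ R n).
Proof.
move=> hM M0; apply: le_trans (ler_norm_sum _ _ _) _.
apply: (@le_trans _ _ (\sum_(i < n) inC (M * (b_ R i * i1 R i)))); first by apply: ler_sum => i _.
by rewrite -inC_sum inC_le -mulr_sumr sum_b_i1 ler_wpM2l// lerBlDr lerDl.
Qed.

Lemma lc_cvg_abs k z t : root4 ((k.+1, z) :: t) -> cvgn (series (lc ((k.+1, z) :: t))).
Proof.
move=> /= /andP[hz /lc_bound[M M0 hM]].
apply: (@cplx_series_le _ (fun n => (15 * M) * bdiff n)); last first.
  have -> : (fun n => 15 * M * bdiff n) = (15 * M) *: bdiff by [].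
  by apply: is_cvg_seriesZ; exact: cvg_series_bdiff.
move=> n; rewrite /= !normrM norm_root4// mul1r.
rewrite exprS invfM normrM -mulrA.
apply: (@le_trans _ _ (inC n%:R^-1 * (inC n%:R^-1 * inC (M * b_ R n)))).
  apply: ler_pM => //.
    by have := norm_natV n 0; rewrite expr1.
  by apply: ler_pM => //; [exact: norm_natV|exact: Lt_lc_bound].
rewrite -!inC_M inC_le /bdiff; case: n => [|n].
  by rewrite invr0 mul0r !mulr_ge0// ?(ltW (i1_gt0 _ _)) ?(ltW (b_gt0 _ _))// invr_ge0 mulr0 add0r.
have h1 := natV_le_i1 n.+1.
have h2 : n.+1%:R^-1 <= 5 / (2 * n.+1%:R + 3) :> R.
  rewrite ler_pdivlMr; last by rewrite ltr_wpDl// mulr_ge0.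
  rewrite mulrC ler_pdivrMr// -natr1; have : 0 <= n%:R :> R by []; lra.
have B0 := b_gt0 R n.+1; have I0 := i1_gt0 R n.+1.
have N0 : 0 <= n.+1%:R^-1 :> R by rewrite invr_ge0.
move: h1 h2 B0 I0 N0; set N := n.+1%:R^-1; set D := (_ + 3)^-1; set B := b_ R _; set I := i1 R _ => h1 h2 B0 I0 N0.
have -> : 15 * M * (B * I * D) = (5 * D) * ((3 * I) * (M * B)) by ring.
have MB : 0 <= M * B by rewrite mulr_ge0// ltW.
by apply: ler_pM; rewrite ?mulr_ge0//; apply: ler_wpM2r.
Qed.

Lemma cplx_cvg0 (u : nat -> C) (g : nat -> R) : (forall n, `|u n| <= inC (g n)) ->
  g @ \oo --> (0 : R) -> u @ \oo --> (0 : C).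
Proof.
move=> h /cvgrPdist_le g0; apply/cvgrPdist_le => e /cplx_pos[r r0 ->].
near=> n; rewrite sub0r normrN; apply: le_trans (h n) _; rewrite inC_le.
apply: le_trans (ler_norm _) _; rewrite -normrN -sub0r; near: n; exact: g0.
Unshelve. all: by end_near. Qed.

Lemma geometric_bounded z : z != 1 -> z ^+ 4 == 1 ->
  exists2 B : R, 0 <= B & forall n, `|\sum_(m < n) z ^+ m| <= inC B.
Proof.
move=> z1 hz; have : 0 < `|z - 1| by rewrite normr_gt0 subr_eq0.
move=> /cplx_pos[r r0 er]; exists (2 / r) => [|n]; first by rewrite divr_ge0// ltW.
rewrite inC_M inC_V inC_nat -er ler_pdivlMr ?er -?er ?normr_gt0 ?subr_eq0//.
rewrite -normrM mulrC -subrX1; apply: le_trans (ler_normB _ _) _.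
by rewrite norm_root4// normr1.
Qed.

Lemma sum_by_parts (z : C) (al : nat -> C) N :
  \sum_(n < N) z ^+ n * al n = (\sum_(m < N) z ^+ m) * al N +
  \sum_(n < N) (\sum_(m < n.+1) z ^+ m) * (al n - al n.+1).
Proof.
elim: N => [|N IH]; first by rewrite !big_ord0 mul0r addr0.
rewrite big_ord_recr/= IH [in RHS]big_ord_recr/= [X in _ = _ + X]big_ord_recr/= !big_ord_recr/=.
ring.
Qed.

Lemma lc_cvg_dirichlet z t : z != 1 -> root4 ((0%N, z) :: t) -> cvgn (series (lc ((0%N, z) :: t))).
Proof.
move=> z1 /= /andP[hz /lc_bound[M M0 hM]].
pose al n := Lt (lc t) n / n%:R : C.
pose Z n : C := \sum_(m < n) z ^+ m.
have [B B0 hB] := geometric_bounded z1 hz.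
have hT n := Lt_lc_bound n hM M0.
have hal n : `|al n| <= inC (3 * M * (b_ R n * i1 R n)).
  rewrite normrM; apply: (@le_trans _ _ (inC (M * b_ R n) * inC n%:R^-1)).
    by apply: ler_pM => //; have := norm_natV n 0; rewrite expr1.
  rewrite -inC_M inC_le; have := natV_le_i1 n; have := b_gt0 R n.
  set b := b_ R n; set I := i1 R n; set N := n%:R^-1 => b0 h.
  have -> : 3 * M * (b * I) = M * b * (3 * I) by ring.
  by rewrite ler_wpM2l// mulr_ge0// ltW.
have hd n : `|al n - al n.+1| <= inC (11 * M * bdiff n).
  case: n => [|n].
    rewrite /al invr0 mulr0 sub0r normrN divr1; apply: le_trans (hT 1%N) _.
    rewrite inC_le /bdiff b_S b_0 /i1 -subr_ge0.
    set d := _ - _; have -> : d = (11 / 3 - 2) * M by rewrite /d; field.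
    by rewrite mulr_ge0//; lra.
  have e : al n.+1 - al n.+2 = Lt (lc t) n.+1 * (n.+1%:R^-1 - n.+2%:R^-1) - lc t n.+1 * n.+2%:R^-1.
    rewrite /al [Lt _ n.+2]LtS; ring.
  rewrite e; apply: le_trans (ler_normB _ _) _; rewrite !normrM.
  have -> : n.+1%:R^-1 - n.+2%:R^-1 = inC (n.+1%:R^-1 * n.+2%:R^-1).
    have p1 : n.+1%:R != 0 :> C by rewrite pnatr_eq0.
    have p2 : n.+1%:R + 1 != 0 :> C by rewrite natr1 pnatr_eq0.
    rewrite inC_M !inC_V !inC_nat -[n.+2%:R]natr1; move: p1 p2; set N := n.+1%:R => p1 p2.
    by clearbody N; field; rewrite p1 p2.
  have -> : n.+2%:R^-1 = inC n.+2%:R^-1 by rewrite inC_V inC_nat.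
  have q1 : 0 <= n.+1%:R^-1 * n.+2%:R^-1 :> R by rewrite mulr_ge0 ?invr_ge0.
  have q2 : 0 <= n.+2%:R^-1 :> R by rewrite invr_ge0.
  rewrite !norm_inC (ger0_norm q1) (ger0_norm q2).
  apply: (@le_trans _ _ (inC (M * b_ R n.+1) * inC (n.+1%:R^-1 * n.+2%:R^-1) +
    inC (M * (b_ R n.+1 * i1 R n.+1)) * inC n.+2%:R^-1)).
    apply: lerD; apply: ler_wpM2r; [by rewrite -inC_0 inC_le|exact: hT|by rewrite -inC_0 inC_le|exact: hM].
  rewrite -!inC_M -inC_D inC_le /bdiff.
  set b := b_ R _; have b0 : 0 < b by exact: b_gt0.
  have -> : M * b * (n.+1%:R^-1 / n.+2%:R) + M * (b * i1 R n.+1) / n.+2%:R =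
    M * b * (n.+1%:R^-1 / n.+2%:R + i1 R n.+1 / n.+2%:R) by ring.
  have -> : 11 * M * (b * i1 R n.+1 / (2 * n.+1%:R + 3)) = M * b * (11 * (i1 R n.+1 / (2 * n.+1%:R + 3))) by ring.
  rewrite ler_wpM2l ?mulr_ge0 ?(ltW b0)//.
  rewrite /i1 -[n.+2%:R]natr1 -[n.+1%:R]natr1; have : 0 <= n%:R :> R by [].
  set N := n%:R => N0.
  have d1 : 0 < N + 1 by lra.
  have d2 : 0 < N + 1 + 1 by lra.
  have d3 : 0 < 2 * (N + 1) + 1 by lra.
  have d4 : 0 < 2 * (N + 1) + 3 by lra.
  rewrite -subr_ge0.
  have -> : 11 * ((2 * (N + 1) + 1)^-1 / (2 * (N + 1) + 3)) -
     ((N + 1)^-1 / (N + 1 + 1) + (2 * (N + 1) + 1)^-1 / (N + 1 + 1)) =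
     (11 * (N + 1) * (N + 1 + 1) - (2 * (N + 1) + 1) * (2 * (N + 1) + 3) - (N + 1) * (2 * (N + 1) + 3)) /
     ((N + 1) * (N + 1 + 1) * (2 * (N + 1) + 1) * (2 * (N + 1) + 3)).
    by field; rewrite !gt_eqF.
  apply: divr_ge0; last by rewrite !mulr_ge0// ltW.
  nra.
have cw : cvgn (series (fun n => Z n.+1 * (al n - al n.+1))).
  apply: (@cplx_series_le _ (fun n => (B * (11 * M)) * bdiff n)); last first.
    have -> : (fun n => B * (11 * M) * bdiff n) = (B * (11 * M)) *: bdiff by [].
    by apply: is_cvg_seriesZ; exact: cvg_series_bdiff.
  by move=> n; rewrite normrM -mulrA inC_M; apply: ler_pM => //; exact: hB.
have c0 : (fun n => Z n * al n) @ \oo --> (0 : C).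
  apply: (@cplx_cvg0 _ (fun n => (B * (3 * M)) * (b_ R n * i1 R n))).
    by move=> n; rewrite normrM -mulrA inC_M; apply: ler_pM => //; exact: hB.
  by rewrite -(mulr0 (B * (3 * M))); apply: cvgM; [exact: cvg_cst|exact: b_i1_cvg0].
have := cvgD c0 cw; rewrite add0r => c.
have -> : series (lc ((0%N, z) :: t)) = (fun n => Z n * al n) + series (fun n => Z n.+1 * (al n - al n.+1)).
  apply/funext => N; rewrite !fctE /series/= !big_mkord -sum_by_parts.
  by apply: eq_bigr => i _; rewrite /al expr1; ring.
exact: (cvgP _ (c _)).
Qed.

Definition lc_conv (t : seq (nat * C)) := if t is (0%N, z) :: _ then z != 1 else true.

Lemma lc_cvg t : root4 t -> lc_conv t -> cvgn (series (lc t)).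
Proof.
case: t => [_ _|[[|k] z] t ht hz]; [|exact: lc_cvg_dirichlet|exact: lc_cvg_abs].
have e : (fun n => series (lc [::]) n.+1) = cst (1 : C).
  by apply/funext => n; rewrite /series/= big_nat_recl//= big1 ?addr0.
by apply: (cvgP (1 : C)); rewrite -cvg_shiftS e; exact: cvg_cst.
Qed.

End ComplexLimits.
Section WordsToCMZV.
Variable R : realType.
Local Notation C := (Cplx R).
Implicit Types (t : seq (nat * C)).

Definition QC : set C := @rationals R.
Definition QI : set C := @gaussian_rationals R.

Definition gen (w : nat) : set C := [set x | exists (r : nat) (k : 'I_r -> nat) (z : 'I_r -> C),
  [/\ admissible4 k z, (\sum_(j < r) k j)%N = w & x = Li k z]].

Definition lwt t : nat := (\sum_(p <- t) p.1.+1)%N.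

Lemma lc_nested t : nested_seq (fun=> true)
   (fun (j : 'I_(size t)) m => (nth (0%N, 1) t j).2 ^+ m / m%:R ^+ (nth (0%N, 1) t j).1.+1) = lc t.
Proof.
elim: t => [|[k z] t IH]; first by apply/funext => n.
by apply/funext => n; rewrite [LHS]/= [RHS]/= -IH.
Qed.

Lemma series_lc t n : series (lc t) n = Lt (lc t) n.
Proof. by rewrite /series/= big_mkord. Qed.

Lemma lc_Li t : root4 t -> lc_conv t -> gen (lwt t) (limn (series (lc t))).
Proof.
move=> rt ct; exists (size t), (fun j => (nth (0%N, 1) t j).1.+1), (fun j => (nth (0%N, 1) t j).2).
split.
- split=> //.
  + by move=> j; apply/eqP; move/allP: rt => /(_ (nth (0%N, 1) t j)); apply; apply: mem_nth.
  + move=> j j0; rewrite j0; case: t rt ct j j0 => [|[k z] t] _ /= ct; first by case.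
    by move=> _ _ [[k0] z1]; move: ct; rewrite k0 z1 eqxx.
- by rewrite /lwt (big_nth (0%N, 1)) big_mkord.
- rewrite /Li; case: t rt ct => [_ _|p t rt ct].
    transitivity (1 : C).
      apply/cvg_lim => //; rewrite -cvg_shiftS.
      have -> : (fun n => series (lc [::]) n.+1) = cst (1 : C).
        by apply/funext => n; rewrite /series/= big_nat_recl//= big1 ?addr0.
      exact: cvg_cst.
    apply/esym/cvg_lim => //.
    rewrite (_ : nested_sum _ _ = cst (1 : C)); first exact: cvg_cst.
    by apply/funext => N; apply: nested_sum0 => n; rewrite big_ord0.
  congr (limn _); apply/funext => N; rewrite series_lc -(lc_nested (p :: t)).
  by rewrite -(nested_sumE (fun=> true)).
Qed.

Definition LW (cv : bool) (w : nat) : set (nat -> C) :=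
  [set lc t | t in [set t | [/\ root4 t, lwt t = w & cv ==> lc_conv t]]].

Lemma QC_1 : QC 1. Proof. by exists 1 => //; rewrite rmorph1. Qed.
Lemma QC_N x : QC x -> QC (- x).
Proof. by move=> [p _ <-]; exists (- p) => //; rewrite rmorphN. Qed.
Lemma QC_M x y : QC x -> QC y -> QC (x * y).
Proof. by move=> [p _ <-] [q _ <-]; exists (p * q) => //; rewrite rmorphM. Qed.
Lemma QC_V x : QC x -> QC x^-1.
Proof. by move=> [p _ <-]; exists p^-1 => //; rewrite fmorphV. Qed.
Lemma QC_nat n : QC n%:R.
Proof. by exists n%:R => //; rewrite rmorph_nat. Qed.

Lemma QC_QI x : QC x -> QI x.
Proof. by move=> [p _ <-]; exists p => //; exists 0 => //; rewrite rmorph0 mul0r addr0. Qed.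
Lemma QI_M x y : QI x -> QI y -> QI (x * y).
Proof.
move=> [a _ [b _ <-]] [c _ [d _ <-]]; exists (a * c - b * d) => //; exists (a * d + b * c) => //.
rewrite !rmorphB !rmorphD !rmorphM/=; have := sqrCi C; set i := 'i => i2.
set A := ratr a; set B := ratr b; set A' := ratr c; set B' := ratr d.
by transitivity (A * A' + B * B' * i ^+ 2 + (A * B' + B * A') * i); [rewrite i2; ring|ring].
Qed.
Lemma QI_1 : QI 1. Proof. exact/QC_QI/QC_1. Qed.
Lemma QI_i : QI 'i.
Proof. by exists 0 => //; exists 1 => //; rewrite rmorph0 rmorph1 add0r mul1r. Qed.

Definition cz (l : letter) : seq (C * C) :=
  match l with
  | LU => [::]
  | LTh => [:: (- 'i, 'i); ('i, - 'i)]
  | LCot => [:: (1, 'i); (1, - 'i)]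
  | LTan => [:: (1, 1); (1, -1); (-1, 'i); (-1, - 'i)]
  | LRho => [:: (-2, -1); (1, 'i); (1, - 'i)]
  end.

Lemma i4 : ('i : C) ^+ 4 = 1.
Proof. by rewrite (exprM _ 2 2) sqrCi sqrrN expr1n. Qed.

Lemma cz_root l p : p \in cz l -> p.2 ^+ 4 == 1.
Proof.
have iN : (- 'i : C) ^+ 4 = 1 by rewrite -i4; ring.
have N4 : (-1 : C) ^+ 4 = 1 by ring.
by case: l; rewrite /= ?inE => //; do ?[case/orP]; do ?[move=> /eqP -> /=]; rewrite ?i4 ?iN ?N4 ?expr1n.
Qed.

Lemma cz_ne1 l p : ~~ isTan l -> p \in cz l -> p.2 != 1.
Proof.
have h (z : C) : z ^+ 2 = -1 -> z != 1.
  move=> e; apply/eqP => z1; move: e; rewrite z1 expr1n => /eqP.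
  by rewrite -subr_eq0 opprK (pnatr_eq0 C 2).
have h1 : (-1 : C) != 1 by rewrite -subr_eq0 -opprD oppr_eq0 (pnatr_eq0 C 2).
by case: l; rewrite /= ?inE => //= _; do ?[case/orP]; move=> /eqP -> //=; apply: h; rewrite ?sqrrN ?sqrCi.
Qed.

Lemma cz_rat l p : p \in cz l -> QC ('i ^+ isTh l * p.1).
Proof.
have ii : ('i * 'i : C) = -1 by rewrite -expr2 sqrCi.
by case: l; rewrite /= ?inE => //; do ?[case/orP]; move=> /eqP -> /=;
  rewrite ?expr1 ?expr0 ?mul1r ?mulrN ?ii ?opprK; do ?[apply: QC_N]; do ?[exact: QC_1|exact: (QC_nat 2)].
Qed.

Lemma eps_cz l k : (eps l k)%:~R = \sum_(p <- cz l) p.1 * p.2 ^+ k.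
Proof.
have red : \sum_(p <- cz l) p.1 * p.2 ^+ k = \sum_(p <- cz l) p.1 * p.2 ^+ (k %% 4).
  apply: eq_big_seq => p /cz_root/eqP h; rewrite {1}(divn_eq k 4) exprD mulnC exprM h expr1n mul1r//.
rewrite red (_ : eps l k = eps l (k %% 4)); last by case: l {red} => //=; rewrite modn_mod.
have : (k %% 4 < 4)%N by rewrite ltn_mod.
have := sqrCi C; rewrite expr2.
by case: l {red}; case: (k %% 4)%N => [|[|[|[|]]]]//=; rewrite ?big_cons ?big_nil/= => i2 _;
  rewrite ?(exprS, expr0, mulr1, mulrN, mulNr, i2, opprK); ring.
Qed.


Definition lopC l (s : nat -> C) : nat -> C := fun n =>
  n%:R^-1 * ((kap l)%:R * s n + \sum_(m < n) (eps l (n - m))%:~R * s m).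

Lemma lopC_linear l k a b : lopC l (k *: a + b) = k *: lopC l a + lopC l b.
Proof.
apply/funext => n; rewrite !fctE /lopC /GRing.scale/=.
rewrite (eq_bigr (fun m : 'I_n => k * ((eps l (n - m))%:~R * a m) + (eps l (n - m))%:~R * b m)).
  by rewrite big_split/= -mulr_sumr; ring.
by move=> m _; ring.
Qed.

Lemma lopC_inC l (a : nat -> R) : (fun n => inC (lop l a n)) = lopC l (fun n => inC (a n)).
Proof.
apply/funext => n; rewrite /lop /lopC inC_M inC_V inC_nat inC_D inC_M inC_nat inC_sum.
by congr (_ * (_ + _)); apply: eq_bigr => m _; rewrite inC_M inC_int.
Qed.

Definition twist (z : C) t : seq (nat * C) := if t is (k, w) :: t' then (k, w / z) :: t' else [::].
Definition incr t : seq (nat * C) := if t is (k, w) :: t' then (k.+1, w) :: t' else [::].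

Lemma lc_twist z t m : z != 0 -> lc (twist z t) m = z ^- m * lc t m.
Proof.
move=> z0; case: t => [|[k w] t] /=; last by rewrite expr_div_n; ring.
by case: m => [|m]; rewrite /= ?expr0 ?invr1 ?mulr1 ?mulr0.
Qed.

Lemma lopC_lc l t : lopC l (lc t) =
  ((t != [::]) && kap l)%:R *: lc (incr t) + \sum_(p <- cz l) p.1 *: lc ((0%N, p.2) :: twist p.2 t).
Proof.
apply/funext => n; rewrite !fctE /lopC mulrDr /GRing.scale/= fct_sumE; congr (_ + _).
  case: t => [|[k w] t] /=; last by rewrite [n%:R ^+ k.+2]exprS invfM; ring.
  by case: n => [|n]; rewrite ?invr0 ?mul0r ?mulr0.
rewrite mulr_sumr.
rewrite (eq_bigr (fun m : 'I_n => \sum_(p <- cz l) p.1 * (p.2 ^+ n / n%:R ^+ 1 * lc (twist p.2 t) m))).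
  rewrite exchange_big/=; apply: eq_bigr => p _; rewrite /GRing.scale/= -mulr_sumr; congr (_ * _).
  by rewrite -mulr_sumr.
move=> m _; rewrite eps_cz mulr_suml mulr_sumr; apply: eq_big_seq => p hp.
have p0 : p.2 != 0.
  by apply/eqP => p0; have := cz_root hp; rewrite p0 expr0n/= eq_sym oner_eq0.
have -> : p.2 ^+ (n - m) = p.2 ^+ n * p.2 ^- m.
  have e : p.2 ^+ n = p.2 ^+ (n - m) * p.2 ^+ m by rewrite -exprD subnK// ltnW.
  by rewrite e mulfK ?expf_neq0.
by rewrite lc_twist// expr1; ring.
Qed.

Lemma root4_twist z t : z ^+ 4 == 1 -> root4 t -> root4 (twist z t).
Proof.
move=> /eqP hz; case: t => [|[k w] t] //= /andP[/eqP hw ->].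
by rewrite expr_div_n hz hw divr1 eqxx.
Qed.

(* The odd letter [LTh] is the only one whose coefficients in [cz] are multiples of i. *)
Lemma word_span (t : seq letter) : wok t -> kspan QC (LW (conv_word t) (size t))
  ('i ^+ count isTh t *: (fun n => inC (wseq R t n))).
Proof.
elim: t => [_|l t IH wt].
  rewrite expr0 scale1r; apply: kspan_in; first exact: QC_1.
  exists [::]; first by split => //; rewrite /lwt big_nil.
  by apply/funext => n; rewrite /= /delta0 inC_nat.
have {IH} IH : kspan QC (LW false (size t)) ('i ^+ count isTh t *: (fun n => inC (wseq R t n))).
  case: t IH wt => [|y t] IH wt; last first.
    by apply: kspan_sub (IH wt) => _ [x [h1 h2 _] <-]; exists x.
  rewrite expr0 scale1r; apply: kspan_in; first exact: QC_1.
  exists [::]; first by split => //; rewrite /lwt big_nil.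
  by apply/funext => n; rewrite /= /delta0 inC_nat.
have -> : 'i ^+ count isTh (l :: t) *: (fun n => inC (wseq R (l :: t) n)) =
   'i ^+ isTh l *: lopC l ('i ^+ count isTh t *: (fun n => inC (wseq R t n))).
  rewrite -[X in lopC l X]addr0 lopC_linear -lopC_inC scalerDr scalerA -exprD.
  have -> : lopC l 0 = 0.
    apply/funext => n; rewrite /lopC mulr0 add0r big1 ?mulr0// => m _; by rewrite mulr0.
  by rewrite scaler0 addr0.
move: IH; apply: (kspan_bind (f := fun s => 'i ^+ isTh l *: lopC l s)).
- exact: QC_M.
- by move=> k x y; rewrite lopC_linear scalerDr !scalerA mulrC.
move=> _ [x [h1 h2 _] <-]; rewrite lopC_lc scalerDr; apply: kspanD.
  case: x h1 h2 => [|[k w] x] h1 h2 /=; first by rewrite scale0r scaler0; constructor.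
  case kl : (kap l); last by rewrite scale0r scaler0; constructor.
  rewrite scale1r; have -> : isTh l = false by case: (l) kl.
  rewrite scale1r; apply: kspan_in; first exact: QC_1.
  exists ((k.+1, w) :: x) => //; split => //; last by rewrite implybT.
  by rewrite -h2 /lwt !big_cons/= addSn.
rewrite scaler_sumr big_seq.
apply: (big_ind (kspan _ _)); [constructor|move=> *; exact: kspanD|].
move=> p pl; rewrite scalerA; apply: kspanZ; [exact: QC_M|exact: cz_rat|].
apply: kspan_in; first exact: QC_1.
exists ((0%N, p.2) :: twist p.2 x) => //; split.
- by rewrite /= (cz_root pl) root4_twist// (cz_root pl).
- by rewrite /= -h2 /lwt big_cons/=; case: (x) => [|[k w] x'] /=; rewrite ?big_nil ?big_cons.
- by apply/implyP => /cz_ne1/(_ pl).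
Qed.


Lemma span_over_kspan (K S : set C) y : kspan (V := C^o) K S y -> span_over K S y.
Proof.
elim=> [|k s v Kk Ss _ [n [c [w [hc hw ->]]]]].
  by exists 0%N, (fun=> 0), (fun=> 0); split; [case|case|rewrite big_ord0].
exists n.+1, (fun i => if unlift ord0 i is Some j then c j else k),
  (fun i => if unlift ord0 i is Some j then w j else s); split.
- by move=> i; case: (unlift _ _).
- by move=> i; case: (unlift _ _).
- rewrite big_ord_recl unlift_none; congr (_ + _); apply: eq_bigr => i _; by rewrite liftK.
Qed.

Lemma kspan_span_over (K S : set C) y : K 1 -> (forall x z, K x -> K z -> K (x * z)) ->
  span_over K S y -> kspan (V := C^o) K S y.
Proof.
move=> K1 KM [n [c [w [hc hw ->]]]]; apply: kspan_sum => i.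
by apply: (kspanZ (v := w i : C^o)) => //; apply: kspan_in.
Qed.

Lemma kspanM (K S : set C) c y : (forall x z, K x -> K z -> K (x * z)) -> K c ->
  kspan (V := C^o) K S y -> kspan (V := C^o) K S (c * y).
Proof. by move=> KM Kc hy; exact: kspanZ. Qed.

Lemma CMZV4P w y : CMZV4 w y <-> kspan (V := C^o) QC (gen w) y.
Proof. by split; [apply: kspan_span_over; [exact: QC_1|exact: QC_M]|exact: span_over_kspan]. Qed.

Lemma tensorP (V : set C) y : tensor_Qi V y <-> kspan (V := C^o) QI V y.
Proof. by split; [apply: kspan_span_over; [exact: QI_1|exact: QI_M]|exact: span_over_kspan]. Qed.

Lemma CMZV4_0 w : CMZV4 w (0 : C).
Proof. by apply/CMZV4P; constructor. Qed.

Lemma add_spaces_sub n (F : 'I_n -> set C) : (forall i, F i 0) ->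
  (\big[@add_spaces R/[set 0]]_(i < n) F i) 0 /\
  forall i y, F i y -> (\big[@add_spaces R/[set 0]]_(i < n) F i) y.
Proof.
elim: n F => [|n IH] F F0; first by rewrite big_ord0; split => // -[].
rewrite big_ord_recl; have [h0 h1] := IH (fun i => F (lift ord0 i)) (fun i => F0 _).
split; first by exists 0 => //; exists 0 => //; rewrite addr0.
move=> i y; case: (unliftP ord0 i) => [j ->|->] Fy.
  by exists 0 => //; exists y; [exact: (h1 j)|rewrite add0r].
by exists y => //; exists 0 => //; rewrite addr0.
Qed.

Lemma CMZV4_le_in w k y : (k <= w)%N -> CMZV4 k y -> @CMZV4_le R w y.
Proof.
move=> kw hy; have [_ h] := @add_spaces_sub w.+1 (fun k => CMZV4 k) (fun=> CMZV4_0 _).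
exact: (h (Ordinal (kw : k < w.+1)%N)).
Qed.

Lemma add_spaces_kspan n (F : 'I_n -> set C) y : (\big[@add_spaces R/[set 0]]_(i < n) F i) y ->
  kspan (V := C^o) QI (fun z => exists i, F i z) y.
Proof.
elim: n F y => [|n IH] F y; first by rewrite big_ord0 => ->; constructor.
rewrite big_ord_recl => -[a Fa [b hb <-]]; apply: kspanD.
  by apply: kspan_in; [exact: QI_1|exists ord0].
by apply: kspan_sub (IH _ _ hb) => z [i Fz]; exists (lift ord0 i).
Qed.

Definition Va w : set R := [set x | CMZV4 w (inC x)].
Definition Vb w : set R := [set x | tensor_Qi (CMZV4_le w) (inC x)].

Lemma inC_qr c : QR c -> QC (inC c).
Proof. by move=> [q _ <-]; exists q => //; rewrite inC_ratr. Qed.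

Lemma Va_comb w c x y : QR c -> Va w x -> Va w y -> Va w (c * x + y).
Proof.
move=> /inC_qr hc /CMZV4P hx /CMZV4P hy; apply/CMZV4P; rewrite inC_D inC_M.
by apply: kspanD => //; apply: kspanM => //; exact: QC_M.
Qed.

Lemma Vb_comb w c x y : QR c -> Vb w x -> Vb w y -> Vb w (c * x + y).
Proof.
move=> /inC_qr hc /tensorP hx /tensorP hy; apply/tensorP; rewrite inC_D inC_M.
by apply: kspanD => //; apply: kspanM => //; [exact: QI_M|exact: QC_QI].
Qed.

Lemma Vb_mono w w' x : (w <= w')%N -> Vb w x -> Vb w' x.
Proof.
move=> ww /tensorP hx; apply/tensorP; move: hx.
apply: (kspan_bind (f := fun z : C^o => z)) => //; first exact: QI_M.
move=> z /add_spaces_kspan; apply: kspan_sub => y [i hy].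
by apply: CMZV4_le_in hy; apply: leq_trans ww; rewrite -ltnS.
Qed.

Lemma Va_Vb w w' x : (w <= w')%N -> Va w x -> Vb w' x.
Proof.
move=> ww hx; apply/tensorP; apply: (kspan_in (v := inC x : C^o)); first exact: QI_1.
exact: CMZV4_le_in hx.
Qed.

Lemma Va_rat c : QR c -> Va 0 c.
Proof.
move=> /inC_qr hc; apply/CMZV4P; rewrite -[inC c]mulr1.
apply: kspanM => //; first exact: QC_M.
apply: kspan_in; first exact: QC_1.
have := @lc_Li [::] isT isT; rewrite /lwt big_nil.
have -> : limn (series (lc [::])) = (1 : C); last by [].
apply/cvg_lim => //; rewrite -cvg_shiftS.
have -> : (fun n => series (lc [::]) n.+1) = cst (1 : C).
  by apply/funext => n; rewrite /series/= big_nat_recl//= big1 ?addr0.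
exact: cvg_cst.
Qed.

Lemma kspan_LW_lim (K : set C) w v : kspan K (LW true w) v ->
  exists2 y : C, kspan (V := C^o) K (gen w) y & series v @ \oo --> y.
Proof.
elim=> [|k s x Kk [t [ht hw ct] <-] _ [y hy cy]].
  exists 0; first by constructor.
  have -> : series (0 : nat -> C) = cst 0 by apply/funext => n; rewrite /series/= big1.
  exact: cvg_cst.
have ct' : lc_conv t by exact: ct.
exists (k * limn (series (lc t)) + y).
  by apply: (kspan_cons (V := C^o)) => //; rewrite -hw; exact: lc_Li.
rewrite seriesD seriesZ.
have c1 : k *: series (lc t) @ \oo --> k * limn (series (lc t)).
  by apply: (@cvgZr C C^o); exact: lc_cvg.
exact: (cvgD c1 cy).
Qed.

Lemma i_pow_unit n : ('i ^+ n : C) != 0.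
Proof. by rewrite expf_neq0// neq0Ci. Qed.

Lemma inC_comb k (s v : nat -> R) : (fun n => inC ((k *: s + v) n)) =
  inC k *: (fun n => inC (s n)) + (fun n => inC (v n)).
Proof. by apply/funext => n; rewrite !fctE inC_D inC_M. Qed.

Lemma series_inC (a : nat -> R) : series (fun n => inC (a n)) = (fun n => inC (series a n)).
Proof. by apply/funext => n; rewrite /series/= inC_sum. Qed.

Lemma cmzv_pure w a : kspan (@QR R) (@pureW R true false w) a ->
  exists2 y : R, Va w y & series a @ \oo --> y.
Proof.
move=> ha; have : kspan QC (LW true w) (fun n => inC (a n)).
  elim: ha => [|k s v Kk [t [h1 h2 h3 h4 h5] <-] _ IH].
    have -> : (fun n => inC ((0 : nat -> R) n)) = 0 by apply/funext => n; rewrite inC_0.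
    by constructor.
  rewrite inC_comb; apply: kspanD => //; apply: kspanZ; [exact: QC_M|exact: inC_qr|].
  have e2 : QC ('i ^+ count isTh t).
    rewrite -(odd_double_half (count _ _)) h3 add0n -mul2n exprM sqrCi.
    by elim: (_./2) => [|m IHm]; rewrite ?exprS; [exact: QC_1|apply: QC_M => //; apply: QC_N; exact: QC_1].
  rewrite -[X in kspan _ _ X](scalerK (i_pow_unit (count isTh t))).
  apply: kspanZ; [exact: QC_M|exact: QC_V|].
  by have := word_span h1; have -> : conv_word t = true by []; rewrite h4.
move=> /kspan_LW_lim[z /CMZV4P hz]; rewrite series_inC => /cvg_inC_real[c e].
by exists (re z); rewrite /Va/= -?e.
Qed.

Lemma cmzv_mix w a : kspan (@QR R) (@mixW R true w) a ->
  exists2 y : R, Vb w y & series a @ \oo --> y.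
Proof.
move=> ha; have [z hz] : exists2 z : C, kspan (V := C^o) QI (CMZV4_le w) z & series (fun n => inC (a n)) @ \oo --> z.
  elim: ha => [|k s v Kk [t [h1 h2 h3] <-] _ [y hy cy]].
    exists 0; first by constructor.
    have -> : series (fun n => inC ((0 : nat -> R) n)) = cst (0 : C).
      by apply/funext => n; rewrite /series/= big1// => i _; exact: inC_0.
    exact: cvg_cst.
  have : kspan QI (LW true (size t)) (fun n => inC (wseq R t n)).
    rewrite -[X in kspan _ _ X](scalerK (i_pow_unit (count isTh t))).
    apply: kspanZ; [exact: QI_M| |].
      rewrite -exprVn invCi; elim: (count _ _) => [|m IHm]; first exact: QI_1.
      rewrite exprS; apply: QI_M => //; rewrite -mulN1r; apply: QI_M; last exact: QI_i.
      by apply/QC_QI/QC_N/QC_1.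
    have := word_span h1; have -> : conv_word t = true by exact: h3.
    move=> hs; elim: hs => [|k' s' v' Kk' Ss' _ IH]; constructor => //.
    exact: QC_QI.
  move=> /kspan_LW_lim[x hx cx]; exists (inC k * x + y).
    apply: kspanD => //; apply: kspanM; [exact: QI_M|exact/QC_QI/inC_qr|].
    apply: kspan_sub hx => g hg; apply: (CMZV4_le_in h2); apply/CMZV4P.
    by apply: (kspan_in (v := g : C^o)) => //; exact: QC_1.
  rewrite inC_comb seriesD seriesZ.
  have c1 : inC k *: series (fun n => inC (wseq R t n)) @ \oo --> inC k * x by exact: (@cvgZr C C^o).
  exact: (cvgD c1 cy).
rewrite series_inC => /cvg_inC_real[c e].
by exists (re z) => //; apply/tensorP; rewrite -e.
Qed.

End WordsToCMZV.
Section SumIn.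
Variable R : realType.
Implicit Types (V : set R) (f g : nat -> R).

Definition SumIn V f := exists2 y : R, V y & series f @ \oo --> y.

Definition Qmod V := V 0 /\ forall c x y, QR c -> V x -> V y -> V (c * x + y).

Lemma Va_Qmod w : Qmod (@Va R w).
Proof.
split; last by move=> c x y; exact: Va_comb.
by rewrite /Va/= inC_0; exact: CMZV4_0.
Qed.

Lemma Vb_Qmod w : Qmod (@Vb R w).
Proof.
split; last by move=> c x y; exact: Vb_comb.
by apply: (@Va_Vb _ 0) => //; case: (Va_Qmod 0).
Qed.

Lemma SumIn_sub V V' f : (forall x, V x -> V' x) -> SumIn V f -> SumIn V' f.
Proof. by move=> h [y Vy c]; exists y => //; exact: h. Qed.

Lemma SumIn_comb V c f g : Qmod V -> QR c -> SumIn V f -> SumIn V g -> SumIn V (c *: f + g).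
Proof.
move=> [_ hV] hc [x Vx cx] [y Vy cy]; exists (c * x + y); first exact: hV.
by rewrite seriesD seriesZ; apply: cvgD => //; exact: cvgZr.
Qed.

Lemma SumIn0 V : Qmod V -> SumIn V (0 : nat -> R).
Proof.
move=> [V0 _]; exists 0 => //.
have -> : series (0 : nat -> R) = cst 0 by apply/funext => n; rewrite /series/= big1.
exact: cvg_cst.
Qed.

Lemma SumInZ V c f : Qmod V -> QR c -> SumIn V f -> SumIn V (c *: f).
Proof. by move=> hV hc hf; rewrite -[_ *: _]addr0; apply: SumIn_comb => //; exact: SumIn0. Qed.

Lemma SumInD V f g : Qmod V -> SumIn V f -> SumIn V g -> SumIn V (f + g).
Proof. by move=> hV hf hg; rewrite -[f]scale1r; apply: SumIn_comb => //; exact: QR_1. Qed.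

Lemma SumIn_kspan V (S : set (nat -> R)) (T : (nat -> R) -> (nat -> R)) f : Qmod V ->
  (forall k x y, T (k *: x + y) = k *: T x + T y) ->
  (forall s, S s -> SumIn V (T s)) -> kspan (@QR R) S f -> SumIn V (T f).
Proof.
move=> hV Tl h; elim=> [|k s v Kk Ss _ IH].
  have : T 0 + T 0 = T 0 + 0 by rewrite addr0 -{3}(addr0 0) -[X in T (X + _)](scaler0 _ 1) Tl scale1r.
  by move=> /addrI ->; exact: SumIn0.
by rewrite Tl; apply: SumIn_comb => //; exact: h.
Qed.

Lemma SumIn_shiftr V f : SumIn V f -> SumIn V (shiftr f).
Proof.
move=> [y Vy c]; exists y => //; rewrite -cvg_shiftS.
by rewrite (_ : (fun n => _) = series f)//; apply/funext => n; rewrite /series/= big_nat_recl// add0r.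
Qed.

Definition bsq (f : nat -> R) : nat -> R := fun n => b_ R n ^+ 2 * f n.

Lemma bsq_linear k f g : bsq (k *: f + g) = k *: bsq f + bsq g.
Proof. by apply/funext => n; rewrite !fctE /bsq /GRing.scale/=; ring. Qed.

Lemma sum_bsq_gseq p k t : (2 <= k)%N -> SumIn (Va (gwt ((p, k) :: t))) (bsq (gseq R ((p, k) :: t))).
Proof.
case: k => [|[|k]]// _; have [a /cmzv_pure[y Vy cy] h] :
    transfer true false (gwt ((p, k.+2) :: t)) (bsq (gseq R ((p, k.+2) :: t))).
  by case: p; [exact: transfer_A|exact: transfer_B].
by exists y => //; exact: h.
Qed.

Lemma mul_Lt_linear (e : nat -> R) k f g n : e n * Lt (k *: f + g) n = k * (e n * Lt f n) + e n * Lt g n.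
Proof. by rewrite /Lt big_split/= -scaler_sumr/= /GRing.scale/=; ring. Qed.

Lemma mul_Le_linear (e : nat -> R) k f g n : e n * Le (k *: f + g) n = k * (e n * Le f n) + e n * Le g n.
Proof. by rewrite /Le big_split/= -scaler_sumr/= /GRing.scale/=; ring. Qed.

Definition iv (l : lin_fun) (n : nat) : R := ((lin_eval l n)%:~R)^-1.

Lemma iv_Two n : iv Two n = i0 R n.
Proof. by rewrite /iv /i0 /= intrM. Qed.

Lemma iv_TwoPlus1 n : iv TwoPlus1 n = i1 R n.
Proof. by rewrite /iv /i1 /= intrD intrM. Qed.

Lemma iv_TwoMinus1 n : iv TwoMinus1 n = im R n.
Proof. by rewrite /iv /im /= intrB intrM. Qed.

Definition step := (lin_fun * nat * bool)%type.

Fixpoint hseq (t : seq step) : nat -> R :=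
  if t is (l, s, st) :: t' then fun n => iv l n ^+ s * (if st then @Lt R else @Le R) (hseq t') n
  else @delta0 R.

Definition hwt (t : seq step) : nat := (\sum_(p <- t) p.1.2)%N.

Lemma hwt_cons l s st t : hwt ((l, s, st) :: t) = (s + hwt t)%N.
Proof. by rewrite /hwt big_cons. Qed.

(* Leading step p with exponent at least s, total weight w. *)
Definition GH (p : bool) (s w : nat) : set (nat -> R) :=
  [set gseq R ((p, x.1) :: x.2) | x in [set x : nat * seq (bool * nat) | (s <= x.1.+1)%N /\ gwt ((p, x.1) :: x.2) = w]].

Lemma im_S n : im R n.+1 = i1 R n.
Proof. by rewrite /im /i1 -natr1; congr (_^-1); ring. Qed.

Lemma im_Lt_shiftr s f : (fun n => im R n ^+ s.+1 * Lt f n) = shiftr (fun n => i1 R n ^+ s.+1 * Le f n).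
Proof. by apply/funext => -[|n] /=; rewrite ?Lt0 ?mulr0// im_S. Qed.

Lemma Lt_shiftr f n : Lt (shiftr f) n = Lt f n - shiftr f n.
Proof.
case: n => [|n]; first by rewrite !Lt0 subrr.
by rewrite [Lt f _]LtS addrK /Lt big_ord_recl add0r.
Qed.

Lemma Le_shiftr f n : Le (shiftr f) n = Lt f n.
Proof. by rewrite LeE Lt_shiftr subrK. Qed.

(* A sum over 2m-1 with < is the shift of the same sum over 2m+1 with <=. *)
Definition reprA (t : seq step) :=
  match t with
  | [::] => True
  | (Two, s, _) :: _ => kspan (@QR R) (GH true s (hwt t)) (hseq t)
  | (TwoPlus1, s, _) :: _ => kspan (@QR R) (GH false s (hwt t)) (hseq t)
  | (TwoMinus1, s, _) :: _ => exists2 f, hseq t = shiftr f & kspan (@QR R) (GH false s (hwt t)) f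
  end.

Lemma reprA_Le s t : reprA t -> (0 < s)%N ->
  kspan (@QR R) (GH false s (s + hwt t)) (fun n => i1 R n ^+ s * Le (hseq t) n).
Proof.
case: s => // s ht _.
pose T f : nat -> R := fun n => i1 R n ^+ s.+1 * Le f n.
have Tl k x y : T (k *: x + y) = k *: T x + T y.
  by apply/funext => n; exact: (mul_Le_linear (fun n => i1 R n ^+ s.+1)).
have gsT p r w f : kspan (@QR R) (GH p r w) f -> kspan (@QR R) (GH false s.+1 (s.+1 + w)) (T f).
  apply: kspan_bind; [exact: QR_M|exact: Tl|].
  move=> _ [[k g] [h1 h2] <-]; apply: kspan_in; first exact: QR_1.
  by exists (s, (p, k) :: g) => //; split; rewrite // gwt_cons h2.
case: t ht => [_|[[[] r] st] t] /=.
- apply: kspan_in; first exact: QR_1.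
  by exists (s, [::]) => //; split; rewrite // gwt_cons /hwt /gwt !big_nil.
- exact: gsT.
- exact: gsT.
- move=> [f -> hf]; have -> : (fun n => i1 R n ^+ s.+1 * Le (shiftr f) n) = T f + (- 1) *: (fun n => i1 R n ^+ s.+1 * f n).
    by apply/funext => n; rewrite !fctE /T Le_shiftr LeE /GRing.scale/=; ring.
  apply: kspanD; first exact: gsT hf.
  apply: kspanZ; [exact: QR_M|by exists (-1) => //; rewrite rmorphN1|].
  move: hf; apply: (kspan_bind (f := fun f n => i1 R n ^+ s.+1 * f n)); first exact: QR_M.
    by move=> k x y; apply/funext => n; rewrite !fctE /GRing.scale/=; ring.
  move=> _ [[k g] [h1 h2] <-]; apply: kspan_in; first exact: QR_1.
  exists ((s + k.+1)%N, g); first by split => /=; [rewrite ltnS leq_addr|move: h2; rewrite !gwt_cons /=; lia].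
  by apply/funext => n; rewrite /= mulrA -exprD addSn.
Qed.

Fixpoint goodA (t : seq step) : Prop :=
  if t is (l, s, st) :: t' then
    [/\ (0 < s)%N, st = default_strict l, goodA t' &
      if t' is (l', _, _) :: _ then l' = TwoMinus1 -> l <> Two else True]
  else True.

Lemma goodA_repr t : goodA t -> reprA t.
Proof.
elim: t => //= -[[l s] st] t IH [s0 -> ht hl]; have {IH} ht := IH ht.
case: l hl => /= hl.
- pose T f : nat -> R := fun n => iv Two n ^+ s * Lt f n.
  have Tl k x y : T (k *: x + y) = k *: T x + T y by apply/funext => n; exact: (mul_Lt_linear (fun n => iv Two n ^+ s)).
  case: s s0 @T Tl => // s _ T Tl; rewrite hwt_cons.
  have gsT p r w f : kspan (@QR R) (GH p r w) f -> kspan (@QR R) (GH true s.+1 (s.+1 + w)) (T f).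
    apply: kspan_bind; [exact: QR_M|exact: Tl|].
    move=> _ [[k g] [h1 h2] <-]; apply: kspan_in; first exact: QR_1.
    exists (s, (p, k) :: g); first by split; rewrite // gwt_cons h2.
    by apply/funext => n; rewrite /T iv_Two.
  case: t hl ht => [_ _|[[[] r] st'] t hl ht]; [|exact: gsT ht|exact: gsT ht|by have := hl erefl].
  apply: kspan_in; first exact: QR_1.
  exists (s, [::]); first by split; rewrite // gwt_cons /hwt /gwt !big_nil.
  by apply/funext => n; rewrite /T iv_Two.
- rewrite hwt_cons; have := reprA_Le ht s0; congr kspan; apply/funext => n; by rewrite iv_TwoPlus1.
- exists (fun n => i1 R n ^+ s * Le (hseq t) n); last by rewrite hwt_cons; exact: reprA_Le.
  case: s s0 => // s _; rewrite -im_Lt_shiftr; apply/funext => n; by rewrite iv_TwoMinus1.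
Qed.

Lemma b_S_i1 n : b_ R n.+1 = b_ R n * (1 + i1 R n).
Proof. by rewrite b_S_sub; ring. Qed.

(* b_{n+1}^2 = b_n^2 (1 + 2 i1 + i1^2) spreads the weight over three degrees. *)
Lemma bsq_shiftr f : bsq (shiftr f) = shiftr (bsq f + 2 *: bsq (fun n => i1 R n * f n) + bsq (fun n => i1 R n ^+ 2 * f n)).
Proof.
by apply/funext => -[|n]; rewrite /bsq !fctE /= ?mulr0// b_S_i1 /GRing.scale/=; ring.
Qed.

Lemma sum_GH p s w e f : (3 <= s)%N -> kspan (@QR R) (GH p s w) f -> (if p then e = 0%N else True) ->
  SumIn (Va (w + e)) (bsq (fun n => i1 R n ^+ e * f n)).
Proof.
move=> s3 hf pe; move: hf.
apply: (SumIn_kspan (T := fun f => bsq (fun n => i1 R n ^+ e * f n))); first exact: Va_Qmod.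
  by move=> k x y; apply/funext => n; rewrite !fctE /bsq /GRing.scale/=; ring.
move=> _ [[k g] [/= h1 <-] <-]; case: p pe => [->|_].
  rewrite addn0 (_ : (fun n => _) = gseq R ((true, k) :: g)).
    by apply: sum_bsq_gseq; lia.
  by apply/funext => n; rewrite expr0 mul1r.
rewrite (_ : (fun n => _) = gseq R ((false, (e + k)%N) :: g)).
  rewrite (_ : gwt _ + e = gwt ((false, (e + k)%N) :: g))%N; first by apply: sum_bsq_gseq; lia.
  rewrite !gwt_cons; lia.
by apply/funext => n; rewrite /= mulrA -exprD addnS.
Qed.

Lemma partA l s st t : (3 <= s)%N -> goodA ((l, s, st) :: t) -> l <> TwoMinus1 ->
  SumIn (Va (hwt ((l, s, st) :: t))) (bsq (hseq ((l, s, st) :: t))).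
Proof.
move=> s3 /goodA_repr h lT.
have e (f : nat -> R) : bsq f = bsq (fun n => i1 R n ^+ 0 * f n).
  by apply/funext => n; rewrite /bsq expr0 mul1r.
rewrite e -[hwt _]addn0; case: l h lT => h lT.
- exact: (sum_GH (e := 0) s3 h erefl).
- exact: (sum_GH (e := 0) s3 h I).
- by case: lT.
Qed.

Lemma partA_minus s st t : (3 <= s)%N -> goodA ((TwoMinus1, s, st) :: t) ->
  exists y0 y1 y2 : R, [/\ Va (hwt ((TwoMinus1, s, st) :: t)) y0, Va (hwt ((TwoMinus1, s, st) :: t)).+1 y1,
    Va (hwt ((TwoMinus1, s, st) :: t)).+2 y2 &
    series (bsq (hseq ((TwoMinus1, s, st) :: t))) @ \oo --> y0 + y1 + y2].
Proof.
move=> s3 /goodA_repr [f -> hf]; set w := hwt _ in hf *.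
have [y0 V0 c0] := sum_GH (e := 0) s3 hf I.
have [y1 V1 c1] := sum_GH (e := 1) s3 hf I.
have [y2 V2 c2] := sum_GH (e := 2) s3 hf I.
rewrite addn0 in V0; rewrite addn2 in V2; exists y0, (2 * y1), y2; split => //.
  rewrite -addn1 -[2 * y1]addr0; apply: Va_comb => //; last by case: (Va_Qmod (w + 1)).
  by exists 2 => //; rewrite ratr_nat.
have : SumIn [set y0 + 2 * y1 + y2] (bsq (shiftr f)).
  rewrite bsq_shiftr; apply: SumIn_shiftr; exists (y0 + 2 * y1 + y2) => //.
  rewrite !seriesD seriesZ; apply: cvgD; first apply: cvgD.
  - by rewrite (_ : (fun n => i1 R n ^+ 0 * f n) = f) in c0; [|apply/funext => n; rewrite expr0 mul1r].
  - by apply: cvgZr; exact: c1.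
  - exact: c2.
by move=> [y -> c].
Qed.

End SumIn.
Section TrigIntegral.
Variable R : realType.
Implicit Types (a L : nat -> R) (G H : R -> R).

Local Notation W cv k := (kspan (@QR R) (@mixW R cv k)).

(* The factors [sf - 1] and [cf] vanish at u = 1, so only L0 contributes to the value there. *)
Definition trig_form (L0 L1 L2 : nat -> R) (u : R) :=
  psum L0 u + (sf u - 1) * psum L1 u + cf u * psum L2 u.

Definition trig_int k G := exists L0 L1 L2, [/\ W true k L0, W false k L1, W false k L2,
  has_deriv (trig_form L0 L1 L2) G & trig_form L0 L1 L2 0 = 0].

Lemma mixW_mono cv k k' a : (k <= k')%N -> W cv k a -> W cv k' a.
Proof.
move=> kk; apply: kspan_sub => _ [t [h1 h2 h3] <-]; exists t => //; split => //.
exact: leq_trans h2 kk.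
Qed.

Lemma mixW_rad1 cv k a : W cv k a -> rad1 a.
Proof. by move=> /mixW_cvg0; exact: cvg_rad1. Qed.

Lemma trig_int_eq k G H : (forall u, 0 < u < 1 -> G u = H u) -> trig_int k G -> trig_int k H.
Proof.
move=> e [L0 [L1 [L2 [h0 h1 h2 hd z]]]]; exists L0, L1, L2; split => //.
exact: has_deriv_eq e hd.
Qed.

Lemma gt_nbhs (x a : R) : a < x -> \forall y \near x, a < y.
Proof.
move=> ax; have : - x < - a by rewrite ltrN2.
by move=> /Nlt_nbhsl; apply: filterS => y; rewrite ltrN2.
Qed.

Lemma has_deriv_ext (f g df : R -> R) : (forall u, `|u| < 1 -> f u = g u) -> has_deriv f df -> has_deriv g df.
Proof.
move=> e [h1 h2]; split.
  move=> u u01; have /andP[u0 u1] := u01.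
  apply: (near_eq_is_derive _ (h1 u u01)).
  near=> v; apply: e; rewrite ltr_norml; apply/andP; split; near: v.
    by apply: gt_nbhs; lra.
  exact: lt_nbhsl.
have e0 : f 0 = g 0 by apply: e; rewrite normr0.
rewrite /prop_for /continuous_at -e0; apply: cvg_trans h2; apply: near_eq_cvg.
near=> v; apply: e; rewrite ltr_norml; apply/andP; split; near: v.
  by apply: gt_nbhs; rewrite oppr_lt0.
exact: lt_nbhsl.
Unshelve. all: by end_near. Qed.

Lemma trig_int_comb k c G H : QR c -> trig_int k G -> trig_int k H ->
  trig_int k (fun u => c * G u + H u).
Proof.
move=> hc [L0 [L1 [L2 [h0 h1 h2 hd z]]]] [M0 [M1 [M2 [m0 m1 m2 md mz]]]].
exists (c *: L0 + M0), (c *: L1 + M1), (c *: L2 + M2).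
have W_comb cv L M : W cv k L -> W cv k M -> W cv k (c *: L + M).
  by move=> hL hM; apply: kspanD => //; apply: kspanZ => //; exact: QR_M.
have e u : `|u| < 1 -> c * trig_form L0 L1 L2 u + trig_form M0 M1 M2 u =
   trig_form (c *: L0 + M0) (c *: L1 + M1) (c *: L2 + M2) u.
  move=> u1; rewrite /trig_form.
  have r L cv : W cv k L -> rad1 L by exact: mixW_rad1.
  have rL0 := r _ _ h0; have rL1 := r _ _ h1; have rL2 := r _ _ h2.
  have rM0 := r _ _ m0; have rM1 := r _ _ m1; have rM2 := r _ _ m2.
  have z0 := rad1Z c rL0; have z1 := rad1Z c rL1; have z2 := rad1Z c rL2.
  by rewrite !psumD// !psumZ//; ring.
split; [exact: W_comb..| |].
  exact: (has_deriv_ext e (has_derivD (has_derivZ c hd) md)).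
by rewrite -e ?normr0// z mz mulr0 addr0.
Qed.

Lemma trig_int_lop k l a : ~~ isTan l -> (kap l -> a 0%N = 0) -> W true k.+1 (lop l a) ->
  W false k a -> trig_int k.+1 (fun u => lval l u * psum a u).
Proof.
move=> lT hk hl ha; exists (lop l a), 0, 0; split => //; [by constructor..| |].
  have := has_deriv_lop (l := l) (mixW_cvg0 ha) hk.
  apply: has_deriv_ext => u u1; by rewrite /trig_form !psum_zero !mulr0 !addr0.
by rewrite /trig_form !psum0 lop0 !mulr0 !addr0.
Qed.

Lemma QR_N1 : QR (-1 : R). Proof. by exists (-1) => //; rewrite rmorphN1. Qed.

Lemma wseq_mixW t : wok t -> W false (size t) (wseq R t).
Proof. by move=> h; apply: kspan_in; [exact: QR_1|exists t]. Qed.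

Lemma wseq_mixWc t : wok t -> conv_word t -> W true (size t) (wseq R t).
Proof. by move=> h c; apply: kspan_in; [exact: QR_1|exists t]. Qed.

Lemma trig_int_word t : wok t ->
  trig_int (size t).+1 (fun u => hf u * cf u * psum (wseq R t) u) /\
  trig_int (size t).+1 (fun u => hf u * sf u * psum (wseq R t) u).
Proof.
have d0 cv k : W cv k (@delta0 R).
  by apply: kspan_in; [exact: QR_1|exists [::] => //; split => //; case: cv].
have dN cv k : W cv k (- @delta0 R).
  by rewrite -scaleN1r; apply: kspanZ; [exact: QR_M|exact: QR_N1|].
elim: t => [_|l t IH wlt].
  split.
    exists (@delta0 R), (@delta0 R), 0; split => //; [by constructor| |].
      apply: (has_deriv_ext _ (has_deriv_eq _ (has_deriv_sf R))).
        move=> u u1; rewrite /trig_form !psum_delta0 (_ : (0 : nat -> R) = 0 *: @delta0 R); last by rewrite scale0r.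
        rewrite psumZ ?psum_delta0//; [ring|exact: rad1_delta0].
      by move=> u _; rewrite /= psum_delta0; ring.
    by rewrite /trig_form !psum0 sf0 /delta0/=; ring.
  exists (@delta0 R), 0, (- @delta0 R); split => //; [by constructor| |].
    apply: (has_deriv_ext _ (has_deriv_eq _ (has_derivB (has_deriv_cst 1) (has_deriv_cf R)))).
      move=> u u1; rewrite /trig_form !psum_delta0 (_ : (0 : nat -> R) = 0 *: @delta0 R); last by rewrite scale0r.
      rewrite psumZ ?psumN ?psum_delta0//; [ring|exact: rad1_delta0..].
    by move=> u _; rewrite /= psum_delta0; ring.
  by rewrite /trig_form !psum0 cf0 /delta0/= !fctE /delta0/=; ring.
have wt : wok t by case: t wlt {IH}.
have [IHc IHs] := IH wt.
have a0 : kap l -> wseq R t 0%N = 0.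
  by case: t wlt {IH wt IHc IHs} => [|y t] //=; [rewrite /wok/= => /negbTE ->|rewrite lop0].
have ha := wseq_mixW wt; have hl := wseq_mixW wlt.
have lopI l' : ~~ isTan l' -> (kap l' -> kap l) -> trig_int (size t).+1 (fun u => lval l' u * psum (wseq R t) u).
  move=> lT hk; apply: trig_int_lop => //; first by move=> /hk.
  apply: (@wseq_mixWc (l' :: t)) => //.
  by case: t wlt {IH wt IHc IHs a0 ha hl} => //= h; apply/negP => /hk; exact/negP.
have hd := has_deriv_lop (l := l) (@wseq_cvg0 R t) a0.
have z : psum (wseq R (l :: t)) 0 = 0 by rewrite psum0 /= lop0.
have comb2 c G H : QR c -> trig_int (size t).+1 G -> trig_int (size t).+1 H ->
    trig_int (size t).+1 (fun u => c * H u + G u) by move=> hc hG hH; exact: trig_int_comb.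
split.
  have h1 : trig_int (size t).+1 (fun u => (1 - sf u) * (lval l u * psum (wseq R t) u)).
    case: l wlt a0 hl lopI hd z => wlt a0 hl lopI hd z.
    - apply: trig_int_eq (comb2 _ _ _ QR_N1 (lopI LU isT id) (lopI LTh isT _)) => // u /andP[u0 u1].
      by rewrite /lval; field; rewrite gt_eqF// sf_gt0.
    - apply: trig_int_eq (comb2 _ _ _ QR_N1 (lopI LTh isT id) IHs) => u _; rewrite /lval; ring.
    - apply: trig_int_eq (comb2 _ _ _ QR_N1 (lopI LCot isT id) IHc) => u /andP[u0 u1].
      by rewrite /lval; field; rewrite gt_eqF// sf_gt0.
    - apply: trig_int_eq (comb2 _ _ _ QR_N1 IHc (lopI LRho isT _)) => // u /andP[u0 u1].
      have c0 : cf u != 0 by rewrite gt_eqF// cf_gt0// ltW.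
      have e : cf u ^+ 2 = 1 - sf u ^+ 2 by rewrite -(sf2_cf2 u); ring.
      rewrite /lval; apply: (mulfI c0).
      transitivity (hf u * psum (wseq R t) u * (cf u ^+ 2 - (1 - sf u))); first by field.
      by rewrite e; field.
    - have h0 := trig_int_comb QR_N1 IHc (lopI LRho isT (fun h => h)).
      have := trig_int_comb (QR_1 R) (lopI LRho isT (fun h => h)) h0.
      apply: trig_int_eq => u /andP[u0 u1].
      have c0 : cf u != 0 by rewrite gt_eqF// cf_gt0// ltW.
      have e : cf u ^+ 2 = 1 - sf u ^+ 2 by rewrite -(sf2_cf2 u); ring.
      rewrite /lval; apply: (mulfI c0).
      transitivity (hf u * psum (wseq R t) u * (2 * (1 - sf u) - cf u ^+ 2)); first by field.
      by rewrite e; field.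
  have [L0 [L1 [L2 [k0 k1 k2 kd kz]]]] := h1.
  exists L0, (L1 + wseq R (l :: t)), L2.
  have r1 := mixW_rad1 k1; have rl := mixW_rad1 hl.
  split; [exact: mixW_mono k0| |exact: mixW_mono k2| |].
  - by apply: kspanD; [exact: mixW_mono k1|exact: mixW_mono hl].
  - have D := has_derivD kd (has_derivM (has_derivB (has_deriv_sf R) (has_deriv_cst 1)) hd).
    apply: (has_deriv_ext _ (has_deriv_eq _ D)).
      by move=> u u1; rewrite /trig_form psumD//=; ring.
    by move=> u _ /=; ring.
  - by rewrite /trig_form psumD ?normr0// z addr0; exact: kz.
have h1 : trig_int (size t).+1 (fun u => cf u * (lval l u * psum (wseq R t) u)).
  case: l wlt a0 hl lopI hd z => wlt a0 hl lopI hd z.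
  - apply: trig_int_eq (lopI LCot isT id) => u _; rewrite /lval; ring.
  - apply: trig_int_eq IHc => u _; rewrite /lval; ring.
  - apply: trig_int_eq (comb2 _ _ _ QR_N1 (lopI LU isT id) IHs) => u /andP[u0 u1].
    have s0 : sf u != 0 by rewrite gt_eqF// sf_gt0.
    have e : cf u ^+ 2 = 1 - sf u ^+ 2 by rewrite -(sf2_cf2 u); ring.
    rewrite /lval; transitivity (hf u * psum (wseq R t) u * cf u ^+ 2 / sf u); last by field.
    by rewrite e; field.
  - apply: trig_int_eq IHs => u /andP[u0 u1]; rewrite /lval; field.
    by rewrite gt_eqF// cf_gt0// ltW.
  - apply: trig_int_eq (comb2 _ _ _ QR_N1 (lopI LTh isT _) IHs) => // u /andP[u0 u1].
    rewrite /lval; field.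
    by rewrite gt_eqF// cf_gt0// ltW.
have [L0 [L1 [L2 [k0 k1 k2 kd kz]]]] := h1.
exists L0, L1, (L2 - wseq R (l :: t)).
have r2 := mixW_rad1 k2; have rl := mixW_rad1 hl.
split; [exact: mixW_mono k0|exact: mixW_mono k1| | |].
- apply: kspanD; first exact: mixW_mono k2.
  by rewrite -scaleN1r; apply: kspanZ; [exact: QR_M|exact: QR_N1|exact: mixW_mono hl].
- have D := has_derivB kd (has_derivM (has_deriv_cf R) hd).
  apply: (has_deriv_ext _ (has_deriv_eq _ D)).
    by move=> u u1; rewrite /trig_form psumB//=; ring.
  by move=> u _ /=; ring.
- by rewrite /trig_form psumB ?normr0// z subr0; exact: kz.
Qed.

Lemma trig_int_cvg k G : trig_int k G -> exists F y, [/\ has_deriv F G, F 0 = 0, Vb k y & F u @[u --> 1^'-] --> y].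
Proof.
move=> [L0 [L1 [L2 [h0 h1 h2 hd z]]]].
have [y Vy cy] := cmzv_mix h0.
exists (trig_form L0 L1 L2), y; split => //.
have idc : (fun u : R => u) u @[u --> 1^'-] --> (1 : R) by apply: cvg_at_left_filter; exact: cvg_id.
have c1 := psum_small (mixW_cvg0 h1); have c2 := psum_small (mixW_cvg0 h2).
have -> : y = y + - ((1 - 1) * 1 / 2) * 0 + (1 + 1) * 1 / 2 * 0 by rewrite !mulr0 !addr0.
have e : trig_form L0 L1 L2 = (fun u => psum L0 u + - ((1 - u) * hf u / 2) * ((1 - u) * psum L1 u)
   + (1 + u) * hf u / 2 * ((1 - u) * psum L2 u)).
  apply/funext => u; rewrite /trig_form /sf /cf /hf; have n0 : 1 + u ^+ 2 != 0 by rewrite gt_eqF// ltr_pwDl// sqr_ge0.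
  by field.
rewrite e; apply: cvgD; [apply: cvgD; first exact: abel|].
  apply: cvgM => //; apply: cvgN; apply: cvgM; last exact: cvg_cst.
  by apply: cvgM; [apply: cvgB; [exact: cvg_cst|exact: idc]|exact: hf_cvg1].
apply: cvgM => //; apply: cvgM; last exact: cvg_cst.
by apply: cvgM; [apply: cvgD; [exact: cvg_cst|exact: idc]|exact: hf_cvg1].
Qed.

Lemma trig_int_phi g : trig_int (gwt g).+2 (fun u => hf u * cf u * phi g u).
Proof.
have [a ha ea] := pspan_phi R g.
apply: (@trig_int_eq _ (fun u => hf u * cf u * psum a u)).
  by move=> u /andP[u0 u1]; rewrite ea// ltW.
clear ea; elim: ha => [|k s v Kk [t [h1 h2 h3 h4 h5] <-] hv IH].
  exists 0, 0, 0; split; [by constructor..| |].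
    apply: (has_deriv_ext _ (has_deriv_eq _ (has_deriv_cst 0))) => u _; rewrite /trig_form !psum_zero ?mulr0 ?addr0//.
  by rewrite /trig_form !psum0 !mulr0 !addr0.
have [hc _] := trig_int_word h1; rewrite h4 in hc.
apply: trig_int_eq (trig_int_comb Kk hc IH) => u /andP[u0 u1].
have rs := cvg_rad1 (@wseq_cvg0 R t); have rv := cvg_rad1 (pureW_cvg0 hv).
have rz := rad1Z k rs.
by rewrite psumD ?psumZ// ?gtr0_norm//; ring.
Qed.

(* The integral of cos * phi; it is the only sum that mixes parities, hence the need for Q(i). *)
Lemma sum_201 g : SumIn (Vb (gwt g).+2) (bsq (fun n => i0 R n ^+ 2 * i1 R n * Lt (gseq R g) n)).
Proof.
have [F [y [hF F0 Vy cy]]] := trig_int_cvg (trig_int_phi g).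
exists y => //.
pose s n u := @sint R n u - sint n.+1 u.
pose sig n := b_ R n * i1 R n - b_ R n.+1 * i1 R n.+1.
have hs n : has_deriv (s n) (fun u => hf u * sf u * cf u ^+ 2 * (sf u ^+ 2) ^+ n).
  apply: (has_deriv_eq _ (has_derivB (has_deriv_sint R n) (has_deriv_sint R n.+1))) => u _ /=.
  have e : cf u ^+ 2 = 1 - sf u ^+ 2 by rewrite -(sf2_cf2 u); ring.
  by rewrite e [_ ^+ n.+1]exprS; ring.
have hF' : has_deriv F (fun u => hf u * sf u * cf u ^+ 2 * psum (@bphi R g) (sf u ^+ 2)).
  by apply: has_deriv_eq hF => u _; rewrite /phi /psy; ring.
have sq := @squeeze R (@bphi R g) s sig _ _ F y (@rad1_b_i1_Le R g) _ _ (@sf2_01 R) _ hs _ _ hF' F0 cy.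
rewrite -cvg_shiftS.
have -> : (fun n => series (bsq (fun n => i0 R n ^+ 2 * i1 R n * Lt (gseq R g) n)) n.+1) =
   series (fun n => @bphi R g n * sig n).
  apply/funext => n; rewrite /series/= big_nat_recl//= /bsq Lt0 !mulr0 add0r.
  apply: eq_bigr => i _; rewrite /sig bdiffE /bdiff /bphi.
  have e := b_S_i0 R i.
  have -> : i1 R i.+1 = (2 * i%:R + 3)^-1 by rewrite /i1 -natr1; congr (_^-1); ring.
  transitivity ((b_ R i.+1 * i0 R i.+1) ^+ 2 / (2 * i%:R + 3) * Lt (gseq R g) i.+1); first ring.
  by rewrite e /Le /Lt; ring.
apply: sq.
- by move=> n; rewrite /bphi !mulr_ge0 ?Le_gseq_ge0// ltW ?b_gt0 ?i1_gt0.
- by move=> u /andP[u0 u1]; rewrite mulr_ge0 ?sqr_ge0// mulr_ge0// ltW ?hf_gt0 ?sf_gt0.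
- exact: sf2_le.
- by move=> n; rewrite /s !sint0 subrr.
- by move=> n; apply: cvgB; exact: sint_cvg1.
Qed.

End TrigIntegral.
Section MonomialSums.
Variable R : realType.
Implicit Types (g : seq (bool * nat)).

Lemma i0_le_i1 n : i0 R n <= 3 * i1 R n.
Proof.
apply: le_trans (natV_le_i1 R n); case: n => [|n]; first by rewrite /i0 mulr0 invr0.
by rewrite /i0 lef_pV2 ?posrE ?mulr_gt0// ler_peMl// ler1n.
Qed.

Lemma im_norm_le_i1 n : `|im R n| <= 3 * i1 R n.
Proof.
case: n => [|n].
  by rewrite /im /i1 mulr0 sub0r add0r invrN invr1 normrN normr1; lra.
rewrite im_S ger0_norm ?(ltW (i1_gt0 R n))// /i1 ler_pdivlMr ?odd_gt0// mulrC ler_pdivrMr ?odd_gt0// -natr1.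
have : 0 <= n%:R :> R by []; lra.
Qed.

Lemma Lt_gseq_bound g (M : R) : 0 <= M -> (forall n, gseq R g n <= M * (b_ R n * i1 R n)) ->
  forall n, Lt (gseq R g) n <= M * b_ R n.
Proof.
move=> M0 hM n; apply: (@le_trans _ _ (\sum_(i < n) M * (b_ R i * i1 R i))); first by apply: ler_sum.
by rewrite -mulr_sumr sum_b_i1 ler_wpM2l// lerBlDr lerDl.
Qed.

Lemma gseq_bound g : exists2 M : R, 0 <= M & forall n, gseq R g n <= M * (b_ R n * i1 R n).
Proof.
elim: g => [|[p k] g [M M0 hM]].
  exists 1 => // -[|n] /=; rewrite /delta0/= mul1r ?(ltW (bi1_gt0 R _))//.
  by rewrite b_0 /i1 mulr0 add0r invr1 mulr1.
have hLt := Lt_gseq_bound M0 hM.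
case: p.
  exists (3 * M) => [|n]; first by rewrite mulr_ge0.
  rewrite /= exprSr -mulrA.
  apply: (@le_trans _ _ (1 * (3 * i1 R n * (M * b_ R n)))).
    apply: ler_pM; rewrite ?exprn_ge0 ?i0_ge0 ?mulr_ge0 ?i0_ge0 ?Lt_gseq_ge0//.
      by rewrite exprn_ile1 ?i0_ge0 ?i0_le1.
    by apply: ler_pM; rewrite ?i0_ge0 ?Lt_gseq_ge0 ?i0_le_i1.
  by rewrite le_eqVlt; apply/orP; left; apply/eqP; ring.
exists (2 * M) => [|n]; first by rewrite mulr_ge0.
rewrite /= exprSr -mulrA.
have I0 := i1_gt0 R n; have B0 := b_gt0 R n.
apply: (@le_trans _ _ (1 * (i1 R n * (M * (2 * b_ R n))))).
  apply: ler_pM; rewrite ?exprn_ge0 ?(ltW I0)// ?mulr_ge0 ?Le_gseq_ge0 ?(ltW I0)//.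
    by rewrite exprn_ile1 ?(ltW I0) ?i1_le1.
  rewrite ler_wpM2l ?(ltW I0)//; apply: le_trans (hLt n.+1) _; rewrite ler_wpM2l// b_S_sub.
  have := i1_le1 R n; nra.
by rewrite le_eqVlt; apply/orP; left; apply/eqP; ring.
Qed.

Lemma boundary_cvg0 (kappa : nat -> R) C g : (forall n, `|kappa n| <= C * (b_ R n * i1 R n) ^+ 2) ->
  (fun n => kappa n * Lt (gseq R g) n) @ \oo --> (0 : R).
Proof.
move=> hk; have [M M0 hM] := gseq_bound g.
have C0 : 0 <= C.
  have := le_trans (normr_ge0 _) (hk 0%N); rewrite b_0 /i1 mulr0 add0r invr1 mulr1 expr1n mulr1//.
have hLt := Lt_gseq_bound M0 hM.
apply/norm_cvg0P.
have c : (fun n => 2 * C * M * (b_ R n * i1 R n)) @ \oo --> (0 : R).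
  by rewrite -(mulr0 (2 * C * M)); apply: cvgM; [exact: cvg_cst|exact: b_i1_cvg0].
apply: (@squeeze_cvgr _ _ _ _ (cst 0) _ _ _ _ _ c); last exact: cvg_cst.
apply: nearW => n; rewrite normr_ge0/= normrM (ger0_norm (Lt_gseq_ge0 R g n)).
apply: le_trans (ler_pM _ _ (hk n) (hLt n)) _; rewrite ?Lt_gseq_ge0//.
have I0 := i1_gt0 R n; have B0 := b_gt0 R n.
have h : b_ R n ^+ 2 * i1 R n <= 2.
  rewrite /i1 ler_pdivrMr ?odd_gt0//; apply: le_trans (b_sqr_le R n) _.
  by have : 0 <= n%:R :> R by []; lra.
have -> : C * (b_ R n * i1 R n) ^+ 2 * (M * b_ R n) = C * M * (b_ R n * i1 R n) * (b_ R n ^+ 2 * i1 R n) by ring.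
have -> : 2 * C * M * (b_ R n * i1 R n) = C * M * (b_ R n * i1 R n) * 2 by ring.
by rewrite ler_wpM2l// !mulr_ge0// ltW.
Qed.

(* Summation by parts; the bound on kappa kills the boundary term although [Lt g] may grow. *)
Lemma abel_rel V (kappa : nat -> R) C g : (forall n, `|kappa n| <= C * (b_ R n * i1 R n) ^+ 2) ->
  SumIn V (fun n => kappa n.+1 * gseq R g n) ->
  SumIn V (fun n => (kappa n - kappa n.+1) * Lt (gseq R g) n).
Proof.
move=> hk [y Vy cy]; exists y => //.
have -> : series (fun n => (kappa n - kappa n.+1) * Lt (gseq R g) n) =
    series (fun n => kappa n.+1 * gseq R g n) - (fun n => kappa n * Lt (gseq R g) n).
  apply/funext => n; rewrite !fctE; elim: n => [|n IH].
    by rewrite /series/= !big_geq// Lt0 mulr0 subr0.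
  by rewrite !seriesSr IH LtS; ring.
by rewrite -[y]subr0; apply: cvgB => //; exact: boundary_cvg0 hk.
Qed.

Definition mono a c e g (n : nat) : R := i0 R n ^+ a * im R n ^+ c * i1 R n ^+ e * Lt (gseq R g) n.
Definition dmono e g (n : nat) : R := i1 R n ^+ e * gseq R g n.

Lemma i0i1 n : i0 R n.+1 * i1 R n.+1 = i0 R n.+1 - i1 R n.+1.
Proof.
rewrite /i0 /i1; have : 0 < n.+1%:R :> R by []; set N := n.+1%:R => N0.
by field; apply/andP; split; rewrite gt_eqF//; lra.
Qed.

Lemma i0im n : i0 R n.+1 * im R n.+1 = im R n.+1 - i0 R n.+1.
Proof.
have : 1 <= n.+1%:R :> R by rewrite ler1n.
rewrite /i0 /im; set N := n.+1%:R => N0.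
by field; apply/andP; split; rewrite gt_eqF//; lra.
Qed.

Lemma imi1 n : im R n.+1 * i1 R n.+1 = (im R n.+1 - i1 R n.+1) / 2.
Proof.
have : 1 <= n.+1%:R :> R by rewrite ler1n.
rewrite /i1 /im; set N := n.+1%:R => N0.
by field; apply/andP; split; rewrite gt_eqF//; lra.
Qed.

Lemma mono_i0i1 a c e g : mono a.+1 c e.+1 g = mono a.+1 c e g + -1 *: mono a c e.+1 g.
Proof.
apply/funext => -[|n]; rewrite !fctE /mono /GRing.scale/=; first by rewrite Lt0; ring.
transitivity (i0 R n.+1 ^+ a * im R n.+1 ^+ c * i1 R n.+1 ^+ e * (i0 R n.+1 * i1 R n.+1) * Lt (gseq R g) n.+1).
  by rewrite !exprS; ring.
by rewrite i0i1 !exprS; ring.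
Qed.

Lemma mono_i0im a c e g : mono a.+1 c.+1 e g = mono a c.+1 e g + -1 *: mono a.+1 c e g.
Proof.
apply/funext => -[|n]; rewrite !fctE /mono /GRing.scale/=; first by rewrite Lt0; ring.
transitivity (i0 R n.+1 ^+ a * im R n.+1 ^+ c * i1 R n.+1 ^+ e * (i0 R n.+1 * im R n.+1) * Lt (gseq R g) n.+1).
  by rewrite !exprS; ring.
by rewrite i0im !exprS; ring.
Qed.

Lemma mono_imi1 a c e g : mono a c.+1 e.+1 g = 2^-1 *: (mono a c.+1 e g + -1 *: mono a c e.+1 g).
Proof.
apply/funext => -[|n]; rewrite !fctE /mono /GRing.scale/=; first by rewrite Lt0; ring.
transitivity (i0 R n.+1 ^+ a * im R n.+1 ^+ c * i1 R n.+1 ^+ e * (im R n.+1 * i1 R n.+1) * Lt (gseq R g) n.+1).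
  by rewrite !exprS; ring.
by rewrite imi1 !exprS; ring.
Qed.

Lemma mono_a a g : mono a.+1 0 0 g = gseq R ((true, a) :: g).
Proof. by apply/funext => n; rewrite /mono !expr0 !mulr1. Qed.

Lemma mono_e e g : mono 0 0 e.+1 g = gseq R ((false, e) :: g) + -1 *: dmono e.+1 g.
Proof. by apply/funext => n; rewrite !fctE /mono /dmono /= LeE /GRing.scale/= !expr0; ring. Qed.

Lemma mono_c c g : mono 0 c.+1 0 g = shiftr (gseq R ((false, c) :: g)).
Proof.
rewrite /= -(im_Lt_shiftr c (gseq R g)); apply/funext => n; rewrite /mono !expr0; ring.
Qed.

Lemma dmono_true e k g : dmono e ((true, k) :: g) = mono k.+1 0 e g.
Proof. by apply/funext => n; rewrite /mono /dmono /= expr0; ring. Qed.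

Lemma dmono_false e k g : dmono e ((false, k) :: g) = gseq R ((false, (e + k)%N) :: g).
Proof. by apply/funext => n; rewrite /dmono /= mulrA -exprD addnS. Qed.

Lemma QR_nat n : QR (n%:R : R). Proof. by exists n%:R => //; rewrite ratr_nat. Qed.
Lemma QR_natV n : QR (n%:R^-1 : R). Proof. by exists n%:R^-1 => //; rewrite fmorphV rmorph_nat. Qed.

Definition mixed a c e := [|| (0 < a) && (0 < c), (0 < a) && (0 < e) | (0 < c) && (0 < e)]%N.

(* The weight bound W allowed for [bsq (mono a c e g)]: a pure power of 1/(2n-1) needs two more
   weights than its degree, and a mixed product needs at least 4 + |g|. *)
Definition mono_ok a c e g W := [&& (a + c + e + gwt g <= W)%N, (0 < c)%N ==> (c + 2 + gwt g <= W)%N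
  & mixed a c e ==> (4 + gwt g <= W)%N].

Definition Mp g := forall a c e W, (3 <= a + c + e)%N -> mono_ok a c e g W -> SumIn (Vb W) (bsq (mono a c e g)).
Definition Dp g := forall e W, (2 <= e)%N -> (e + gwt g <= W)%N -> (3 <= e)%N || (4 + gwt g <= W)%N ->
  SumIn (Vb W) (bsq (dmono e g)).

Lemma sum_bsq_gseq_Vb p k g W : (2 <= k)%N -> (k.+1 + gwt g <= W)%N -> SumIn (Vb W) (bsq (gseq R ((p, k) :: g))).
Proof.
move=> k2 hW; apply: (SumIn_sub _ (sum_bsq_gseq R p g k2)) => x; apply: Va_Vb.
by rewrite gwt_cons.
Qed.

Lemma Dp_nil : Dp [::].
Proof.
move=> e W e2 hW _; exists 1.
  by apply: (@Va_Vb _ 0) => //; apply: Va_rat; exact: QR_1.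
have e1 : (fun n => series (bsq (dmono e [::])) n.+1) = cst 1; last first.
  by rewrite -cvg_shiftS e1; exact: cvg_cst.
apply/funext => n; rewrite /series/= big_nat_recl//= /bsq /dmono /= /delta0 /= b_0 /i1 mulr0 add0r invr1.
by rewrite big1 ?expr1n ?mul1r ?addr0// => i _; rewrite !mulr0.
Qed.

Lemma Dp_cons p k g : Mp g -> Dp ((p, k) :: g).
Proof.
move=> hM e W e2; rewrite gwt_cons => hW he; case: p.
  rewrite dmono_true; apply: hM; first lia.
  rewrite /mono_ok /mixed; move: he; lia.
by rewrite dmono_false; apply: sum_bsq_gseq_Vb; lia.
Qed.

Section Step.
Variables (g : seq (bool * nat)) (W : nat).
Hypothesis hD : Dp g.
Let hV := Vb_Qmod R W.

Local Notation inVb f := (SumIn (Vb W) f).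

Lemma kappa_bound (x y : nat -> R) : (forall n, `|x n| <= 3 * i1 R n) -> (forall n, `|y n| <= 3 * i1 R n) ->
  forall n, `|b_ R n ^+ 2 * (x n * y n)| <= 9 * (b_ R n * i1 R n) ^+ 2.
Proof.
move=> hx hy n; rewrite normrM [`|x n * y n|]normrM [`|b_ R n ^+ 2|]ger0_norm ?sqr_ge0//.
have -> : 9 * (b_ R n * i1 R n) ^+ 2 = b_ R n ^+ 2 * ((3 * i1 R n) * (3 * i1 R n)) by ring.
by rewrite ler_wpM2l ?sqr_ge0// ler_pM.
Qed.

Lemma i0_norm n : `|i0 R n| <= 3 * i1 R n.
Proof. by rewrite ger0_norm ?i0_ge0// i0_le_i1. Qed.

Lemma sum_mono_a a : (3 <= a)%N -> (a + gwt g <= W)%N -> inVb (bsq (mono a 0 0 g)).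
Proof. by case: a => // a a3 aW; rewrite mono_a; apply: sum_bsq_gseq_Vb. Qed.

Lemma sum_mono_e e : (3 <= e)%N -> (e + gwt g <= W)%N -> inVb (bsq (mono 0 0 e g)).
Proof.
case: e => // e e3 eW; rewrite mono_e addrC bsq_linear; apply: SumIn_comb => //; first exact: QR_N1.
  by apply: hD => //; [exact: ltnW|rewrite e3].
exact: sum_bsq_gseq_Vb.
Qed.

Lemma sum_mono_c c : (3 <= c)%N -> (c + 2 + gwt g <= W)%N -> inVb (bsq (mono 0 c 0 g)).
Proof.
case: c => // c c3 cW; rewrite mono_c bsq_shiftr; apply: SumIn_shiftr.
have hs j : (j <= 2)%N -> inVb (bsq (fun n => i1 R n ^+ j * gseq R ((false, c) :: g) n)).
  move=> j2; rewrite (_ : (fun n => _) = gseq R ((false, (j + c)%N) :: g)); first by apply: sum_bsq_gseq_Vb; lia.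
  by apply/funext => n; rewrite /= mulrA -exprD addnS.
rewrite addrAC addrC; apply: SumIn_comb => //; [exact: QR_nat|exact: (hs 1%N)|].
apply: SumInD => //; last exact: hs.
by apply: sum_bsq_gseq_Vb; lia.
Qed.

Hypothesis hW : (4 + gwt g <= W)%N.

Lemma dsum e : (2 <= e <= 4)%N -> inVb (bsq (dmono e g)).
Proof. by move=> he; apply: hD; rewrite ?hW ?orbT//; lia. Qed.

Lemma sum_mono_210 : inVb (bsq (mono 2 1 0 g)).
Proof.
have -> : bsq (mono 2 1 0 g) = shiftr (bsq (gseq R ((false, 2%N) :: g))).
  apply/funext => -[|n]; rewrite /bsq /mono /=; first by rewrite Lt0; ring.
  rewrite im_S; transitivity ((b_ R n.+1 * i0 R n.+1) ^+ 2 * i1 R n * Lt (gseq R g) n.+1); first ring.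
  by rewrite b_S_i0 /Le /Lt; ring.
by apply: SumIn_shiftr; apply: sum_bsq_gseq_Vb; lia.
Qed.

Lemma sum_mono_120 : inVb (bsq (mono 1 2 0 g)).
Proof.
have -> : bsq (mono 1 2 0 g) = shiftr (bsq (gseq R ((false, 2%N) :: g)) + bsq (gseq R ((false, 3%N) :: g))).
  apply/funext => -[|n]; rewrite !fctE /bsq /mono /=; first by rewrite Lt0; ring.
  rewrite im_S; transitivity (b_ R n.+1 * (b_ R n.+1 * i0 R n.+1) * i1 R n ^+ 2 * Lt (gseq R g) n.+1); first ring.
  by rewrite b_S_i0 b_S_i1 /Le /Lt; ring.
by apply: SumIn_shiftr; apply: SumInD => //; apply: sum_bsq_gseq_Vb; lia.
Qed.

Lemma sum_mono_201 : inVb (bsq (mono 2 0 1 g)).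
Proof.
have -> : mono 2 0 1 g = (fun n => i0 R n ^+ 2 * i1 R n * Lt (gseq R g) n).
  by apply/funext => n; rewrite /mono; ring.
apply: (SumIn_sub _ (sum_201 R g)) => x.
apply: Vb_mono; apply: leq_trans hW; lia.
Qed.

Lemma sum_mono_102 : inVb (bsq (mono 1 0 2 g)).
Proof.
pose kappa n : R := b_ R n ^+ 2 * (i0 R n * i0 R n).
have hk n : kappa n.+1 * gseq R g n = bsq (dmono 2 g) n.
  transitivity ((b_ R n.+1 * i0 R n.+1) ^+ 2 * gseq R g n); first by rewrite /kappa; ring.
  by rewrite b_S_i0 /bsq /dmono; ring.
have hs : inVb (fun n => (kappa n - kappa n.+1) * Lt (gseq R g) n).
  apply: (abel_rel (kappa_bound i0_norm i0_norm)).
  by rewrite (_ : (fun n => _) = bsq (dmono 2 g)); [exact: dsum|apply/funext => n; exact: hk].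
rewrite (_ : bsq _ = -1 *: bsq (mono 2 0 1 g) + (fun n => (kappa n - kappa n.+1) * Lt (gseq R g) n)).
  by apply: SumIn_comb => //; [exact: QR_N1|exact: sum_mono_201].
apply/funext => -[|n]; rewrite !fctE /bsq /mono /GRing.scale/=; first by rewrite Lt0; ring.
have -> : kappa n.+2 = b_ R n.+1 ^+ 2 * i1 R n.+1 ^+ 2.
  by transitivity ((b_ R n.+2 * i0 R n.+2) ^+ 2); [rewrite /kappa; ring|rewrite b_S_i0; ring].
rewrite /kappa; have := i0i1 n; set x := i0 R n.+1; set y := i1 R n.+1; set b := b_ R n.+1 => e.
transitivity (b ^+ 2 * ((x * y) * y) * Lt (gseq R g) n.+1); first ring.
transitivity (b ^+ 2 * (- (x * (x * y)) + x * x - y * y) * Lt (gseq R g) n.+1); last ring.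
by congr (_ * _ * _); rewrite e mulrBr mulrBl e; ring.
Qed.

Lemma sum_mono_012 : inVb (bsq (mono 0 1 2 g)).
Proof.
pose kappa n : R := b_ R n ^+ 2 * (im R n * i0 R n).
have hk n : kappa n.+1 = b_ R n ^+ 2 * (i1 R n ^+ 2 + i1 R n ^+ 3).
  transitivity (b_ R n.+1 * (b_ R n.+1 * i0 R n.+1) * im R n.+1); first by rewrite /kappa; ring.
  by rewrite b_S_i0 b_S_i1 im_S; ring.
have hs : inVb (fun n => (kappa n - kappa n.+1) * Lt (gseq R g) n).
  apply: (abel_rel (kappa_bound im_norm_le_i1 i0_norm)).
  rewrite (_ : (fun n => kappa n.+1 * gseq R g n) = bsq (dmono 2 g) + bsq (dmono 3 g)).
    by apply: SumInD => //; apply: dsum.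
  by apply/funext => n; rewrite !fctE hk /bsq /dmono; ring.
rewrite (_ : bsq _ = 4^-1 *: ((fun n => (kappa n - kappa n.+1) * Lt (gseq R g) n) + bsq (mono 0 0 3 g) + bsq (mono 1 0 2 g))).
  apply: SumInZ => //; first exact: QR_natV.
  by apply: SumInD => //; [apply: SumInD => //; apply: sum_mono_e; lia|exact: sum_mono_102].
apply/funext => -[|n]; rewrite !fctE /bsq /mono /GRing.scale/=; first by rewrite Lt0; ring.
rewrite (hk n.+1) /kappa; have n1 : 1 <= n.+1%:R :> R by rewrite ler1n.
rewrite /i0 /i1 /im; set N := n.+1%:R in n1 *; field.
by apply/and3P; split; rewrite gt_eqF//; lra.
Qed.

Lemma sum_mono_021 : inVb (bsq (mono 0 2 1 g)).
Proof.
pose kappa n : R := b_ R n ^+ 2 * (im R n * im R n).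
have hk n : kappa n.+1 = b_ R n ^+ 2 * (i1 R n ^+ 2 + 2 * i1 R n ^+ 3 + i1 R n ^+ 4).
  by rewrite /kappa b_S_i1 im_S; ring.
have hs : inVb (fun n => (kappa n - kappa n.+1) * Lt (gseq R g) n).
  apply: (abel_rel (kappa_bound im_norm_le_i1 im_norm_le_i1)).
  rewrite (_ : (fun n => kappa n.+1 * gseq R g n) = 2 *: bsq (dmono 3 g) + (bsq (dmono 2 g) + bsq (dmono 4 g))).
    by apply: SumIn_comb; [|exact: QR_nat|exact: dsum|apply: SumInD => //; exact: dsum].
  by apply/funext => n; rewrite !fctE hk /bsq /dmono /GRing.scale/=; ring.
rewrite (_ : bsq _ = 2^-1 *: (2 *: bsq (mono 0 0 3 g) + ((fun n => (kappa n - kappa n.+1) * Lt (gseq R g) n) + bsq (mono 0 0 4 g)))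
    + -1 *: bsq (mono 0 1 2 g)).
  apply: SumIn_comb => //; first exact: QR_natV.
    apply: SumIn_comb => //; [exact: QR_nat|by apply: sum_mono_e; lia|].
    by apply: SumInD => //; apply: sum_mono_e; lia.
  by apply: SumInZ => //; [exact: QR_N1|exact: sum_mono_012].
apply/funext => -[|n]; rewrite !fctE /bsq /mono /GRing.scale/=; first by rewrite Lt0; ring.
rewrite (hk n.+1) /kappa; have n1 : 1 <= n.+1%:R :> R by rewrite ler1n.
rewrite /i0 /i1 /im; set N := n.+1%:R in n1 *; field.
by apply/andP; split; rewrite gt_eqF//; lra.
Qed.

Lemma sum_mono_111 : inVb (bsq (mono 1 1 1 g)).
Proof.
rewrite (_ : bsq _ = 2^-1 *: (bsq (mono 2 1 0 g) + bsq (mono 2 0 1 g))).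
  apply: SumInZ => //; first exact: QR_natV.
  by apply: SumInD => //; [exact: sum_mono_210|exact: sum_mono_201].
apply/funext => -[|n]; rewrite !fctE /bsq /mono /GRing.scale/=; first by rewrite Lt0; ring.
have n1 : 1 <= n.+1%:R :> R by rewrite ler1n.
rewrite /i0 /i1 /im; set N := n.+1%:R in n1 *; field.
by apply/and3P; split; rewrite gt_eqF//; lra.
Qed.

End Step.

Lemma Mp_of_Dp g : Dp g -> Mp g.
Proof.
move=> hD a c e W; have [n] := ubnP (a + c + e); elim: n a c e => // n IH a c e hn h3 hok.
have hV := Vb_Qmod R W.
have W4 : mixed a c e -> (4 + gwt g <= W)%N by case/and3P: hok => _ _ /implyP.
have [h4|h4] := leqP 4 (a + c + e); last first.
  move: hok W4 h4 h3 {IH hn}; case: a => [|[|[|[|a]]]]; case: c => [|[|[|[|c]]]]; case: e => [|[|[|[|e]]]] // hok W4 _ _.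
  all: try (by apply: sum_mono_e => //; case/and3P: hok).
  all: try (by apply: sum_mono_a => //; case/and3P: hok).
  all: try (by apply: sum_mono_c => //; case/and3P: hok => _ /implyP/(_ isT)).
  - exact: sum_mono_012 hD (W4 isT).
  - exact: sum_mono_021 hD (W4 isT).
  - exact: sum_mono_102 hD (W4 isT).
  - exact: sum_mono_111 (W4 isT).
  - exact: sum_mono_120 (W4 isT).
  - exact: sum_mono_201 (W4 isT).
  - exact: sum_mono_210 (W4 isT).
have red a' c' e' : (a' + c' + e' = (a + c + e).-1)%N -> (c' <= c)%N -> mixed a c e -> SumIn (Vb W) (bsq (mono a' c' e' g)).
  move=> hs hc hm; apply: IH; [lia|lia|]; have := W4 hm.
  move: hok; rewrite /mono_ok /mixed; lia.
case: a hn h3 hok W4 h4 red => [|a]; case: c => [|c]; case: e => [|e] // hn h3 hok W4 h4 red.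
- by apply: sum_mono_e => //; case/and3P: hok.
- by apply: sum_mono_c; [lia|case/and3P: hok => _ /implyP/(_ isT); lia].
- rewrite mono_imi1 (_ : bsq _ = 2^-1 *: (-1 *: bsq (mono 0 c e.+1 g) + bsq (mono 0 c.+1 e g))).
    by apply: SumInZ => //; [exact: QR_natV|apply: SumIn_comb => //; [exact: QR_N1|apply: red; rewrite /mixed//; lia..]].
  by apply/funext => m; rewrite !fctE /bsq /GRing.scale/=; ring.
- by apply: sum_mono_a; [lia|case/and3P: hok; lia].
- rewrite mono_i0i1 addrC bsq_linear; apply: SumIn_comb => //; [exact: QR_N1|apply: red; rewrite /mixed//; lia..].
- rewrite mono_i0im addrC bsq_linear; apply: SumIn_comb => //; [exact: QR_N1|apply: red; rewrite /mixed//; lia..].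
- rewrite mono_i0im addrC bsq_linear; apply: SumIn_comb => //; [exact: QR_N1|apply: red; rewrite /mixed//; lia..].
Qed.

Lemma sum_mono g : Mp g.
Proof.
apply: Mp_of_Dp; elim: g => [|[p k] g IH]; first exact: Dp_nil.
by apply: Dp_cons; exact: Mp_of_Dp.
Qed.

End MonomialSums.
Section GeneralRelations.
Variable R : realType.
Implicit Types (g : seq (bool * nat)) (f : nat -> R).

Definition DD w : set (nat -> R) := [set f | f = @delta0 R \/ exists a c e g,
  [/\ (0 < a + c + e)%N, (a + c + e + gwt g <= w)%N & f = mono R a c e g]].

Definition LD w : set (nat -> R) := [set f | (exists2 g, (gwt g <= w)%N & f = Lt (gseq R g)) \/ DD w f].

Local Notation Q := (@QR R).

Lemma Lt_linear k f f' : Lt (k *: f + f') = k *: Lt f + Lt f'.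
Proof. by apply/funext => n; have := mul_Lt_linear (fun=> 1) k f f' n; rewrite !mul1r. Qed.

Lemma LD_mono w w' f : (w <= w')%N -> kspan Q (LD w) f -> kspan Q (LD w') f.
Proof.
move=> ww; apply: kspan_sub => s [[g h ->]|[->|[a [c [e [g [h1 h2 ->]]]]]]].
- by left; exists g => //; exact: leq_trans ww.
- by right; left.
- by right; right; exists a, c, e, g; split => //; exact: leq_trans ww.
Qed.

Lemma LD_gseq w g : (gwt g <= w)%N -> kspan Q (LD w) (Lt (gseq R g)).
Proof. by move=> h; apply: kspan_in; [exact: QR_1|left; exists g]. Qed.

Lemma LD_opp w f : kspan Q (LD w) f -> kspan Q (LD w) (-1 *: f).
Proof. by apply: kspanZ; [exact: QR_M|exact: QR_N1]. Qed.

Lemma Lt_mono_LD_of g : (forall e, (0 < e)%N -> kspan Q (LD (e + gwt g)) (Lt (dmono R e g))) ->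
  forall a c e, (0 < a + c + e)%N -> kspan Q (LD (a + c + e + gwt g)) (Lt (mono R a c e g)).
Proof.
move=> hD a c e; have [n] := ubnP (a + c + e); elim: n a c e => // n IH a c e hn h0.
have red a' c' e' : (0 < a' + c' + e')%N -> (a' + c' + e' < a + c + e)%N ->
    kspan Q (LD (a + c + e + gwt g)) (Lt (mono R a' c' e' g)).
  move=> h1 h2; apply: (LD_mono _ (IH _ _ _ _ h1)); first by rewrite leq_add2r; exact: ltnW.
  exact: leq_trans h2 _.
case: a hn h0 red => [|a]; case: c => [|c]; case: e => [|e] // hn h0 red.
- rewrite mono_e addrC Lt_linear; apply: kspanD; last by apply: LD_gseq; rewrite gwt_cons; lia.
  by apply: kspanZ; [exact: QR_M|exact: QR_N1|apply: (LD_mono _ (hD e.+1 isT)); lia].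
- rewrite mono_c (_ : Lt _ = -1 *: mono R 0 c.+1 0 g + Lt (gseq R ((false, c) :: g))).
    apply: kspanD; last by apply: LD_gseq; rewrite gwt_cons; lia.
    apply: LD_opp; apply: kspan_in; first exact: QR_1.
    by right; right; exists 0%N, c.+1, 0%N, g; split => //; lia.
  by apply/funext => m; rewrite mono_c !fctE Lt_shiftr /GRing.scale/=; ring.
- rewrite mono_imi1 -[X in Lt X]addr0 Lt_linear; apply: kspanD.
    apply: kspanZ; [exact: QR_M|exact: QR_natV|].
    by rewrite addrC Lt_linear; apply: kspanD; [apply: LD_opp|]; apply: red; lia.
  by have := LD_opp (kspan0 _ (LD _)); rewrite scaler0 => h; rewrite (_ : Lt 0 = 0)//; apply/funext => m; rewrite /Lt big1.
- by rewrite mono_a; apply: LD_gseq; rewrite gwt_cons; lia.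
- by rewrite mono_i0i1 addrC Lt_linear; apply: kspanD; [apply: LD_opp|]; apply: red; lia.
- by rewrite mono_i0im addrC Lt_linear; apply: kspanD; [apply: LD_opp|]; apply: red; lia.
- by rewrite mono_i0im addrC Lt_linear; apply: kspanD; [apply: LD_opp|]; apply: red; lia.
Qed.

Lemma Lt_mono_LD g a c e : (0 < a + c + e)%N -> kspan Q (LD (a + c + e + gwt g)) (Lt (mono R a c e g)).
Proof.
elim: g a c e => [|[p k] g IH] a c e; apply: Lt_mono_LD_of => {a c}e e0.
  rewrite (_ : dmono R e [::] = gseq R [::]); first by apply: LD_gseq; lia.
  apply/funext => -[|n]; rewrite /dmono /= /delta0 ?mulr0//.
  by rewrite /i1 mulr0 add0r invr1 expr1n mul1r.
case: p; last by rewrite dmono_false; apply: LD_gseq; rewrite !gwt_cons; lia.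
by rewrite dmono_true; apply: (LD_mono _ (IH _ _ _ _)); rewrite ?gwt_cons; lia.
Qed.

Lemma LD_Lt w f : kspan Q (DD w) f -> kspan Q (LD w) (Lt f).
Proof.
apply: kspan_bind; [exact: QR_M|exact: Lt_linear|].
move=> _ [->|[a [c [e [g [h1 h2 ->]]]]]]; first by apply: (@LD_gseq _ [::]); rewrite /gwt big_nil.
by apply: (LD_mono h2); exact: Lt_mono_LD.
Qed.

Lemma LD_DD w f : kspan Q (DD w) f -> kspan Q (LD w) f.
Proof. by apply: kspan_sub => s hs; right. Qed.

Lemma LD_LtLe w f (st : bool) : kspan Q (DD w) f -> kspan Q (LD w) ((if st then @Lt R else @Le R) f).
Proof.
move=> hf; case: st; first exact: LD_Lt.
rewrite (_ : Le f = Lt f + f); last by apply/funext => n; rewrite LeE.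
by apply: kspanD; [exact: LD_Lt|exact: LD_DD].
Qed.

Lemma iv_delta0 l s : exists2 c : R, QR c & (fun n => iv R l n ^+ s * @delta0 R n) = c *: @delta0 R.
Proof.
exists (iv R l 0 ^+ s); last by apply/funext => -[|n]; rewrite !fctE /delta0 /GRing.scale/= ?mulr0.
by exists ((lin_eval l 0)%:~R^-1 ^+ s) => //; rewrite rmorphXn/= fmorphV rmorph_int.
Qed.

Definition expo (l l' : lin_fun) (s : nat) : nat :=
  match l, l' with Two, Two | TwoPlus1, TwoPlus1 | TwoMinus1, TwoMinus1 => s | _, _ => 0 end.

Lemma iv_mono l s a c e g : (fun n => iv R l n ^+ s * mono R a c e g n) =
  mono R (a + expo l Two s) (c + expo l TwoMinus1 s) (e + expo l TwoPlus1 s) g.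
Proof.
by apply/funext => n; rewrite /mono; case: l; rewrite ?iv_Two ?iv_TwoPlus1 ?iv_TwoMinus1 /= ?addn0 exprD; ring.
Qed.

Lemma iv_Lt l s g : (fun n => iv R l n ^+ s * Lt (gseq R g) n) =
  mono R (expo l Two s) (expo l TwoMinus1 s) (expo l TwoPlus1 s) g.
Proof.
rewrite -[RHS](iv_mono l s 0 0 0 g); apply/funext => n; rewrite /mono !expr0; ring.
Qed.

Lemma LD_mul_DD l s w f : (0 < s)%N -> kspan Q (LD w) f ->
  kspan Q (DD (s + w)) (fun n => iv R l n ^+ s * f n).
Proof.
move=> s0; apply: (kspan_bind (f := fun f n => iv R l n ^+ s * f n)); first exact: QR_M.
  by move=> k x y; apply/funext => n; rewrite !fctE /GRing.scale/=; ring.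
move=> _ [[g h ->]|[->|[a [c [e [g [h1 h2 ->]]]]]]].
- apply: kspan_in; first exact: QR_1.
  by rewrite iv_Lt; right; do 4 eexists; split; last reflexivity; case: l => /=; lia.
- have [c Qc ->] := iv_delta0 l s; apply: kspanZ => //; first exact: QR_M.
  by apply: kspan_in; [exact: QR_1|left].
- apply: kspan_in; first exact: QR_1.
  by rewrite iv_mono; right; do 4 eexists; split; last reflexivity; case: l => /=; lia.
Qed.

Lemma hseq_DD (t : seq step) : all (fun p : step => (0 < p.1.2)%N) t -> kspan Q (DD (hwt t)) (hseq R t).
Proof.
elim: t => [_|[[l s] st] t IH /= /andP[s0 ht]].
  by apply: kspan_in; [exact: QR_1|left].
by rewrite hwt_cons; apply: LD_mul_DD => //; apply: LD_LtLe; exact: IH.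
Qed.

Lemma sum_LD l s w f : (3 <= s)%N -> kspan Q (LD w) f ->
  SumIn (Vb (s + w + 2 * nu l)) (bsq (fun n => iv R l n ^+ s * f n)).
Proof.
move=> s3; apply: (SumIn_kspan (T := fun f => bsq (fun n => iv R l n ^+ s * f n))); first exact: Vb_Qmod.
  by move=> k x y; apply/funext => n; rewrite !fctE /bsq /GRing.scale/=; ring.
move=> _ [[g h ->]|[->|[a [c [e [g [h1 h2 ->]]]]]]].
- by rewrite iv_Lt; apply: sum_mono; rewrite /mono_ok /mixed; case: l => /=; lia.
- have [c Qc ->] := iv_delta0 l s.
  rewrite (_ : bsq _ = c *: bsq (dmono R 3 [::])).
    by apply: SumInZ => //; [exact: Vb_Qmod|apply: Dp_nil; rewrite // /gwt big_nil; lia].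
  apply/funext => -[|n]; rewrite !fctE /bsq /dmono /= /delta0 /GRing.scale/= ?mulr0//.
  by rewrite /i1 mulr0 add0r invr1; ring.
- by rewrite iv_mono; apply: sum_mono; rewrite /mono_ok /mixed; case: l => /=; lia.
Qed.

Lemma partC l s st (t : seq step) : (3 <= s)%N -> all (fun p : step => (0 < p.1.2)%N) t ->
  SumIn (Vb (hwt ((l, s, st) :: t) + 2 * nu l)) (bsq (hseq R ((l, s, st) :: t))).
Proof. by move=> s3 ht; rewrite hwt_cons; apply: sum_LD => //; apply: LD_LtLe; exact: hseq_DD. Qed.

End GeneralRelations.

Section Translation.
Variable R : realType.

Fixpoint flist (T : Type) d : ('I_d -> T) -> seq T :=
  match d with
  | 0 => fun=> [::]
  | d'.+1 => fun F => F ord0 :: flist (fun j => F (lift ord0 j))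
  end.

Definition steps d (l : 'I_d -> lin_fun) (s : 'I_d -> nat) (st : 'I_d -> bool) : seq step :=
  flist (fun j => (l j, s j, st j)).

Lemma nested_hseq d (l : 'I_d -> lin_fun) s st :
  nested_seq st (fun j m => iv R (l j) m ^+ s j) = hseq R (steps l s st).
Proof.
elim: d l s st => [|d IH] l s st; first by apply/funext.
by apply/funext => n /=; rewrite /steps/= -[flist _]/(steps _ _ _) -IH.
Qed.

Lemma hwt_steps d (l : 'I_d -> lin_fun) s st : hwt (steps l s st) = (\sum_(j < d) s j)%N.
Proof.
elim: d l s st => [|d IH] l s st; first by rewrite big_ord0 /hwt big_nil.
by rewrite big_ord_recl /steps/= hwt_cons -[flist _]/(steps _ _ _) IH.
Qed.

Lemma steps_pos d (l : 'I_d -> lin_fun) s st : (forall j, (0 < s j)%N) ->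
  all (fun p : step => (0 < p.1.2)%N) (steps l s st).
Proof.
elim: d l s st => [|d IH] l s st h //=.
by rewrite h/= -[flist _]/(steps _ _ _) IH.
Qed.

Lemma goodA_steps d (l : 'I_d -> lin_fun) s : (forall j, (0 < s j)%N) ->
  (forall i j : 'I_d, j = i.+1 :> nat -> l j = TwoMinus1 -> l i <> Two) ->
  goodA (steps l s (fun j => default_strict (l j))).
Proof.
elim: d l s => [|d IH] l s hs hl //=; split => //.
  by apply: (IH (fun j => l (lift ord0 j)) (fun j => s (lift ord0 j))) => // i j ij; apply: hl; rewrite /= /bump/= ij.
by case: d l s hs hl {IH} => [|d] l s hs hl //=; exact: hl.
Qed.

Lemma binom_partialE d (l : 'I_d.+1 -> lin_fun) s st :
  binom_partial R l s st = series (bsq (hseq R (steps l s st))).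
Proof.
apply/funext => N; rewrite /binom_partial /series/= big_mkord.
pose f (j : 'I_d.+1) m : R := (if j == ord0 then b_ R m ^+ 2 else 1) * iv R (l j) m ^+ s j.
transitivity (nested_sum st (fun n => \prod_(j < d.+1) f j (n j)) N).
  apply: eq_bigr => n _; rewrite /binom_term big_split/= -prodfV; congr (_ * _).
    rewrite big_ord_recl /= big1 ?mulr1// => j _.
  by apply: eq_bigr => j _; rewrite /iv exprVn.
have e : (fun j => f (lift ord0 j)) = (fun j m => iv R (l (lift ord0 j)) m ^+ s (lift ord0 j)).
  by apply/funext => j; apply/funext => m; rewrite /f -val_eqE/= mul1r.
rewrite nested_sumE /Lt; apply: eq_bigr => m _.
by rewrite /bsq -nested_hseq /= e {1}/f eqxx mulrA.
Qed.

End Translation.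
Theorem theorem4p7 (R : realType) (d : nat)
    (s : 'I_d.+1 -> nat) (l : 'I_d.+1 -> lin_fun)
    (s_pos : forall j, (0 < s j)%N) (s1_ge3 : (3 <= s ord0)%N) :
  let w := (\sum_(j < d.+1) s j)%N in
  let strict0 := fun j => default_strict (l j) in
  let T := (binom_series R l s strict0)%:C%C : Cplx R in
  let no_Two_before_TwoMinus1 := forall i j : 'I_d.+1,
    j = i.+1 :> nat -> l j = TwoMinus1 -> l i <> Two in
  cvgn (binom_partial R l s strict0) /\
  (* (a) *)
  (l ord0 <> TwoMinus1 -> no_Two_before_TwoMinus1 -> CMZV4 w T) /\
  (l ord0 = TwoPlus1 -> (forall j, l j <> Two) -> CMZV4 w T) /\
  (l ord0 = TwoMinus1 -> no_Two_before_TwoMinus1 ->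
    add_spaces (add_spaces (CMZV4 w) (CMZV4 w.+1)) (CMZV4 w.+2) T) /\
  (* (b) *)
  tensor_Qi (CMZV4_le (w + 2 * nu (l ord0))) T /\
  (* (c) *)
  (forall strict : 'I_d.+1 -> bool, terms_defined l strict ->
    cvgn (binom_partial R l s strict) /\
    tensor_Qi (CMZV4_le (w + 2 * nu (l ord0)))
      ((binom_series R l s strict)%:C%C : Cplx R)).
Proof.
have stE st : steps l s st = (l ord0, s ord0, st ord0) ::
    steps (fun j => l (lift ord0 j)) (fun j => s (lift ord0 j)) (fun j => st (lift ord0 j)) by [].
have lim st y : series (bsq (hseq R (steps l s st))) @ \oo --> y ->
    cvgn (binom_partial R l s st) /\ (binom_series R l s st)%:C%C = inC y.
  rewrite -binom_partialE => c; split; first exact: cvgP c.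
  by rewrite /binom_series (cvg_lim _ c).
move=> w strict0 T noTwo.
have bound st : cvgn (binom_partial R l s st) /\
    tensor_Qi (CMZV4_le (w + 2 * nu (l ord0))) ((binom_series R l s st)%:C%C : Cplx R).
  have [|y Vy c] := @partC R (l ord0) (s ord0) (st ord0)
    (steps (fun j => l (lift ord0 j)) (fun j => s (lift ord0 j)) (fun j => st (lift ord0 j))) s1_ge3.
    exact: steps_pos.
  have [h1 h2] := lim st y c; split => //.
  by rewrite h2; move: Vy; rewrite -stE hwt_steps.
have caseA : l ord0 <> TwoMinus1 -> noTwo -> CMZV4 w T.
  move=> l0 /(goodA_steps s_pos) hg; rewrite stE in hg.
  have [y Vy c] := partA R s1_ge3 hg l0.
  by rewrite /T (lim strict0 _ c).2; move: Vy; rewrite -(stE strict0) hwt_steps.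
split; first by case: (bound strict0).
split; first exact: caseA.
split.
  move=> l0 hl; apply: caseA; first by rewrite l0.
  by move=> i j _ _; exact: hl.
split; last by split; [case: (bound strict0)|move=> st _; exact: bound].
move=> l0 /(goodA_steps s_pos) hg; rewrite stE l0 in hg.
have [y0 [y1 [y2 [V0 V1 V2 c]]]] := partA_minus R s1_ge3 hg.
rewrite -l0 -(stE strict0) hwt_steps in V0 V1 V2 c.
rewrite /T (lim _ _ c).2 !inC_D; exists (inC y0 + inC y1); last by exists (inC y2).
by exists (inC y0) => //; exists (inC y1).
Qed.
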